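(* Let $\mu$ be a smooth volume form on $M$, and let $\gamma(t)=\pi(e^{t\vec H}(\lambda))$ be an ample and equiregular geodesic with initial covector $\lambda\in T^*_{x_0}M$. Let $Y_1,\dots,Y_k$ be an orthonormal basis of $\mathcal D$ in a neighborhood of $x_0$ and choose vector fields $Y_{k+1},\dots,Y_n$ such that $Y_1,\dots,Y_n$ is a local basis of $TM$ with $\mu(Y_1,\dots,Y_n)=1$. Let $M_i(t)$, $i=1,\dots,m$, be the symmetric operators defined, for $t$ small, through the inner product on $TM$ for which $Y_1,\dots,Y_n$ is orthonormal. Then $$\rho(\lambda)=\frac12\sum_{i=1}^m\mathrm{tr}\left(M_i(0)^{-1}\dot M_i(0)\right).$$
   Context: Setting. $M$ is a connected smooth $n$-dimensional manifold, $X_0,X_1,\dots,X_k$ ($k\le n$) are smooth vector fields on $M$ and $Q$ is a smooth function on $M$. It is assumed that $X_1,\dots,X_k$ are everywhere linearly independent and that $\mathrm{Lie}\{(\mathrm{ad}\,X_0)^jX_i: i=1,\dots,k,\ j\ge0\}|_x=T_xM$ for all $x\in M$, where $(\mathrm{ad}\,Y)X=[Y,X]$. $\mathcal D_x=\mathrm{span}\{X_1,\dots,X_k\}|_x$ is endowed with the inner product making $X_1,\dots,X_k$ orthonormal; $\Gamma(\mathcal D)$ denotes smooth sections of $\mathcal D$. The Hamiltonian is $H(p,x)=\tfrac12\sum_{i=1}^k\langle p,X_i(x)\rangle^2+\langle p,X_0(x)\rangle+\tfrac12Q(x)$ on $T^*M$, with Hamiltonian vector field $\vec H=\sum_j \frac{\partial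 H}{\partial p_j}\frac{\partial}{\partial x_j}-\frac{\partial H}{\partial x_j}\frac{\partial}{\partial p_j}$ and flow $e^{t\vec H}$; $\pi:T^*M\to M$ is the projection. A geodesic with initial covector $\lambda$ is $\gamma(t)=\pi(e^{t\vec H}(\lambda))$. Flag. An admissible extension of $\dot\gamma$ is a vector field $\mathsf T=X_0+X$, $X\in\Gamma(\mathcal D)$, with $\mathsf T(\gamma(t))=\dot\gamma(t)$. The flag of $\gamma$ is $\mathcal F^i_{\gamma(t)}=\mathrm{span}\{\mathcal L^j_{\mathsf T}(X)|_{\gamma(t)}: X\in\Gamma(\mathcal D),\ j\le i-1\}$, $i\ge1$, $\mathcal F^0=\{0\}$ (independent of $\mathsf T$). $\gamma$ is equiregular if each $\dim\mathcal F^i_{\gamma(t)}$ is independent of $t$, and ample if for every $t$ there is $m$ with $\mathcal F^m_{\gamma(t)}=T_{\gamma(t)}M$. For an ample equiregular geodesic, $m$ is the smallest such integer, $d_i=\dim\mathcal F^i_{\gamma(t)}-\dim\mathcal F^{i-1}_{\gamma(t)}$, $\mathcal N(\lambda)=\sum_{i=1}^m(2i-1)d_i$, and the Lie derivative along $\mathsf T$ induces well-defined surjective linear maps $\mathcal L_{\mathsf T}:\mathcal F^i_{\gamma(t)}/\mathcal F^{i-1}_{\gamma(t)}\to\mathcal F^{i+1}_{\gamma(t)}/\mathcal F^i_{\gamma(t)}$, $v\mapsto[\mathsf T,X]|_{\gamma(t)}$ (where $X$ extends $v$ with $X|_{\gamma(s)}\in\mathcal F^i_{\gamma(s)}$), hence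 surjective maps $\mathcal L_{\mathsf T}^{i-1}:\mathcal D_{\gamma(t)}\to\mathcal F^i_{\gamma(t)}/\mathcal F^{i-1}_{\gamma(t)}$, independent of the extensions ($\mathcal L^0_{\mathsf T}$ is the identity of $\mathcal D_{\gamma(t)}=\mathcal F^1_{\gamma(t)}$). Operators $M_i(t)$. With respect to the inner product for which $Y_1,\dots,Y_n$ is orthonormal, set $V_i=\mathcal F^i_{\gamma(t)}\cap(\mathcal F^{i-1}_{\gamma(t)})^\perp\simeq\mathcal F^i_{\gamma(t)}/\mathcal F^{i-1}_{\gamma(t)}$, which carries the restricted inner product. Then $\mathcal L_{\mathsf T}^{i-1}$ descends to an isomorphism $\mathcal D_{\gamma(t)}/\ker\mathcal L_{\mathsf T}^{i-1}\to V_i$, where $\mathcal D_{\gamma(t)}/\ker\mathcal L_{\mathsf T}^{i-1}$ has the quotient inner product, and $M_i(t)=(\mathcal L^{i-1}_{\mathsf T})^*\circ\mathcal L^{i-1}_{\mathsf T}:\mathcal D_{\gamma(t)}/\ker\mathcal L_{\mathsf T}^{i-1}\to\mathcal D_{\gamma(t)}/\ker\mathcal L_{\mathsf T}^{i-1}$, a smooth family of symmetric invertible operators. $\dot M_i$ is the derivative of the matrix of $M_i(t)$ in any smooth orthonormal frame of $\mathcal D_{\gamma(t)}/\ker\mathcal L^{i-1}_{\mathsf T}$ along $\gamma$ (the trace in the formula does not depend on the frame). Volume geodesic derivative. For $\lambda\in T_x^*M$ let $\mathcal V_\lambda=T_\lambda(T_x^*M)\simeq T_x^*M$, and let $\mu_\lambda^*$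 be the volume form on $\mathcal V_\lambda$ induced by the volume form $\mu_x^*$ on $T_x^*M$ with $\mu_x^*(\mu_x)=1$. Write $(\pi\circ e^{t\vec H})^*\mu|_{\mathcal V_\lambda}=f_\lambda(t)\mu^*_\lambda$; then $\rho(\lambda)=\frac{d}{dt}|_{t=0}\log(t^{-\mathcal N(\lambda)}f_\lambda(t))$. *)

(* Defs.v *)
From HB Require Import structures.
From mathcomp Require Import all_boot all_order all_algebra.
From mathcomp Require Import all_classical all_reals all_analysis.

Set Implicit Arguments.
Unset Strict Implicit.
Unset Printing Implicit Defensive.

Import Order.TTheory GRing.Theory Num.Theory.
Import numFieldNormedType.Exports.

Local Open Scope classical_set_scope.
Local Open Scope ring_scope.

(* Conventions. Vectors and covectors are row vectors. jacobian f u is the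
   matrix of the differential acting on the right, so a tangent vector v with
   coordinates at u is pushed forward to v *m jacobian f u. *)

Section SmoothMaps.
Context {R : realType} {V W : normedModType R}.

(* Meant for open A.  In finite dimension the differential of f is C^k if and
   only if all the directional derivatives of f are. *)
Fixpoint Ck (k : nat) (A : set V) (f : V -> W) : Prop :=
  if k is k'.+1 then
    (forall x, A x -> differentiable f x) /\
    (forall v : V, Ck k' A (fun x => 'D_v f x))
  else forall x, A x -> {for x, continuous f}.

Definition smooth_on (A : set V) (f : V -> W) : Prop := forall k, Ck k A f.

End SmoothMaps.

(* The functions chart_map a and param a are total, but meaningful only on dom a
   and on its image; they are mutually inverse homeomorphisms there.  chart_at
   selects a chart around each point, in which tangent vectors and covectors
   at that point are expressed. *)
Record smoothManifold (R : realType) (n : nat) := SmoothManifold {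
  manifold_sort :> topologicalType;
  chart : Type;
  dom : chart -> set manifold_sort;
  chart_map : chart -> manifold_sort -> 'rV[R]_n;
  param : chart -> 'rV[R]_n -> manifold_sort;
  chart_at : manifold_sort -> chart;
  manifold_hausdorff : hausdorff_space manifold_sort;
  manifold_second_countable : @second_countable manifold_sort;
  dom_chart_at : forall x, dom (chart_at x) x;
  open_dom : forall a, open (dom a);
  open_chart_map_dom : forall a, open (chart_map a @` dom a);
  chart_mapK : forall a x, dom a x -> param a (chart_map a x) = x;
  chart_map_continuous : forall a x, dom a x -> {for x, continuous (chart_map a)};
  param_continuous : forall a u, (chart_map a @` dom a) u ->
    {for u, continuous (param a)};
  transition_smooth : forall a b,
    smooth_on (chart_map a @` (dom a `&` dom b)) (chart_map b \o param a)
}.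

Section Fields.
Context {R : realType} {n : nat} {M : smoothManifold R n}.

Definition trans (a b : chart M) : 'rV[R]_n -> 'rV[R]_n := chart_map b \o param a.

Definition smooth_function (Q : M -> R) : Prop :=
  forall a, smooth_on (chart_map a @` dom a) (fun u => Q (param a u) : R^o).

(* Vector fields are given by their local expressions in all the charts. *)
Definition vfield := chart M -> 'rV[R]_n -> 'rV[R]_n.

Definition smooth_vfield_on (U : set M) (Z : vfield) : Prop :=
  (forall a, smooth_on (chart_map a @` (dom a `&` U)) (Z a)) /\
  (forall a b x, U x -> dom a x -> dom b x ->
     Z b (chart_map b x) = Z a (chart_map a x) *m jacobian (trans a b) (chart_map a x)).

Definition smooth_vfield (Z : vfield) : Prop := smooth_vfield_on setT Z.

Definition addvf (Z1 Z2 : vfield) : vfield := fun a u => Z1 a u + Z2 a u.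

Definition scalevf (c : R) (Z : vfield) : vfield := fun a u => c *: Z a u.

(* The Lie bracket [Z1, Z2]; thus lie T is ad T, the Lie derivative along T. *)
Definition lie (Z1 Z2 : vfield) : vfield :=
  fun a u => 'D_(Z1 a u) (Z2 a) u - 'D_(Z2 a u) (Z1 a) u.

(* The value at x, with coordinates in the selected chart. *)
Definition ev (Z : vfield) (x : M) : 'rV[R]_n :=
  Z (chart_at x) (chart_map (chart_at x) x).

Definition frame_mx {p : nat} (Z : 'I_p -> vfield) (x : M) : 'M[R]_(p, n) :=
  \matrix_(i < p) ev (Z i) x.

Inductive Lie_algebra (G : set vfield) : vfield -> Prop :=
| Lie_gen Z : G Z -> Lie_algebra G Z
| Lie_zero : Lie_algebra G (fun _ _ => 0)
| Lie_add Z1 Z2 : Lie_algebra G Z1 -> Lie_algebra G Z2 ->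
    Lie_algebra G (addvf Z1 Z2)
| Lie_scale c Z : Lie_algebra G Z -> Lie_algebra G (scalevf c Z)
| Lie_bracket Z1 Z2 : Lie_algebra G Z1 -> Lie_algebra G Z2 ->
    Lie_algebra G (lie Z1 Z2).

(* The volume form with expression mu a u du_1 /\ ... /\ du_n in the chart a. *)
Definition vform := chart M -> 'rV[R]_n -> R.

Definition volume_form (mu : vform) : Prop :=
  [/\ forall a, smooth_on (chart_map a @` dom a) (mu a : 'rV[R]_n -> R^o),
      forall a u, (chart_map a @` dom a) u -> mu a u != 0 &
      forall a b x, dom a x -> dom b x ->
        mu a (chart_map a x) =
        mu b (chart_map b x) * \det (jacobian (trans a b) (chart_map a x))].

Definition vform_density (mu : vform) (x : M) : R :=
  mu (chart_at x) (chart_map (chart_at x) x).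

(* The value of mu on n vectors of T_x M, the rows of A. *)
Definition vform_eval (mu : vform) (x : M) (A : 'M[R]_n) : R :=
  vform_density mu x * \det A.

End Fields.

Arguments vfield {R n} M.
Arguments vform {R n} M.

Section ControlAffine.
Context {R : realType} {n k : nat} {M : smoothManifold R n}.
Variables (X0 : vfield M) (X : 'I_k -> vfield M).

Definition everywhere_independent : Prop := forall x, row_free (frame_mx X x).

Definition Lie_condition : Prop :=
  forall (x : M) (v : 'rV[R]_n), exists2 Z,
    Lie_algebra [set Z | exists i j, Z = iter j (lie X0) (X i)] Z & ev Z x = v.

(* The smooth sections of the distribution D. *)
Definition section (V : vfield M) : Prop :=
  smooth_vfield V /\ forall x, (ev V x <= frame_mx X x)%MS.

(* The inner product on D is the one for which the X_i are orthonormal: a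
   basis of D_x is orthonormal when the change of basis is orthogonal. *)
Definition orthonormal_basis_on (U : set M) (Y : 'I_k -> vfield M) : Prop :=
  forall x, U x -> exists2 O : 'M[R]_k,
    O *m O^T = 1%:M & frame_mx Y x = O *m frame_mx X x.

End ControlAffine.

Section Hamiltonian.
Context {R : realType} {n k : nat} {M : smoothManifold R n}.
Variables (X0 : vfield M) (X : 'I_k -> vfield M) (Q : M -> R).

Definition pairing (p v : 'rV[R]_n) : R := (p *m v^T) 0 0.

(* (x, p) is the covector at x with components p in the chart chart_at x. *)
Definition cotangent : Type := (M * 'rV[R]_n)%type.

(* The chart of T^*M induced by the chart a, and its inverse. *)
Definition ct_coord (a : chart M) (z : cotangent) : 'rV[R]_n * 'rV[R]_n :=
  (chart_map a z.1,
   z.2 *m (jacobian (trans a (chart_at z.1)) (chart_map a z.1))^T).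

Definition ct_param (a : chart M) (w : 'rV[R]_n * 'rV[R]_n) : cotangent :=
  let x := param a w.1 in
  (x, w.2 *m (jacobian (trans (chart_at x) a) (chart_map (chart_at x) x))^T).

Definition ham (a : chart M) (p u : 'rV[R]_n) : R :=
  2^-1 * (\sum_(i < k) pairing p (X i a u) ^+ 2) + pairing p (X0 a u)
  + 2^-1 * Q (param a u).

Definition dham_dp (a : chart M) (p u : 'rV[R]_n) : 'rV[R]_n :=
  \row_j 'D_(delta_mx 0 j) (fun q => ham a q u : R^o) p.

Definition dham_dx (a : chart M) (p u : 'rV[R]_n) : 'rV[R]_n :=
  \row_j 'D_(delta_mx 0 j) (fun v => ham a p v : R^o) u.

(* Hamilton's equations at time t.  The continuity requirement keeps the curve
   in the domain of the chart for times close to t. *)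
Definition hamilton_at (z : R -> cotangent) (t : R) : Prop :=
  let a := chart_at (z t).1 in
  let x s := (ct_coord a (z s)).1 in
  let p s := (ct_coord a (z s)).2 in
  [/\ {for t, continuous (fun s => (z s).1)},
      is_derive (t : R^o) (1 : R^o) x (dham_dp a (p t) (x t)) &
      is_derive (t : R^o) (1 : R^o) p (- dham_dx a (p t) (x t))].

(* A smooth flow e^{t H} of the Hamiltonian vector field, with (open) domain
   dPhi containing {0} x T^*M; it need not be maximal. *)
Record hamiltonian_flow (dPhi : set (R * cotangent))
    (Phi : R -> cotangent -> cotangent) : Prop := {
  flow_init : forall z, dPhi (0, z) /\ Phi 0 z = z;
  flow_interval : forall z, is_interval [set t | dPhi (t, z)];
  flow_hamilton : forall t z, dPhi (t, z) -> hamilton_at (Phi^~ z) t;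
  flow_smooth : forall t z a b,
    dPhi (t, z) -> dom a z.1 -> dom b (Phi t z).1 ->
    exists A : set (R^o * ('rV[R]_n * 'rV[R]_n)),
      [/\ open A, A (t, ct_coord a z),
          forall s w, A (s, w) ->
            [/\ (chart_map a @` dom a) w.1, dPhi (s, ct_param a w) &
                dom b (Phi s (ct_param a w)).1] &
          smooth_on A (fun y => ct_coord b (Phi y.1 (ct_param a y.2)))]
}.

(* f_lam(t): the ratio on T_lam(T_x^*M) of the pull-back of mu by pi o e^{tH}
   and of mu^*, both evaluated on the basis dual to the coordinate basis of
   T_x M.  As mu^*_x(mu_x) = 1, the form mu^*_x takes there the value
   (vform_density mu x)^-1. *)
Definition fiber_volume (mu : vform M) (Phi : R -> cotangent -> cotangent)
    (lam : cotangent) (t : R) : R :=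
  let y := (Phi t lam).1 in
  let expmap p := chart_map (chart_at y) (Phi t (lam.1, p)).1 in
  vform_eval mu y (jacobian expmap lam.2) / (vform_density mu lam.1)^-1.

(* rho is the derivative at 0 of log (t^(-N) f(t)), once t^(-N) f(t) has been
   extended to t = 0 by its limit. *)
Definition is_volume_geodesic_derivative (f : R -> R) (N : nat) (rho : R) :=
  exists2 c : R, 0 < c &
    is_derive (0 : R^o) (1 : R^o)
      (fun t => ln (if t == 0 then c else t ^- N * f t) : R^o) rho.

End Hamiltonian.

Arguments cotangent {R n} M.

Section Span.
Context {R : realType} {n : nat}.

(* A matrix whose row space is the linear span of S. *)
Definition span_mx (S : set 'rV[R]_n) : 'M[R]_n :=
  xget 0 [set A : 'M[R]_n | (forall v, S v -> (v <= A)%MS) /\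
    forall B : 'M[R]_n, (forall v, S v -> (v <= B)%MS) -> (A <= B)%MS].

Lemma span_mxP (S : set 'rV[R]_n) :
  (forall v, S v -> (v <= span_mx S)%MS) /\
  forall B : 'M[R]_n, (forall v, S v -> (v <= B)%MS) -> (span_mx S <= B)%MS.
Proof.
pose P (A : 'M[R]_n) :=
  forall B : 'M[R]_n, (forall v, S v -> (v <= B)%MS) -> (A <= B)%MS.
rewrite /span_mx.
suff [A [SA PA]] : exists A : 'M[R]_n, (forall v, S v -> (v <= A)%MS) /\ P A.
  by case: xgetP => [B _ [] //|/(_ A)[]].
have exr : exists r, `[<exists2 A, P A & \rank A = r>].
  by exists 0%N; apply/asboolP; exists 0; rewrite ?mxrank0// => B _; exact: sub0mx.
have ubr r : `[<exists2 A, P A & \rank A = r>] -> (r <= n)%N.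
  by move=> /asboolP[A _ <-]; exact: rank_leq_row.
case: (ex_maxnP exr ubr) => r /asboolP[A PA rA] maxr.
exists A; split=> // v Sv.
have AAv : (A <= A + v)%MS by exact: addsmxSl.
have : (\rank (A + v)%MS <= \rank A)%N.
  rewrite rA; apply: maxr; apply/asboolP; exists (A + v)%MS => // B SB.
  by rewrite addsmx_sub PA //= SB.
rewrite (geq_leqif (mxrank_leqif_sup AAv)) => AvA.
exact: submx_trans (addsmxSr A v) AvA.
Qed.

End Span.

Section Flag.
Context {R : realType} {n k : nat} {M : smoothManifold R n}.
Variables (X0 : vfield M) (X : 'I_k -> vfield M).
Variables (gam : R -> M) (I : set R).

Definition admissible_extension (T : vfield M) : Prop :=
  (exists2 V, section X V & T = addvf X0 V) /\
  forall t, I t ->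
    is_derive (t : R^o) (1 : R^o) (fun s => chart_map (chart_at (gam t)) (gam s))
      (ev T (gam t)).

Variable T : vfield M.

(* The row space of flag i t is F^i at gam t. *)
Definition flag (i : nat) (t : R) : 'M[R]_n :=
  span_mx [set v | exists j V,
    [/\ (j < i)%N, section X V & v = ev (iter j (lie T) V) (gam t)]].

Definition equiregular : Prop :=
  forall i s t, I s -> I t -> \rank (flag i s) = \rank (flag i t).

Definition ample : Prop := forall t, I t -> exists m, row_full (flag m t).

Definition is_step (m : nat) : Prop :=
  (forall t, I t -> row_full (flag m t)) /\
  forall l, (forall t, I t -> row_full (flag l t)) -> (m <= l)%N.

Definition growth (i : nat) : nat :=
  (\rank (flag i 0) - \rank (flag i.-1 0))%N.

Definition geodesic_dimension (m : nat) : nat :=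
  \sum_(1 <= i < m.+1) (2 * i - 1) * growth i.

(* From here on, tangent vectors along gam are replaced by their components in
   the frame Y, for which the inner product making Y orthonormal is the
   standard one, v *m w^T. *)
Variable Y : 'I_n -> vfield M.

Definition ycomp {p : nat} (t : R) (A : 'M[R]_(p, n)) : 'M[R]_(p, n) :=
  A *m invmx (frame_mx Y (gam t)).

Definition distr_comp (t : R) : 'M[R]_(k, n) := ycomp t (frame_mx X (gam t)).

(* The representative in V_i = F^i \cap (F^(i-1))^perp of L_T^(i-1) v, for v in
   D: extend v to a section V of D and project the iterated Lie derivative of V
   onto (F^(i-1))^perp along F^(i-1).  The value does not depend on V. *)
Definition Lmap (i : nat) (t : R) (v : 'rV[R]_n) : 'rV[R]_n :=
  let F := ycomp t (flag i.-1 t) in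
  xget 0 [set w | exists2 V, section X V /\ ycomp t (ev V (gam t)) = v &
    w = ycomp t (ev (iter i.-1 (lie T) V) (gam t)) *m proj_mx (kermx F^T) F].

(* The rows of E form an orthonormal basis of D / ker L_T^(i-1), identified
   isometrically, as the quotient inner product prescribes, with the orthogonal
   complement of ker L_T^(i-1) in D. *)
Definition quotient_basis (i : nat) (t : R) {d : nat} (E : 'M[R]_(d, n)) :=
  E *m E^T = 1%:M /\
  forall v : 'rV[R]_n, (v <= E)%MS <->
    (v <= distr_comp t)%MS /\
    (forall w : 'rV[R]_n, (w <= distr_comp t)%MS -> Lmap i t w = 0 ->
       v *m w^T = 0).

(* The matrix of L_T^(i-1) from the orthonormal basis E to V_i. *)
Definition Lmx (i : nat) (t : R) {d : nat} (E : 'M[R]_(d, n)) : 'M[R]_(d, n) :=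
  \matrix_(j < d) Lmap i t (row j E).

(* The matrix of M_i(t) = (L_T^(i-1))^* o L_T^(i-1) in the basis E. *)
Definition Mmx (i : nat) (t : R) {d : nat} (E : 'M[R]_(d, n)) : 'M[R]_d :=
  Lmx i t E *m (Lmx i t E)^T.

Definition smooth_quotient_frame (i : nat) {d : nat} (E : R -> 'M[R]_(d, n)) :=
  exists2 e : R, 0 < e &
    smooth_on (ball (0 : R^o) e) (E : R^o -> 'M[R]_(d, n)) /\
    forall t : R, ball (0 : R^o) e t -> quotient_basis i t (E t).

Definition trace_term (i : nat) {d : nat} (E : R -> 'M[R]_(d, n)) : R :=
  let Mi t := Mmx i t (E t) in \tr (invmx (Mi 0) *m derive1 Mi 0).

End Flag.

(* Main.v *)
(** Let A(t) and B(t) be the derivatives of the base and fibre coordinates of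
e^{tH} lam with respect to the initial covector. They solve the linearized
Hamiltonian system A' = A a + B b, B' = - A c - B a^T, A(0) = 0, B(0) = 1, with
c symmetric and b = D^T D, where the rows of D span the distribution and are
orthonormal. As mu(Y) = 1, f(t) is det A(t) computed in the frame Y. Now pass to
the frame whose blocks of weight w = 0, ..., m - 1 are the images under L_T^w of
the given orthonormal frames of D / ker L_T^w. In this frame b is the projector
onto the block of weight 0, while a raises the weight by at most one, with a
leading part given by the scalar products of the quotient frames. A Taylor
expansion then yields A_xy(t) = t^(w_x + w_y + 1) K_xy(t): det K(0) is positive,
being a constant multiple of a Hilbert-type determinant, and (det K)'(0) = 0
because the fundamental solution is symplectic. Hence rho is the logarithmic
derivative at 0 of the determinant of the adapted frame, and the square of this
determinant is the product of the det M_i. *)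

Require Import Defs.
From HB Require Import structures.
From mathcomp Require Import all_boot all_order all_algebra.
From mathcomp Require Import all_classical all_reals all_analysis.
From mathcomp Require Import perm ring lra zify.

Set Implicit Arguments.
Unset Strict Implicit.
Unset Printing Implicit Defensive.

Import Order.TTheory GRing.Theory Num.Theory.
Import numFieldNormedType.Exports.

Local Open Scope classical_set_scope.
Local Open Scope ring_scope.

(** * Smooth functions of one real variable *)

(** The bound on [a] rests on the admissible extension. For a frozen covector, the Hamiltonian
    velocity and [T] are both the drift plus a section of the distribution D, and they agree on the
    geodesic; hence their linearizations differ by terms with values in D. Up to weight 0, [a] is
    therefore minus the Lie derivative along [T] of the adapted frame, which moves the flag by one
    step. That (det K)'(0) = 0 takes two facts. The leading Taylor coefficient of the fundamental
    solution started at t has a determinant independent of t, since the scalar products of the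
    quotient frames disappear from it. Moreover, comparing the fundamental solution with its
    symplectic inverse expresses the transpose of the next coefficient through that coefficient and
    the t-derivative of the leading one. The logarithmic derivative of det K at 0 then equals its
    own opposite. The determinant is computed by triangular factors: (-1)^j / (i+j+1)! is the
    integral over [0, 1] of t^i/i! times (t-1)^j/j!, and both functions are expanded in shifted
    Legendre polynomials. *)

Lemma fun_big_nil {T S J : Type} (op : S -> S -> S) (idx : S) (P : pred J)
    (F : J -> T -> S) :
  (fun t => \big[op/idx]_(j <- [::] | P j) F j t) = fun=> idx.
Proof. by apply/funext => t; rewrite big_nil. Qed.

Lemma fun_big_cons {T S J : Type} (op : S -> S -> S) (idx : S) (P : pred J)
    (F : J -> T -> S) j r :
  (fun t => \big[op/idx]_(i <- j :: r | P i) F i t) =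
  if P j then fun t => op (F j t) (\big[op/idx]_(i <- r | P i) F i t)
  else fun t => \big[op/idx]_(i <- r | P i) F i t.
Proof. by case: ifPn => Pj; apply/funext => t; rewrite big_cons ?Pj// (negPf Pj). Qed.

Section SmoothCurves.
Context {R : realType}.
Implicit Types (O : set R) (f g : R -> R).

Fact dable_key : unit. Proof. by []. Qed.
(** Locked, lest unification unfold derivability into the existence of a limit. *)
Definition dable f x := locked_with dable_key (derivable f x 1).

Lemma dableE f x : dable f x = derivable f x 1.
Proof. by rewrite /dable unlock. Qed.

(** Order 0 asks for nothing: the notion of interest is the intersection [smooth1] of all orders,
    where every derivative is differentiable and so continuous. *)
Fixpoint sm (k : nat) O f : Prop :=
  if k is k'.+1 then (forall x, O x -> dable f x) /\ sm k' O f^`()%classic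
  else True.

Definition smooth1 O f := forall k, sm k O f.

Lemma smooth1P O f :
  smooth1 O f <-> (forall x, O x -> dable f x) /\ smooth1 O f^`()%classic.
Proof.
split=> [sf|[df sf] [|k]] //; split; first by have [] := sf 1%N.
by move=> k; have [] := sf k.+1.
Qed.

Lemma derivable_smooth1 O f x : smooth1 O f -> O x -> dable f x.
Proof. by move=> /smooth1P[+ _]; apply. Qed.

Lemma smooth1_derive1 O f : smooth1 O f -> smooth1 O f^`()%classic.
Proof. by move=> /smooth1P[]. Qed.

Lemma smooth1_derive1n O f k : smooth1 O f -> smooth1 O f^`(k)%classic.
Proof. by move=> sf; elim: k => // k IH; rewrite derive1nS; exact: smooth1_derive1. Qed.

Lemma smW k O f : sm k.+1 O f -> sm k O f.
Proof. by elim: k f => // k IH f [df /IH sf]. Qed.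

Lemma eq_on_derivable O f g x : open O -> {in O, f =1 g} -> O x ->
  dable f x -> dable g x.
Proof.
move=> oO fg Ox; rewrite !dableE; apply: near_eq_derivable.
by near=> y; apply: fg; rewrite inE; near: y; exact: open_nbhs_nbhs.
Unshelve. all: by end_near. Qed.

Lemma eq_on_derive1 O f g x : open O -> {in O, f =1 g} -> O x ->
  f^`()%classic x = g^`()%classic x.
Proof.
move=> oO fg Ox; rewrite !derive1E; apply: near_eq_derive.
by near=> y; apply: fg; rewrite inE; near: y; exact: open_nbhs_nbhs.
Unshelve. all: by end_near. Qed.

Lemma eq_on_sm k O f g : open O -> {in O, f =1 g} -> sm k O f -> sm k O g.
Proof.
move=> oO; elim: k f g => // k IH f g fg [df sf]; split.
  by move=> x Ox; exact: (eq_on_derivable oO fg Ox (df x Ox)).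
apply: (IH f^`()%classic) => // x; rewrite inE => Ox.
exact: (eq_on_derive1 oO fg Ox).
Qed.

Lemma eq_on_smooth1 O f g : open O -> {in O, f =1 g} -> smooth1 O f -> smooth1 O g.
Proof. by move=> oO fg sf k; exact: (eq_on_sm oO fg (sf k)). Qed.

Lemma smS O O' f : O' `<=` O -> smooth1 O f -> smooth1 O' f.
Proof.
move=> sO sf k; move: (sf k); elim: k f {sf} => // k IH f [df sf].
by split=> [x /sO/df//|]; exact: IH.
Qed.

Lemma smooth1_cst O (c : R) : smooth1 O (cst c).
Proof.
move=> k; elim: k c => // k IH c; split=> [x _|]; first by rewrite dableE; exact: derivable_cst.
suff -> : (cst c : R -> R)^`()%classic = cst 0 by [].
by apply/funext => x; rewrite derive1_cst.
Qed.

Lemma dable_cst (c x : R) : dable (fun=> c) x.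
Proof. rewrite dableE; exact: derivable_cst. Qed.

Lemma dableD f g x : dable f x -> dable g x -> dable (fun t => f t + g t) x.
Proof. rewrite !dableE; exact: (@derivableD R R R f g x 1). Qed.

Lemma dableM f g x : dable f x -> dable g x -> dable (fun t => f t * g t) x.
Proof. rewrite !dableE; exact: (@derivableM R R f g x 1). Qed.

Lemma dable_cont f x : dable f x -> {for x, continuous f}.
Proof. by rewrite dableE => /derivable1_diffP; exact: differentiable_continuous. Qed.

Lemma derive1D f g x : dable f x -> dable g x ->
  (fun t => f t + g t)^`()%classic x = f^`()%classic x + g^`()%classic x.
Proof.
rewrite !dableE => df dg; rewrite !derive1E.
exact: (@deriveD R R R f g x 1 df dg).
Qed.

Lemma derive1_mul f g x : dable f x -> dable g x ->
  (fun t => f t * g t)^`()%classic x = f^`()%classic x * g x + f x * g^`()%classic x.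
Proof.
rewrite !dableE => df dg; rewrite !derive1E.
transitivity (f x *: 'D_1 g x + g x *: 'D_1 f x).
  exact: (@deriveM R R f g x 1 df dg).
by rewrite /GRing.scale/= addrC [g x * _]mulrC.
Qed.

Lemma derive1_inv f x : f x != 0 -> dable f x ->
  (fun t => (f t)^-1)^`()%classic x = - (f x)^-1 * (f x)^-1 * f^`()%classic x.
Proof.
rewrite dableE => f0 df; rewrite !derive1E deriveV//.
by rewrite /GRing.scale/= expr2 invfM !mulNr.
Qed.

Section Closure.
Variable O : set R.
Hypothesis oO : open O.

Lemma smD k f g : sm k O f -> sm k O g -> sm k O (fun t => f t + g t).
Proof.
elim: k f g => // k IH f g [df sf] [dg sg]; split.
  by move=> x Ox; apply: dableD; [exact: df|exact: dg].
apply: (@eq_on_sm _ _ (fun t => f^`()%classic t + g^`()%classic t)) => //; last exact: IH.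
by move=> x /set_mem Ox; rewrite derive1D//; [exact: df|exact: dg].
Qed.

Lemma smM k f g : sm k O f -> sm k O g -> sm k O (fun t => f t * g t).
Proof.
elim: k f g => // k IH f g sf sg.
have [df sf'] := sf; have [dg sg'] := sg; split.
  by move=> x Ox; apply: dableM; [exact: df|exact: dg].
apply: (@eq_on_sm _ _ (fun t => f^`()%classic t * g t + f t * g^`()%classic t)) => //.
  by move=> x /set_mem Ox; rewrite derive1_mul//; [exact: df|exact: dg].
by apply: smD; apply: IH => //; exact: smW.
Qed.

Lemma smooth1D f g : smooth1 O f -> smooth1 O g -> smooth1 O (fun t => f t + g t).
Proof. by move=> sf sg k; exact: smD. Qed.

Lemma smooth1M f g : smooth1 O f -> smooth1 O g -> smooth1 O (fun t => f t * g t).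
Proof. by move=> sf sg k; exact: smM. Qed.

Lemma smooth1N f : smooth1 O f -> smooth1 O (fun t => - f t).
Proof.
move=> sf; rewrite (_ : (fun t => - f t) = (fun t => cst (-1) t * f t)).
  by apply: smooth1M => //; exact: smooth1_cst.
by apply/funext => t; rewrite mulN1r.
Qed.

Lemma smooth1V f : (forall x, O x -> f x != 0) -> smooth1 O f ->
  smooth1 O (fun t => (f t)^-1).
Proof.
move=> f0 sf k; elim: k => // k IH; split.
  move=> x Ox; rewrite dableE; apply: derivableV; first exact: f0.
  by rewrite -dableE; exact: derivable_smooth1 sf Ox.
apply: (@eq_on_sm _ _ (fun t => cst (-1) t * (f t)^-1 * (f t)^-1 * f^`()%classic t)) => //.
  move=> x /set_mem Ox; rewrite derive1_inv//; last exact: derivable_smooth1 sf Ox.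
    by rewrite /= mulN1r.
  exact: f0.
apply: smM; last exact: smooth1_derive1.
by apply: smM => //; apply: smM => //; exact: smooth1_cst.
Qed.

Lemma smooth1_sum (J : Type) (r : seq J) (P : pred J) (F : J -> R -> R) :
  (forall j, P j -> smooth1 O (F j)) -> smooth1 O (fun t => \sum_(j <- r | P j) F j t).
Proof.
move=> sF; elim: r => [|j r IH].
  by rewrite fun_big_nil; exact: smooth1_cst.
rewrite fun_big_cons; case: ifP => // Pj.
by apply: smooth1D => //; exact: sF.
Qed.

Lemma smooth1_prod (J : Type) (r : seq J) (P : pred J) (F : J -> R -> R) :
  (forall j, P j -> smooth1 O (F j)) -> smooth1 O (fun t => \prod_(j <- r | P j) F j t).
Proof.
move=> sF; elim: r => [|j r IH].
  by rewrite fun_big_nil; exact: smooth1_cst.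
rewrite fun_big_cons; case: ifP => // Pj.
by apply: smooth1M => //; exact: sF.
Qed.

End Closure.

(** Derivability and the value of the derivative in one predicate, so that the rules below compose
    as proof terms and yield both at once. *)
Definition isd f x (d : R) := dable f x /\ f^`()%classic x = d.

Lemma isd_cst (c x : R) : isd (fun=> c) x 0.
Proof. by split; [exact: dable_cst|exact: derive1_cst]. Qed.

Lemma isdD f g x a b : isd f x a -> isd g x b -> isd (fun t => f t + g t) x (a + b).
Proof. by move=> [df <-] [dg <-]; split; [exact: dableD|exact: derive1D]. Qed.

Lemma isdM f g x a b : isd f x a -> isd g x b ->
  isd (fun t => f t * g t) x (a * g x + f x * b).
Proof. by move=> [df <-] [dg <-]; split; [exact: dableM|exact: derive1_mul]. Qed.

Lemma isd_sum (J : Type) (r : seq J) (P : pred J) (F : J -> R -> R) x (d : J -> R) :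
  (forall j, P j -> isd (F j) x (d j)) ->
  isd (fun t => \sum_(j <- r | P j) F j t) x (\sum_(j <- r | P j) d j).
Proof.
move=> dF; elim: r => [|j r IH].
  by rewrite fun_big_nil big_nil; exact: isd_cst.
rewrite fun_big_cons big_cons; case: ifP => // Pj.
by apply: isdD => //; exact: dF.
Qed.

Lemma isd_prod (J : finType) (F : J -> R -> R) x (d : J -> R) :
  (forall j, isd (F j) x (d j)) ->
  isd (fun t => \prod_j F j t) x (\sum_j d j * \prod_(i | i != j) F i x).
Proof.
move=> dF.
(* The induction runs over lists without repetition, for the condition [i != j] must remove exactly
   one factor. *)
suff H (r : seq J) : uniq r ->
    isd (fun t => \prod_(j <- r) F j t) x
      (\sum_(j <- r) d j * \prod_(i <- r | i != j) F i x).
  exact: H (index_enum_uniq J).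
elim: r => [_|j r IH /= /andP[jr ur]].
  by rewrite fun_big_nil big_nil; exact: isd_cst.
have {}IH := IH ur.
rewrite fun_big_cons big_cons.
have -> : d j * \prod_(i <- j :: r | i != j) F i x
    + \sum_(l <- r) d l * \prod_(i <- j :: r | i != l) F i x =
    d j * \prod_(i <- r) F i x
    + F j x * \sum_(l <- r) d l * \prod_(i <- r | i != l) F i x.
  rewrite big_cons eqxx/=; congr (_ * _ + _).
    rewrite big_seq_cond [RHS]big_seq_cond; apply: eq_bigl => i.
    by case: eqP => [->|]; rewrite ?(negPf jr)// andbT.
  rewrite mulr_sumr big_seq [RHS]big_seq; apply: eq_bigr => i ir.
  by rewrite big_cons; case: eqP => [ji|_]; [rewrite ji ir in jr|rewrite mulrCA].
exact: isdM.
Qed.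

End SmoothCurves.

(** * Matrix-valued curves, differentiated entrywise *)

Section MatrixCurves.
Context {R : realType}.

Definition dmx {p q} (F : R -> 'M[R]_(p, q)) (t : R) : 'M[R]_(p, q) :=
  \matrix_(i, j) (fun s => F s i j)^`()%classic t.

Definition smx {p q} (O : set R) (F : R -> 'M[R]_(p, q)) :=
  forall i j, smooth1 O (fun s => F s i j).

Section One.
Variable O : set R.
Hypothesis oO : open O.

Lemma smx_derivable {p q} (F : R -> 'M[R]_(p, q)) t : smx O F -> O t ->
  forall i j, dable (fun s => F s i j) t.
Proof. by move=> sF Ot i j; exact: derivable_smooth1 (sF i j) Ot. Qed.

Lemma smx_isd {p q} (F : R -> 'M[R]_(p, q)) t : smx O F -> O t ->
  forall i j, isd (fun s => F s i j) t (dmx F t i j).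
Proof. by move=> sF Ot i j; split; [exact: smx_derivable|rewrite mxE]. Qed.

Lemma smx_dmx {p q} (F : R -> 'M[R]_(p, q)) : smx O F -> smx O (dmx F).
Proof.
move=> sF i j; rewrite (_ : (fun _ => _) = (fun s => F s i j)^`()%classic).
  exact/smooth1_derive1/sF.
by apply/funext => s; rewrite mxE.
Qed.

Lemma eq_on_smx {p q} (F G : R -> 'M[R]_(p, q)) : {in O, F =1 G} -> smx O F -> smx O G.
Proof.
by move=> FG sF i j; apply: (eq_on_smooth1 oO _ (sF i j)) => t /FG ->.
Qed.

Lemma eq_on_dmx {p q} (F G : R -> 'M[R]_(p, q)) t : {in O, F =1 G} -> O t ->
  dmx F t = dmx G t.
Proof.
move=> FG Ot; apply/matrixP => i j; rewrite !mxE.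
by apply: (eq_on_derive1 oO) => // s /FG ->.
Qed.

Lemma smx_cst {p q} (A : 'M[R]_(p, q)) : smx O (fun=> A).
Proof. by move=> i j; exact: smooth1_cst. Qed.

Lemma dmx_cst {p q} (A : 'M[R]_(p, q)) t : dmx (fun=> A) t = 0.
Proof. by apply/matrixP => i j; rewrite !mxE derive1_cst. Qed.

Lemma smxD {p q} (F G : R -> 'M[R]_(p, q)) :
  smx O F -> smx O G -> smx O (fun t => F t + G t).
Proof.
by move=> sF sG i j; under eq_fun do rewrite mxE; exact: smooth1D.
Qed.

Lemma smxN {p q} (F : R -> 'M[R]_(p, q)) : smx O F -> smx O (fun t => - F t).
Proof. by move=> sF i j; under eq_fun do rewrite mxE; exact: smooth1N. Qed.

Lemma smxB {p q} (F G : R -> 'M[R]_(p, q)) :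
  smx O F -> smx O G -> smx O (fun t => F t - G t).
Proof. by move=> sF sG; apply: smxD => //; exact: smxN. Qed.

Lemma smxM {p q r} (F : R -> 'M[R]_(p, q)) (G : R -> 'M[R]_(q, r)) :
  smx O F -> smx O G -> smx O (fun t => F t *m G t).
Proof.
move=> sF sG i j; under eq_fun do rewrite mxE; apply: smooth1_sum => // l _.
exact: smooth1M.
Qed.

Lemma smxT {p q} (F : R -> 'M[R]_(p, q)) : smx O F -> smx O (fun t => (F t)^T).
Proof.
move=> sF i j; rewrite (_ : (fun _ => _) = fun s => F s j i)//.
by apply/funext => s; rewrite mxE.
Qed.

Lemma smooth1_det {p} (F : R -> 'M[R]_p) : smx O F -> smooth1 O (fun t => \det (F t)).
Proof.
move=> sF; rewrite /determinant; apply: smooth1_sum => // s _.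
by apply: smooth1M; [exact: oO|exact: smooth1_cst|exact: smooth1_prod].
Qed.

Lemma smx_inv {p} (F : R -> 'M[R]_p) : (forall t, O t -> F t \in unitmx) ->
  smx O F -> smx O (fun t => invmx (F t)).
Proof.
move=> uF sF.
apply: (@eq_on_smx _ _ (fun t => (\det (F t))^-1 *: \adj (F t))).
  by move=> t /set_mem/uF Ft /=; rewrite /invmx Ft.
move=> i j; under eq_fun do rewrite !mxE; apply: smooth1M => //.
  apply: smooth1V => //; last exact: smooth1_det.
  by move=> t /uF; rewrite unitmxE unitfE.
rewrite /cofactor; apply: smooth1M; [exact: oO|exact: smooth1_cst|].
apply: smooth1_det => k l.
rewrite (_ : (fun _ => _) = fun s => F s (lift j k) (lift i l))//.
by apply/funext => s; rewrite !mxE.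
Qed.

Lemma dmxD {p q} (F G : R -> 'M[R]_(p, q)) t : smx O F -> smx O G -> O t ->
  dmx (fun s => F s + G s) t = dmx F t + dmx G t.
Proof.
move=> sF sG Ot; apply/matrixP => i j; rewrite !mxE.
rewrite (_ : (fun s => (F s + G s) i j) = fun s => F s i j + G s i j).
  by rewrite derive1D//; exact: smx_derivable.
by apply/funext => s; rewrite mxE.
Qed.

Lemma dmxM {p q r} (F : R -> 'M[R]_(p, q)) (G : R -> 'M[R]_(q, r)) t :
  smx O F -> smx O G -> O t ->
  dmx (fun s => F s *m G s) t = dmx F t *m G t + F t *m dmx G t.
Proof.
move=> sF sG Ot; apply/matrixP => i j; rewrite !mxE -big_split/=.
under eq_fun do rewrite mxE.
have [_ ->] := @isd_sum R _ (index_enum 'I_q) xpredT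
    (fun l s => F s i l * G s l j) t _ (fun l _ => isdM (smx_isd sF Ot i l) (smx_isd sG Ot l j)).
by apply: eq_bigr => l _; rewrite !mxE.
Qed.

Lemma dmxT {p q} (F : R -> 'M[R]_(p, q)) t : dmx (fun s => (F s)^T) t = (dmx F t)^T.
Proof.
by apply/matrixP => i j; rewrite !mxE; congr (derive1 _ t); apply/funext => s; rewrite mxE.
Qed.

Lemma dmxN {p q} (F : R -> 'M[R]_(p, q)) t : smx O F -> O t ->
  dmx (fun s => - F s) t = - dmx F t.
Proof.
move=> sF Ot; apply/matrixP => i j; rewrite !mxE !derive1E.
rewrite (_ : (fun s => (- F s) i j) = - (fun s => F s i j)).
  by rewrite deriveN// -dableE; exact: smx_derivable sF Ot i j.
by apply/funext => s; rewrite mxE.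
Qed.

End One.

(** Jacobi's formula. Differentiating the sum over permutations and grouping by the differentiated
    row [i] gives the determinant with row [i] replaced by that of [dF]; its expansion along this
    row is the [i]-th diagonal entry of [dF] times the adjugate. *)
Lemma isd_det {p} (F : R -> 'M[R]_p) t (dF : 'M[R]_p) :
  (forall i j, isd (fun s => F s i j) t (dF i j)) ->
  isd (fun s => \det (F s)) t (\tr (dF *m \adj (F t))).
Proof.
move=> HF.
have -> : \tr (dF *m \adj (F t)) =
    \sum_(s : 'S_p) (0 * \prod_i F t i (s i) +
      (-1) ^+ s * \sum_i dF i (s i) * \prod_(j | j != i) F t j (s j)).
  under [RHS]eq_bigr do rewrite mul0r add0r mulr_sumr.
  rewrite exchange_big/= /mxtrace; apply: eq_bigr => i _.
  rewrite mxE.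
  pose B : 'M[R]_p := \matrix_(k, l) (if k == i then dF i l else F t k l).
  transitivity (\det B).
    rewrite (expand_det_row _ i); apply: eq_bigr => j _.
    rewrite !mxE eqxx; congr (_ * _).
    rewrite /cofactor; congr (_ * \det _); apply/matrixP => k l.
    by rewrite !mxE eq_sym (negPf (neq_lift _ _)).
  apply: eq_bigr => s _; congr (_ * _).
  rewrite [LHS](bigD1 i)//= !mxE eqxx; congr (_ * _).
  by apply: eq_bigr => k ki; rewrite !mxE (negPf ki).
apply: isd_sum => s _.
exact: (isdM (isd_cst _ _) (isd_prod (fun i => HF i (s i)))).
Qed.

Lemma isd_mulmx {p q r} (F : R -> 'M[R]_(p, q)) (G : R -> 'M[R]_(q, r))
    (dF : 'M[R]_(p, q)) (dG : 'M[R]_(q, r)) (t : R) i j :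
  (forall a b, isd (fun s => F s a b) t (dF a b)) ->
  (forall a b, isd (fun s => G s a b) t (dG a b)) ->
  isd (fun s => (F s *m G s) i j) t ((dF *m G t + F t *m dG) i j).
Proof.
move=> HF HG.
have -> : (fun s => (F s *m G s) i j) = fun s => \sum_l F s i l * G s l j.
  by apply/funext => s; rewrite mxE.
have -> : (dF *m G t + F t *m dG) i j =
    \sum_l (dF i l * G t l j + F t i l * dG l j).
  by rewrite !mxE -big_split.
by apply: isd_sum => l _; exact: isdM.
Qed.

Lemma dmx_inv {p} (O : set R) (F : R -> 'M[R]_p) t : open O ->
  (forall s, O s -> F s \in unitmx) -> smx O F -> O t ->
  dmx (fun s => invmx (F s)) t = - (invmx (F t) *m dmx F t *m invmx (F t)).
Proof.
move=> oO uF sF Ot.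
have sV := smx_inv oO uF sF.
have : dmx (fun s => F s *m invmx (F s)) t = 0.
  rewrite (eq_on_dmx oO (G := fun=> 1%:M))//; first exact: dmx_cst.
  by move=> s /set_mem/uF Fs; rewrite mulmxV.
rewrite (dmxM sF sV Ot) => /eqP; rewrite addrC addr_eq0 => /eqP H.
have := congr1 (mulmx (invmx (F t))) H.
by rewrite mulmxA mulVmx ?uF// mul1mx mulmxN mulmxA.
Qed.

(** Bootstrap: if the entries of [X] are differentiable to order [k], so are those of [X *m H],
    which are the derivatives of the entries of [X]. *)
Lemma smx_linear_ode {p q} (O : set R) (X : R -> 'M[R]_(p, q)) (H : R -> 'M[R]_q) :
  open O -> smx O H ->
  (forall t i j, O t -> isd (fun s => X s i j) t ((X t *m H t) i j)) -> smx O X.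
Proof.
move=> oO sH dX i j k; elim: k i j => // k IH i j; split.
  by move=> t Ot; have [] := dX t i j Ot.
apply: (@eq_on_sm _ _ _ (fun t => \sum_l X t i l * H t l j)) => //.
  by move=> t /set_mem Ot; have [_ ->] := dX t i j Ot; rewrite mxE.
elim: (index_enum _) => [|l r IHr]; first by rewrite fun_big_nil; exact: smooth1_cst.
by rewrite fun_big_cons; apply: smD => //; apply: smM => //; exact: sH.
Qed.

End MatrixCurves.

(** * Taylor expansion at 0 and division by powers of t *)

Section Peano.
Context {R : realType}.
Implicit Types (O : set R) (h : R -> R).

Lemma mvt0 O h t : (forall s, `|s| <= `|t| -> O s) -> smooth1 O h ->
  exists2 c, `|c| <= `|t| & h t - h 0 = h^`()%classic c * t.
Proof.
move=> Ot sh.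
have dh (s : R) : `|s| <= `|t| -> is_derive s 1 h (h^`()%classic s).
  move=> /Ot Os; have := derivable_smooth1 sh Os; rewrite dableE => d.
  by apply: DeriveDef => //; rewrite derive1E.
have cont (a b : R) : (forall s, s \in `[a, b] -> `|s| <= `|t|) ->
    {within `[a, b], continuous h}.
  move=> ab; apply: derivable_within_continuous => s /ab st.
  by have [] := dh s st.
have [t0|t0|->] := ltgtP t 0; last by exists 0; rewrite ?subrr ?mulr0.
- have bd s : s \in `[t, 0] -> `|s| <= `|t|.
    by rewrite in_itv/= => /andP[ts s0]; rewrite !ler0_norm ?lerN2// ltW.
  have [|c cc] := @MVT R h h^`()%classic t 0 t0 _ (cont _ _ bd).
    by move=> s /subset_itv_oo_cc/bd/dh.
  have ct := bd _ (subset_itv_oo_cc cc).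
  by rewrite sub0r => H; exists c => //; rewrite -opprB H mulrN opprK.
- have bd s : s \in `[0, t] -> `|s| <= `|t|.
    by rewrite in_itv/= => /andP[s0 st]; rewrite !ger0_norm// ltW.
  have [|c cc] := @MVT R h h^`()%classic 0 t t0 _ (cont _ _ bd).
    by move=> s /subset_itv_oo_cc/bd/dh.
  have ct := bd _ (subset_itv_oo_cc cc).
  by rewrite subr0 => H; exists c.
Qed.

(** Induction on [r] through the mean value theorem: [h t] is [t] times a value of the derivative,
    whose jet at 0 vanishes to one order less. *)
Lemma peano_small O h r : open O -> O 0 -> smooth1 O h ->
  (forall l, (l <= r)%N -> h^`(l)%classic 0 = 0) ->
  forall e, 0 < e -> exists2 d, 0 < d & forall t, `|t| < d -> `|h t| <= e * `|t| ^+ r.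
Proof.
move=> oO O0; elim: r h => [|r IH] h sh h0 e e0.
  have /dable_cont/cvgrPdist_le/(_ e e0)[d /= d0 hd] := derivable_smooth1 sh O0.
  exists d => // t td; have := hd t; rewrite /= sub0r normrN => /(_ td).
  have -> : h 0 = 0 by exact: (h0 0%N).
  by rewrite sub0r normrN expr0 mulr1.
have [||d d0 hd] := IH h^`()%classic _ _ e e0; first exact: smooth1_derive1.
  by move=> l lr; rewrite -derive1Sn; exact: h0.
have /nbhs_ballP[d' /= d'0 Od'] : nbhs (0 : R) O by exact: open_nbhs_nbhs.
exists (Num.min d d'); first by rewrite lt_min d0.
move=> t; rewrite lt_min => /andP[td td'].
have [|c ct] := @mvt0 O h t _ sh.
  by move=> s st; apply: Od'; rewrite -ball_normE/= sub0r normrN (le_lt_trans st).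
have -> : h 0 = 0 by exact: (h0 0%N).
rewrite subr0 => ->.
rewrite normrM exprSr mulrA ler_wpM2r//.
apply: le_trans (hd c _) _; first exact: le_lt_trans td.
by rewrite ler_wpM2l ?(ltW e0)// lerXn2r// nnegrE.
Qed.

Lemma derive1n_horner (p : {poly R}) l :
  (horner p)^`(l)%classic = horner (p^`(l)).
Proof. by elim: l => // l IH; rewrite derive1nS IH -derivE. Qed.

Lemma smooth1_horner O (p : {poly R}) : smooth1 O (horner p).
Proof.
move=> k; elim: k p => // k IH p; split.
  by move=> x _; rewrite dableE; exact: derivable_horner.
by rewrite -derivE.
Qed.

Lemma derive1nB O (f g : R -> R) l t : open O -> smooth1 O f -> smooth1 O g -> O t ->
  (fun s => f s - g s)^`(l)%classic t = f^`(l)%classic t - g^`(l)%classic t :> R.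
Proof.
move=> oO sf sg; elim: l t => // l IH t Ot; rewrite !derive1nS.
rewrite (eq_on_derive1 (g := fun s => f^`(l)%classic s - g^`(l)%classic s) oO)//.
  have df := derivable_smooth1 (smooth1_derive1n l sf) Ot.
  have dg := derivable_smooth1 (smooth1_derive1n l sg) Ot.
  rewrite !dableE in df dg.
  rewrite !derive1E; exact: (deriveB df dg).
by move=> s /set_mem; exact: IH.
Qed.

(** The Taylor polynomial of degree [r.+1] has only its two top terms. Subtracting it leaves a
    remainder of order o(t^(r+1)), which is what the difference quotient at 0 of the extended
    function requires. *)
Lemma isd_quot_expr O h r : open O -> O 0 -> smooth1 O h ->
  (forall l, (l < r)%N -> h^`(l)%classic 0 = 0) ->
  isd (fun t => if t == 0 then h^`(r)%classic 0 / r`!%:R else h t / t ^+ r) 0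
      (h^`(r.+1)%classic 0 / r.+1`!%:R).
Proof.
move=> oO O0 sh h0.
set a := _ 0 / _; set b := _ 0 / _.
have fact_neq0 l : l`!%:R != 0 :> R by rewrite pnatr_eq0 -lt0n fact_gt0.
have aE : a * r`!%:R = h^`(r)%classic 0 by rewrite divfK.
have bE : b * r.+1`!%:R = h^`(r.+1)%classic 0 by rewrite divfK.
pose p : {poly R} := a%:P * 'X^r + b%:P * 'X^(r.+1).
pose q t := h t - p.[t].
have sq : smooth1 O q.
  by apply: smooth1D => //; apply: smooth1N => //; exact: smooth1_horner.
have q0 l : (l <= r.+1)%N -> q^`(l)%classic 0 = 0.
  move=> lr; rewrite (@derive1nB O)//; last exact: smooth1_horner.
  rewrite derive1n_horner horner_coef0 coef_derivn addn0.
  rewrite ffactnn {1}/p coefD !coefCM !coefXn.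
  move: lr; rewrite leq_eqVlt ltnS => /predU1P[->|].
    by rewrite eqxx gtn_eqF// mulr0 add0r mulr1 -mulr_natr bE subrr.
  move=> lr; rewrite (_ : (l == r.+1) = false); last by rewrite ltn_eqF.
  rewrite mulr0 addr0; move: lr; rewrite leq_eqVlt => /predU1P[->|lr].
    by rewrite eqxx mulr1 -mulr_natr aE subrr.
  by rewrite ltn_eqF// mulr0 mul0rn subr0 h0.
have Hq := peano_small oO O0 sq q0.
set K := fun t => _.
have HK : (fun x => x^-1 *: (K (x + 0) - K 0)) @ 0^' --> b.
  apply/cvgrPdist_le => e e0.
  have [d d0 hd] := Hq e e0.
  exists d => //= t /=; rewrite sub0r normrN => td tn0.
  rewrite addr0 /K (negPf tn0) eqxx.
  have -> : b - t^-1 *: (h t / t ^+ r - a) = - (q t / t ^+ r.+1).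
    rewrite /q /p !hornerE /GRing.scale/=.
    have tr0 : t ^+ r != 0 by rewrite expf_neq0.
    rewrite exprS; field.
    by rewrite tn0 tr0.
  rewrite normrN normrM normfV normrX ler_pdivrMr ?hd//.
  by rewrite exprn_gt0// normr_gt0.
split; last by rewrite /derive1; apply/cvg_lim.
rewrite dableE /derivable; apply/cvg_ex; exists b => /=.
(* [derive1] writes the increment as [x], [derivable] as [x] times 1. *)
move: HK; set F1 := fun x : R => _; set F2 := fun x : R => _.
suff -> : F1 = F2 by [].
by apply/funext => x; rewrite /F1 /F2 /= [x%:A]mulr1.
Qed.

End Peano.

(** * A Hilbert-type determinant *)

Section HilbertFactorization.
Context {R : realFieldType}.
Implicit Types i j p q : nat.

Local Notation fct i := ((i`!)%:R : R).

Lemma fct_neq0 i : fct i != 0.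
Proof. by rewrite pnatr_eq0 -lt0n fact_gt0. Qed.

Lemma fctS i : fct i.+1 = i.+1%:R * fct i.
Proof. by rewrite factS natrM. Qed.

(* The integral of t ^ i times the shifted Legendre polynomial of degree p. *)
Definition legendre_moment i p : R :=
  if (p <= i)%N then fct i ^+ 2 / (fct (i - p) * fct (i + p).+1) else 0.

(** Telescoping term for [sum_legendre_moment]: it is 1 at [p = 0] and vanishes for [p] greater than
    [i]. *)
Let g i p : R := if (p <= i)%N then fct i ^+ 2 / (fct (i - p) * fct (i + p)) else 0.

Let momentl i p : legendre_moment i p * (i + p).+1%:R = g i p.
Proof.
rewrite /legendre_moment /g; case: ifP => _; last by rewrite mul0r.
rewrite fctS; have := fct_neq0 (i - p); have := fct_neq0 (i + p).
have : (i + p).+1%:R != 0 :> R by rewrite pnatr_eq0.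
by move=> *; field; do ?[apply/andP; split].
Qed.

Let momentr i p : legendre_moment i p * (i%:R - p%:R) = g i p.+1.
Proof.
rewrite /legendre_moment /g; have [|pi] := ltnP p i; last first.
  case: ifP => [pi'|]; last by rewrite mul0r.
  have -> : p = i by apply/eqP; rewrite eqn_leq pi pi'.
  by rewrite subrr mulr0.
move=> pi; rewrite (ltnW pi) -natrB ?(ltnW pi)//.
have -> : (i - p)%N = (i - p.+1).+1 by lia.
rewrite addnS fctS; have := fct_neq0 (i - p.+1); have := fct_neq0 (i + p).+1.
have : (i - p.+1).+1%:R != 0 :> R by rewrite pnatr_eq0.
by move=> *; field; do ?[apply/andP; split].
Qed.

(** Expansion of the scalar product of t^i and t^j on [0, 1] in the shifted Legendre polynomials, of
    squared norm 1/(2p+1); it stops because t^i is orthogonal to those of degree greater than i. The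
    telescoping rests on (2p+1)(i+j+1) = (i+p+1)(j+p+1) - (i-p)(j-p). *)
Lemma sum_legendre_moment P i j : (i < P)%N ->
  \sum_(p < P) p.*2.+1%:R * legendre_moment i p * legendre_moment j p =
  ((i + j).+1%:R)^-1.
Proof.
move=> iP; have n0 : (i + j).+1%:R != 0 :> R by rewrite pnatr_eq0.
apply: (mulIf n0); rewrite mulVf// mulr_suml.
have E (p : nat) : p.*2.+1%:R * legendre_moment i p * legendre_moment j p *
    (i + j).+1%:R = g i p * g j p - g i p.+1 * g j p.+1.
  rewrite -!momentr -(momentl i p) -(momentl j p) -!natr1 -addnn !natrD; ring.
under eq_bigr do rewrite E.
rewrite -(big_mkord xpredT (fun p => g i p * g j p - g i p.+1 * g j p.+1)).
under eq_bigr do rewrite -opprB.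
rewrite sumrN (@telescope_sumr _ _ _ (fun p => g i p * g j p)) ?leq0n// opprB.
rewrite {3}/g leqNgt iP mul0r subr0 /g !leq0n !subn0 !addn0.
by rewrite !expr2 !divff ?mulr1// mulf_neq0 ?fct_neq0.
Qed.

(** The Beta integral of t^i (1-t)^j, expanded by the binomial theorem. The induction on [j] is
    (1-t)^(j+1) = (1-t)^j - t (1-t)^j. *)
Lemma sum_bin_inv i j :
  \sum_(q < j.+1) (-1) ^+ q * 'C(j, q)%:R / (i + q).+1%:R =
  fct i * fct j / fct (i + j).+1.
Proof.
elim: j i => [|j IH] i.
  rewrite big_ord1 expr0 bin0 mulr1 fact0 addn0 mulr1 fctS.
  have := fct_neq0 i; have : i.+1%:R != 0 :> R by rewrite pnatr_eq0.
  by move=> *; field; do ?[apply/andP; split].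
transitivity (fct i * fct j / fct (i + j).+1 - fct i.+1 * fct j / fct (i.+1 + j).+1).
  rewrite -!IH big_ord_recl /= bin0 expr0 mulr1 addn0.
  under eq_bigr do rewrite /bump add1n binS natrD mulrDr mulrDl addnS.
  rewrite big_split/= addrA; congr (_ + _).
    rewrite big_ord_recr/= bin_small// mulr0 mul0r addr0.
    rewrite [RHS]big_ord_recl/= bin0 expr0 mulr1 addn0; congr (_ + _).
    by apply: eq_bigr => q _; rewrite /bump add1n addnS.
  rewrite -sumrN; apply: eq_bigr => q _.
  by rewrite exprS mulN1r !mulNr addSn.
rewrite addSn addnS !fctS.
have f0 := fct_neq0 (i + j).
have n0 (k : nat) : k.+1%:R != 0 :> R by rewrite pnatr_eq0.
have -> : j.+1%:R = (i + j).+2%:R - i.+1%:R :> R.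
  by rewrite -natrB; [congr _%:R|]; lia.
move: (n0 (i + j)%N) (n0 (i + j).+1) => n1 n2; field.
by rewrite f0 -(natrD _ i j) nat1r n1 -(natrD _ 2) n2.
Qed.

(** The integral over [0, 1] of t^i/i! against the shifted Legendre polynomial of degree [p]; lower
    triangular by orthogonality. *)
Definition hilbert_low i p : R := legendre_moment i p / fct i.

(** 2p+1 times the integral of (t-1)^j/j! against the same polynomial; upper triangular. *)
Definition hilbert_up p j : R :=
  \sum_(q < j.+1) p.*2.+1%:R * legendre_moment q p *
    ((-1) ^+ (j - q) / (fct q * fct (j - q))).

Lemma hilbert_low0 i p : (i < p)%N -> hilbert_low i p = 0.
Proof. by move=> ip; rewrite /hilbert_low /legendre_moment leqNgt ip mul0r. Qed.

Lemma hilbert_up0 p j : (j < p)%N -> hilbert_up p j = 0.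
Proof.
move=> jp; apply: big1 => q _; rewrite /legendre_moment leqNgt.
by rewrite (leq_ltn_trans _ jp) ?mulr0 ?mul0r// -ltnS.
Qed.

Lemma legendre_moment_diag_gt0 p : 0 < legendre_moment p p.
Proof.
by rewrite /legendre_moment leqnn divr_gt0 ?exprn_gt0 ?mulr_gt0 ?ltr0n ?fact_gt0.
Qed.

Lemma hilbert_low_gt0 p : 0 < hilbert_low p p.
Proof. by rewrite divr_gt0 ?legendre_moment_diag_gt0// ltr0n fact_gt0. Qed.

Lemma hilbert_up_gt0 p : 0 < hilbert_up p p.
Proof.
rewrite /hilbert_up big_ord_recr/= big1 => [|q _]; last first.
  by rewrite /legendre_moment leqNgt ltn_ord mulr0 mul0r.
by rewrite add0r subnn expr0 !mulr_gt0 ?legendre_moment_diag_gt0 ?ltr0n ?invr_gt0 ?mulr_gt0 ?ltr0n ?fact_gt0//.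
Qed.

(** Both sides are the integral of t^i/i! times (t-1)^j/j!, computed by the Legendre expansion on
    the left and as a Beta integral on the right. *)
Lemma hilbert_lowM_up P i j : (i < P)%N ->
  \sum_(p < P) hilbert_low i p * hilbert_up p j = (-1) ^+ j / fct (i + j).+1.
Proof.
move=> iP; rewrite /hilbert_up.
under eq_bigr do rewrite mulr_sumr.
rewrite exchange_big/=.
transitivity (\sum_(q < j.+1) (-1) ^+ j / (fct i * fct j) *
    ((-1) ^+ q * 'C(j, q)%:R / (i + q).+1%:R)).
  apply: eq_bigr => q _; rewrite -(@sum_legendre_moment P)// !mulr_sumr.
  apply: eq_bigr => p _; rewrite /hilbert_low.
  have qj : (q <= j)%N by rewrite -ltnS.
  have -> : 'C(j, q)%:R = fct j / (fct q * fct (j - q)).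
    rewrite -(bin_fact qj) !natrM mulfK// mulf_neq0 ?fct_neq0//.
  have -> : (-1) ^+ (j - q) = (-1) ^+ j * (-1) ^+ q :> R.
    rewrite -exprD -signr_odd -[RHS]signr_odd oddB// oddD//.
  have := fct_neq0 i; have := fct_neq0 j; have := fct_neq0 q; have := fct_neq0 (j - q).
  by move=> *; field; do ?[apply/andP; split].
rewrite -mulr_sumr sum_bin_inv.
have := fct_neq0 i; have := fct_neq0 j; have := fct_neq0 (i + j).+1.
by move=> *; field; do ?[apply/andP; split].
Qed.

End HilbertFactorization.

Section WeightTriangular.
Context {R : comNzRingType} {n : nat} (w : 'I_n -> nat).

(* Only the identity contributes to the Leibniz sum: a permutation that does
   not increase w preserves it. *)
Lemma det_weight_trig (A : 'M[R]_n) :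
  (forall a b, a != b -> (w a <= w b)%N -> A a b = 0) ->
  \det A = \prod_a A a a.
Proof.
move=> A0; rewrite /determinant (bigD1 (1%g : 'S_n))//= odd_perm1 expr0 mul1r.
rewrite [X in _ + X]big1 ?addr0 => [|s s1].
  by apply: eq_bigr => a _; rewrite perm1.
have [|] := boolP [exists a, (s a != a) && (w a <= w (s a))%N].
  case/existsP => a /andP[sa wa].
  by rewrite (bigD1 a)//= A0 ?mul0r ?mulr0// eq_sym.
rewrite negb_exists => /forallP H; exfalso.
have wle a : (w (s a) <= w a)%N.
  have := H a; rewrite negb_and negbK -ltnNge.
  by case/orP => [/eqP->|/ltnW].
have : \sum_a w (s a) = \sum_a w a.
  by rewrite [RHS](reindex_inj (@perm_inj _ s)).
have [a sa] : exists a, s a != a.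
  apply/existsP; apply: contraNT s1; rewrite negb_exists => /forallP s1.
  by apply/eqP/permP => a; rewrite perm1; apply/eqP; have := s1 a; rewrite negbK.
have wa : (w (s a) < w a)%N.
  by have := H a; rewrite negb_and sa/= -ltnNge.
rewrite (bigD1 a)//= [RHS](bigD1 a)//= => E.
have : (\sum_(i | i != a) w (s i) <= \sum_(i | i != a) w i)%N.
  by apply: leq_sum => i _.
by move=> le; have := leq_add wa le; rewrite addSn ltn_neqAle => /andP[/eqP/(_ E)].
Qed.

End WeightTriangular.

(** * Expansion of the weighted linear system *)

Section WeightedGram.
Context {R : realFieldType} {n : nat} (w : 'I_n -> nat) (g : 'M[R]_n).
(** The model: [g a b] is the scalar product of the vectors with indices [a] and [b], those of equal
    weight being an orthonormal basis of a subspace that decreases as the weight grows. [g_nest]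
    then says that projecting onto a larger subspace changes nothing. *)
Hypothesis g_ortho : forall a b, w a = w b -> g a b = (a == b)%:R.
Hypothesis g_sym : forall a b, g a b = g b a.
Hypothesis g_nest : forall p a b, (p <= w a)%N ->
  \sum_(k | w k == p) g a k * g k b = g a b.

(** The intermediate indices are grouped by weight [p]. As [l] is triangular, only [p <= w a]
    contributes, and there [g_nest] collapses the products of entries of [g]: the weight factors
    multiply as if [g] were absent. *)
Lemma weighted_gramM P (l u : nat -> nat -> R) :
  (forall a, (w a < P)%N) -> (forall i p, (i < p)%N -> l i p = 0) ->
  (\matrix_(a, b) (l (w a) (w b) * g a b)) *m
  (\matrix_(a, b) (u (w a) (w b) * g a b)) =
  \matrix_(a, b) ((\sum_(p < P) l (w a) p * u p (w b)) * g a b).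
Proof.
move=> wP l0; apply/matrixP => a b; rewrite !mxE.
rewrite (partition_big (fun k => Ordinal (wP k)) xpredT)//= mulr_suml.
apply: eq_bigr => p _; have [pa|pa] := leqP p (w a); last first.
  rewrite l0// !mul0r; apply: big1 => k /eqP E.
  have {}E : w k = p by rewrite -E.
  by rewrite !mxE/= E l0// !mul0r.
rewrite -(g_nest b pa) mulr_sumr; apply: eq_big => k; first by rewrite -val_eqE.
move=> /eqP E; have {}E : w k = p by rewrite -E.
by rewrite !mxE/= E mulrACA.
Qed.

(** The entries of [g] multiply both triangular factors of the Hilbert-type matrix; as [g] is the
    identity on each block of equal weight, it leaves no trace in the determinant. *)
Lemma det_weighted_gram :
  \det (\matrix_(a, b) ((-1) ^+ w b / (w a + w b).+1`!%:R * g a b)) =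
  \prod_a (hilbert_low (w a) (w a) * hilbert_up (w a) (w a)).
Proof.
pose P := (\max_a w a).+1.
have wP a : (w a < P)%N by rewrite ltnS leq_bigmax.
transitivity (\det ((\matrix_(a, b) (hilbert_low (w a) (w b) * g a b)) *m
    (\matrix_(a, b) (hilbert_up (w a) (w b) * g a b)))).
  rewrite (@weighted_gramM P)//; last exact: hilbert_low0.
  congr (\det _); apply/matrixP => a b; rewrite !mxE hilbert_lowM_up//.
rewrite det_mulmx big_split/=; congr (_ * _).
  rewrite (det_weight_trig (w := w)).
    by apply: eq_bigr => a _; rewrite !mxE g_ortho// eqxx mulr1.
  move=> a b ab; rewrite !mxE leq_eqVlt => /predU1P[wab|wab].
    by rewrite g_ortho// (negPf ab) mulr0.
  by rewrite hilbert_low0// mul0r.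
rewrite -det_tr (det_weight_trig (w := w)).
  by apply: eq_bigr => a _; rewrite !mxE g_ortho// eqxx mulr1.
move=> a b ab; rewrite !mxE leq_eqVlt => /predU1P[wab|wab].
  by rewrite g_ortho// eq_sym (negPf ab) mulr0.
by rewrite hilbert_up0// mul0r.
Qed.

Lemma det_weighted_gram_gt0 :
  0 < \prod_a (hilbert_low (w a) (w a) * hilbert_up (w a) (w a) : R).
Proof.
by apply: prodr_gt0 => a _; rewrite mulr_gt0 ?hilbert_low_gt0 ?hilbert_up_gt0.
Qed.

End WeightedGram.

(** * Jets of a function of two variables along the diagonal *)

Section MixedJets.
Context {R : realType} (O : set R).
Hypothesis oO : open O.

Lemma eq_on_isd (f h : R -> R) x d : {in O, f =1 h} -> O x -> isd f x d -> isd h x d.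
Proof.
move=> fh Ox [df <-]; split; first exact: (eq_on_derivable oO fh Ox df).
by rewrite (eq_on_derive1 oO fh Ox).
Qed.

Lemma isd_unique (f : R -> R) x a b : isd f x a -> isd f x b -> a = b.
Proof. by move=> [_ <-] [_ <-]. Qed.

(* Think of f a b t as the derivative of order a in s and b in t of a
   function F(s, t), restricted to the diagonal. *)
Lemma mixed_jets (f : nat -> nat -> R -> R) r :
  (forall a b t, O t -> isd (f a b) t (f a.+1 b t + f a b.+1 t)) ->
  (forall b t, O t -> (b < r)%N -> f 0%N b t = 0) ->
  forall t, O t -> f r 0%N t = (-1) ^+ r * f 0%N r t /\
    f r.+1 0%N t = (-1) ^+ r.+1 * (f 0%N r.+1 t - r.+1%:R * (f 0%N r)^`()%classic t).
Proof.
move=> df f0.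
(* Differentiating a vanishing jet along the diagonal trades a derivative in t for one in s, with
   the opposite sign. *)
have z a : forall b t, O t -> (a + b < r)%N -> f a b t = 0.
  elim: a => [|a IH] b t Ot abr; first exact: f0.
  have Z : {in O, cst 0 =1 f a b}.
    by move=> s /set_mem Os; rewrite IH//; lia.
  have := isd_unique (df a b t Ot) (eq_on_isd Z Ot (isd_cst _ _)).
  by rewrite (IH b.+1)// ?addr0//; lia.
have m a : forall b t, O t -> (a + b = r)%N -> f a b t = (-1) ^+ a * f 0%N r t.
  elim: a => [|a IH] b t Ot abr; first by rewrite -abr expr0 mul1r.
  have Z : {in O, cst 0 =1 f a b}.
    by move=> s /set_mem Os; rewrite z//; lia.
  have := isd_unique (df a b t Ot) (eq_on_isd Z Ot (isd_cst _ _)).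
  rewrite (IH b.+1)//; last by lia.
  by move=> /eqP; rewrite addr_eq0 => /eqP ->; rewrite exprS mulN1r mulNr.
move=> t Ot; split; first by apply: m => //; rewrite addn0.
(* At total order r + 1 the function differentiated is (-1)^a times [f 0 r] instead of 0; each step
   in [a] adds one derivative of it, whence the factor [a%:R]. *)
have H a : forall b, (a + b = r.+1)%N ->
    f a b t = (-1) ^+ a * (f 0%N r.+1 t - a%:R * (f 0%N r)^`()%classic t).
  elim: a => [|a IH] b abr.
    by rewrite -abr expr0 mul1r mul0r subr0.
  have Z : {in O, (fun t => cst ((-1) ^+ a) t * f 0%N r t) =1 f a b}.
    by move=> s /set_mem Os; rewrite (m a b s Os)//; case: abr.
  have d0 : isd (f 0%N r) t ((f 0%N r)^`()%classic t).
    by have [dd _] := df 0%N r t Ot; split.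
  have := isd_unique (df a b t Ot) (eq_on_isd Z Ot (isdM (isd_cst _ _) d0)).
  rewrite (IH b.+1)//; last by lia.
  move=> E; rewrite -[LHS](addrK ((-1) ^+ a * (f 0%N r.+1 t - a%:R * (f 0%N r)^`()%classic t))).
  by rewrite E exprS -natr1 /=; ring.
by apply: H; rewrite addn0.
Qed.

End MixedJets.

(** * Jets of a graded linear Hamiltonian system *)

Section HamiltonianJets.
Context {R : realType} {n : nat}.

(* The symplectic adjoint. *)
Definition sadj (M : 'M[R]_(n + n)) : 'M[R]_(n + n) :=
  block_mx (drsubmx M)^T (- (ursubmx M)^T) (- (dlsubmx M)^T) (ulsubmx M)^T.

Lemma sadj_mul M N : sadj (M *m N) = sadj N *m sadj M.
Proof.
rewrite -[M]submxK -[N]submxK /sadj mulmx_block !(block_mxKul, block_mxKur, block_mxKdl, block_mxKdr).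
rewrite mulmx_block !linearD/= !trmx_mul !(mulmxN, mulNmx) !opprK.
by congr block_mx; rewrite addrC.
Qed.

Lemma sadj1 : sadj 1%:M = 1%:M.
Proof.
rewrite (scalar_mx_block n n 1) /sadj !(block_mxKul, block_mxKur, block_mxKdl, block_mxKdr).
by rewrite !trmx0 !oppr0 !trmx1.
Qed.

Lemma sadjD M N : sadj (M + N) = sadj M + sadj N.
Proof.
rewrite -[M]submxK -[N]submxK /sadj add_block_mx !(block_mxKul, block_mxKur, block_mxKdl, block_mxKdr).
by rewrite add_block_mx !linearD/=.
Qed.

Lemma sadjE M i j : sadj M i j =
  match fintype.split i, fintype.split j with
  | inl a, inl b => M (rshift n b) (rshift n a)
  | inl a, inr b => - M (lshift n b) (rshift n a)
  | inr a, inl b => - M (rshift n b) (lshift n a)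
  | inr a, inr b => M (lshift n b) (lshift n a)
  end.
Proof.
have sl b : fintype.split (lshift n b) = inl b := unsplitK (inl b).
have sr b : fintype.split (rshift n b) = inr b := unsplitK (inr b).
case: (split_ordP i) => a ->; case: (split_ordP j) => b ->; rewrite ?sl ?sr.
- by rewrite block_mxEul !mxE.
- by rewrite block_mxEur !mxE.
- by rewrite block_mxEdl !mxE.
- by rewrite block_mxEdr !mxE.
Qed.

Variables (O : set R) (AA c : R -> 'M[R]_n) (b : 'M[R]_n).
Hypotheses (oO : open O).
Hypotheses (sAA : smx O AA) (sc : smx O c).
Hypothesis c_sym : forall t, O t -> (c t)^T = c t.
Hypothesis b_sym : b^T = b.

(** The generator, acting from the right on rows (A | B). *)
Definition hamx t := block_mx (AA t) (- c t) b (- (AA t)^T).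

Lemma smx_hamx : smx O hamx.
Proof.
move=> i j; case: (split_ordP i) => k ->; case: (split_ordP j) => l ->.
- by rewrite (_ : (fun _ => _) = fun s => AA s k l)//; apply/funext => s; rewrite block_mxEul.
- rewrite (_ : (fun _ => _) = fun s => (- c s) k l).
    exact: (smxN oO sc).
  by apply/funext => s; rewrite block_mxEur.
- rewrite (_ : (fun _ => _) = fun s => b k l); first exact: smooth1_cst.
  by apply/funext => s; rewrite block_mxEdl.
- rewrite (_ : (fun _ => _) = fun s => (- (AA s)^T) k l).
    exact: (smxN oO (smxT sAA)).
  by apply/funext => s; rewrite block_mxEdr.
Qed.

Lemma sadj_hamx t : O t -> sadj (hamx t) = - hamx t.
Proof.
move=> Ot; rewrite /sadj /hamx !(block_mxKul, block_mxKur, block_mxKdl, block_mxKdr).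
have trN (M : 'M[R]_n) : (- M)^T = - M^T by rewrite linearN.
by rewrite opp_block_mx !trN !opprK trmxK c_sym// b_sym.
Qed.

(** Determined by the requirement that the [l]-th derivative of any solution [X] of X' = X [hamx] be
    [X *m hjet l]. Thus [hjet l t] is the [l]-th derivative at [t] of the fundamental solution
    started at [t]. *)
Fixpoint hjet j : R -> 'M[R]_(n + n) :=
  if j is j'.+1 then fun t => dmx (hjet j') t + hamx t *m hjet j' t
  else fun=> 1%:M.

Lemma smx_hjet j : smx O (hjet j).
Proof.
elim: j => [|j IH] /=; first exact: smx_cst.
apply: (@smxD _ _ oO); first exact: smx_dmx.
apply: (@smxM _ _ oO) => //; exact: smx_hamx.
Qed.

Lemma smx_sadj F : smx O F -> smx O (fun t => sadj (F t)).
Proof.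
move=> sF i j.
have sE : (fun s => sadj (F s) i j) = fun s => match fintype.split i, fintype.split j with
  | inl a, inl b => F s (rshift n b) (rshift n a)
  | inl a, inr b => - F s (lshift n b) (rshift n a)
  | inr a, inl b => - F s (rshift n b) (lshift n a)
  | inr a, inr b => F s (lshift n b) (lshift n a)
  end by apply/funext => s; rewrite sadjE.
rewrite sE; case: (fintype.split i) => k; case: (fintype.split j) => l; try exact: sF.
  by apply: smooth1N => //; exact: sF.
by apply: smooth1N => //; exact: sF.
Qed.

Lemma dmx_sadj F t : smx O F -> O t -> dmx (fun s => sadj (F s)) t = sadj (dmx F t).
Proof.
move=> sF Ot; apply/matrixP => i j; rewrite mxE sadjE.
have sE : (fun s => sadj (F s) i j) = fun s => match fintype.split i, fintype.split j with
  | inl a, inl b => F s (rshift n b) (rshift n a)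
  | inl a, inr b => - F s (lshift n b) (rshift n a)
  | inr a, inl b => - F s (rshift n b) (lshift n a)
  | inr a, inr b => F s (lshift n b) (lshift n a)
  end by apply/funext => s; rewrite sadjE.
have dN k l : (fun s => - F s k l)^`()%classic t = - dmx F t k l.
  have -> : - dmx F t k l = dmx (fun s => - F s) t k l by rewrite (dmxN sF Ot) !mxE.
  by rewrite mxE; congr (derive1 _ t); apply/funext => s; rewrite mxE.
rewrite sE; case: (fintype.split i) => k; case: (fintype.split j) => l; rewrite ?dN//.
  by rewrite [RHS]mxE.
by rewrite [RHS]mxE.
Qed.

(** The derivative at s = t, of order [j] in s and [l] in t, of [sadj (X s) *m X t] for a symplectic
    fundamental solution [X]: the factors [sadj (X t) *m X t] in the middle cancel. *)
Definition hjet2 j l t := sadj (hjet j t) *m hjet l t.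

(** The contributions of [hamx] to the two jets cancel, because [sadj] changes its sign. *)
Lemma isd_hjet2 j l t i k : O t ->
  isd (fun s => hjet2 j l s i k) t (hjet2 j.+1 l t i k + hjet2 j l.+1 t i k).
Proof.
move=> Ot.
have -> : hjet2 j.+1 l t i k + hjet2 j l.+1 t i k = dmx (hjet2 j l) t i k.
  have -> : dmx (hjet2 j l) t = hjet2 j.+1 l t + hjet2 j l.+1 t; last by rewrite !mxE.
  rewrite /hjet2 (dmxM (smx_sadj (smx_hjet j)) (smx_hjet l) Ot).
  rewrite dmx_sadj//; last exact: smx_hjet.
  rewrite /= sadjD sadj_mul sadj_hamx// mulmxDl mulmxDr mulmxN mulNmx -!mulmxA.
  by rewrite [X in _ = _ + X]addrC addrA subrK.
exact: (smx_isd (smxM oO (smx_sadj (smx_hjet j)) (smx_hjet l)) Ot).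
Qed.

Section Flow.
Context {q : nat} (X : R -> 'M[R]_(q, n + n)).
Hypothesis dX : forall t i j, O t ->
  isd (fun s => X s i j) t ((X t *m hamx t) i j).

Lemma smx_flow : smx O X.
Proof. exact: (smx_linear_ode oO smx_hamx). Qed.

Lemma derive1n_flow l t i j : O t ->
  (fun s => X s i j)^`(l)%classic t = (X t *m hjet l t) i j.
Proof.
elim: l t => [|l IH] t Ot; first by rewrite /= mulmx1.
rewrite derive1nS (eq_on_derive1 (g := fun s => (X s *m hjet l s) i j) oO)//; last first.
  by move=> s /set_mem; exact: IH.
have sX := smx_flow; have sH := smx_hjet l.
have [_ ->] := smx_isd (smxM oO sX sH) Ot i j.
have dXE : dmx X t = X t *m hamx t.
  by apply/matrixP => a d; rewrite mxE; have [] := dX a d Ot.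
by rewrite (dmxM sX sH Ot) /= mulmxDr addrC dXE mulmxA.
Qed.

End Flow.

Variables (w : 'I_n -> nat) (g : R -> 'M[R]_n).
Hypothesis g_ortho : forall t a b, O t -> w a = w b -> g t a b = (a == b)%:R.
Hypothesis g_sym : forall t a b, O t -> g t a b = g t b a.
Hypothesis g_nest : forall t p a b, O t -> (p <= w a)%N ->
  \sum_(k | w k == p) g t a k * g t k b = g t a b.
Hypothesis bE : forall i j, b i j = ((i == j) && (w i == 0))%N%:R.
Hypothesis AA0 : forall t i j, O t -> (w i + 1 < w j)%N -> AA t i j = 0.
Hypothesis AA1 : forall t i j, O t -> w j = (w i + 1)%N -> AA t i j = - g t i j.

(** A grading of the 2n coordinates for which [hamx] raises the level by at most one: momenta of
    weight w have level -w, positions w + 1. From momentum [i] to position [j] there are w i + w j +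
    1 steps, the power of t carried by the entry of A. [sgn] accounts for the signs in the part of
    degree one. *)
Let lev (r : 'I_(n + n)) : int :=
  match fintype.split r with inl a => (w a)%:Z + 1 | inr a => - (w a)%:Z end.
Let sgn (r : 'I_(n + n)) : R :=
  match fintype.split r with inl a => (-1) ^+ w a | inr a => 1 end.
Let idx (r : 'I_(n + n)) : 'I_n := match fintype.split r with inl a => a | inr a => a end.

Let sl (a : 'I_n) : fintype.split (lshift n a) = inl a :> 'I_n + 'I_n. Proof. exact: (unsplitK (inl a)). Qed.
Let sr (a : 'I_n) : fintype.split (rshift n a) = inr a :> 'I_n + 'I_n. Proof. exact: (unsplitK (inr a)). Qed.

Let levl a : lev (lshift n a) = (w a)%:Z + 1. Proof. by rewrite /lev sl. Qed.
Let levr a : lev (rshift n a) = - (w a)%:Z. Proof. by rewrite /lev sr. Qed.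

Let hamx0 t i j : O t -> lev i + 1 < lev j -> hamx t i j = 0.
Proof.
move=> Ot; case: (split_ordP i) => a ->; case: (split_ordP j) => d ->; rewrite ?levl ?levr => H.
- by rewrite block_mxEul AA0//; lia.
- by exfalso; lia.
- by rewrite block_mxEdl bE; case: eqP => //= E; case: eqP => // E'; subst d; exfalso; lia.
- by rewrite block_mxEdr !mxE AA0 ?oppr0//; lia.
Qed.

Let hamx1 t i j : O t -> lev j = lev i + 1 ->
  hamx t i j = sgn i * sgn j * g t (idx i) (idx j).
Proof.
move=> Ot; rewrite /sgn /idx.
case: (split_ordP i) => a ->; case: (split_ordP j) => d ->; rewrite ?levl ?levr => H; rewrite ?sl ?sr.
- have wd : w d = (w a + 1)%N by lia.
  rewrite block_mxEul AA1// wd exprD expr1 mulrA -expr2 sqrr_sign mul1r.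
  by rewrite mulN1r.
- by exfalso; lia.
- have [wa wd] : w a = 0%N /\ w d = 0%N by lia.
  by rewrite block_mxEdl bE wa eqxx andbT wd expr0 !mul1r g_ortho// wa wd.
- rewrite block_mxEdr !mxE AA1//; last by lia.
  by rewrite opprK !mul1r g_sym.
Qed.

(** Levels from 1 on are position blocks and the others momentum blocks. On the momentum side this
    is [g_nest] based at [i], on the position side its transpose based at [j]. *)
Let level_nest t i j l : O t -> lev i < l <= lev j ->
  \sum_(k | lev k == l) g t (idx i) (idx k) * g t (idx k) (idx j) =
  g t (idx i) (idx j).
Proof.
move=> Ot /andP[il lj]; rewrite big_split_ord/=.
have [l1|l0] := lerP 1 l.
  rewrite [X in _ + X]big1 ?addr0 => [|k /eqP]; last by rewrite levr; lia.
  have [a ja] : exists a, j = lshift n a.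
    by case: (split_ordP j) lj => a -> //; [exists a|rewrite levr; lia].
  rewrite ja levl in lj *.
  have E : idx (lshift n a) = a by rewrite /idx sl.
  rewrite E [RHS]g_sym// -(@g_nest t `|l - 1|%N a (idx i))//; last by lia.
  apply: eq_big => k; first by rewrite levl; lia.
  by move=> _; rewrite /idx sl mulrC [X in X * _]g_sym// [X in _ * X]g_sym.
rewrite big1 ?add0r => [|k /eqP]; last by rewrite levl; lia.
have [a ja] : exists a, i = rshift n a.
  by case: (split_ordP i) il => a -> //; [rewrite levl; lia|exists a].
rewrite ja levr in il *.
have E : idx (rshift n a) = a by rewrite /idx sr.
rewrite E -(@g_nest t `|l|%N a (idx j))//; last by lia.
apply: eq_big => k; first by rewrite levr; lia.
by move=> _; rewrite /idx sr.
Qed.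

(** Each factor [hamx] raises the level by at most one and differentiation does not raise it, so
    level [j] is reached only by products of parts of degree one. Those collapse by [level_nest],
    the intermediate signs being squared. *)
Let hjet_level j t r s : O t ->
  (lev r + j%:Z < lev s -> hjet j t r s = 0) /\
  (lev s = lev r + j%:Z -> hjet j t r s = sgn r * sgn s * g t (idx r) (idx s)).
Proof.
elim: j t r s => [|j IH] t r s Ot.
  rewrite /= mxE addr0; split; first by case: eqP => // ->; rewrite ltxx.
  rewrite /sgn /idx.
  case: (split_ordP r) => a ->; case: (split_ordP s) => d ->; rewrite ?levl ?levr => H; rewrite ?sl ?sr.
  - have wad : w a = w d by lia.
    by rewrite (inj_eq (@lshift_inj _ _)) g_ortho// wad -expr2 sqrr_sign mul1r.
  - by exfalso; lia.
  - by exfalso; lia.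
  - have wad : w a = w d by lia.
    by rewrite (inj_eq (@rshift_inj _ _)) g_ortho// !mul1r.
have d0 : lev r + j%:Z < lev s -> dmx (hjet j) t r s = 0.
  move=> H; rewrite mxE.
  have Z : {in O, cst 0 =1 (fun u => hjet j u r s)}.
    by move=> u /set_mem Ou; rewrite (IH u r s Ou).1.
  by rewrite -(eq_on_derive1 oO Z Ot) derive1_cst.
split=> H; rewrite /= mxE [X in _ + X]mxE d0 ?add0r; try by lia.
  apply: big1 => k _; have [rk|rk] := ltrP (lev r + 1) (lev k).
    by rewrite hamx0 ?mul0r.
  by rewrite (IH t k s Ot).1 ?mulr0//; lia.
rewrite (bigID (fun k => lev k == lev r + 1))/= [X in _ + X]big1 ?addr0; last first.
  move=> k /eqP Hk; have [rk|rk] := ltrP (lev r + 1) (lev k).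
    by rewrite hamx0 ?mul0r.
  by rewrite (IH t k s Ot).1 ?mulr0//; lia.
rewrite -(@level_nest t r s (lev r + 1))//; last by lia.
rewrite mulr_sumr; apply: eq_bigr => k /eqP Hk.
rewrite hamx1// (IH t k s Ot).2; last by lia.
have sk : sgn k * sgn k = 1.
  by rewrite /sgn; case: (fintype.split k) => a; rewrite ?mulr1// -expr2 sqrr_sign.
rewrite -[RHS]mul1r -sk; ring.
Qed.

(* phi and x are the leading and the next Taylor numerators at t of the
   fundamental solution started at t *)
Let phi i j t := hjet (w i + w j).+1 t (rshift n i) (lshift n j).
Let x i j t := hjet (w i + w j).+2 t (rshift n i) (lshift n j).

Let phiE i j t : O t -> phi i j t = (-1) ^+ w j * g t i j.
Proof.
move=> Ot; rewrite /phi (hjet_level _ _ _ Ot).2; last by rewrite levr levl; lia.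
by rewrite /sgn /idx sl sr mul1r.
Qed.

Let hjet_low i j l t : O t -> (l <= w i + w j)%N ->
  hjet l t (rshift n i) (lshift n j) = 0.
Proof. by move=> Ot H; rewrite (hjet_level _ _ _ Ot).1// levr levl; lia. Qed.

(** [mixed_jets] for a momentum-position entry of [hjet2]: the jets in t alone give [x i j], those
    in s alone give, through [sadj], the entry with exchanged indices. This is how symplecticity
    constrains the next Taylor coefficient. *)
Let jets_sym i j t : O t ->
  x j i t = - (-1) ^+ (w i + w j) * (x i j t - (w i + w j).+2%:R * (phi i j)^`()%classic t).
Proof.
move=> Ot; pose f a d t := hjet2 a d t (rshift n i) (lshift n j).
have f0 d u : f 0%N d u = hjet d u (rshift n i) (lshift n j).
  by rewrite /f /hjet2 /= sadj1 mul1mx.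
have fa a u : f a 0%N u = - hjet a u (rshift n j) (lshift n i).
  by rewrite /f /hjet2 /= mulmx1 sadjE sl sr.
have [||_] := @mixed_jets _ O oO f (w i + w j).+1 _ _ t Ot.
- by move=> a d u Ou; exact: isd_hjet2.
- by move=> d u Ou; rewrite ltnS f0; exact: hjet_low.
have -> : f 0%N (w i + w j).+1 = phi i j by apply/funext => u; rewrite f0.
rewrite fa f0 -/(x i j t) addnC -/(x j i t) addnC => /eqP.
rewrite eqr_oppLR => /eqP ->.
by rewrite 2!exprS; ring.
Qed.

Variables (A B : R -> 'M[R]_n).
Hypothesis O0 : O 0.
Hypothesis dA : forall t i j, O t ->
  isd (fun s => A s i j) t ((A t *m AA t + B t *m b) i j).
Hypothesis dB : forall t i j, O t ->
  isd (fun s => B s i j) t ((- (A t *m c t) - B t *m (AA t)^T) i j).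
Hypothesis A_init : A 0 = 0.
Hypothesis B_init : B 0 = 1%:M.

Theorem weighted_flow_expansion : exists K : R -> 'M[R]_n,
  [/\ forall t i j, O t -> A t i j = t ^+ (w i + w j).+1 * K t i j,
      isd (fun t => \det (K t)) 0 0 & 0 < \det (K 0)].
Proof.
pose X t := row_mx (A t) (B t).
have dX t i j : O t -> isd (fun s => X s i j) t ((X t *m hamx t) i j).
  move=> Ot; rewrite /X /hamx mul_row_block !mulmxN -[X in row_mx _ (_ + X)]/(- _).
  case: (split_ordP j) => d ->.
    rewrite row_mxEl (_ : (fun _ => _) = fun s => A s i d); first exact: dA.
    by apply/funext => s; rewrite row_mxEl.
  rewrite row_mxEr (_ : (fun _ => _) = fun s => B s i d); first exact: dB.
  by apply/funext => s; rewrite row_mxEr.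
have sX := smx_flow dX.
have sA i j : smooth1 O (fun s => A s i j).
  have := sX i (lshift n j); congr smooth1; apply/funext => s.
  by rewrite /X row_mxEl.
have dnA l i j : (fun s => A s i j)^`(l)%classic 0 = hjet l 0 (rshift n i) (lshift n j).
  transitivity ((fun s => X s i (lshift n j))^`(l)%classic 0).
    by congr (derive1n l _ 0); apply/funext => s; rewrite /X row_mxEl.
  rewrite (derive1n_flow dX)// /X A_init B_init -[hjet l 0 in LHS]submxK mul_row_block.
  by rewrite row_mxEl !mul0mx mul1mx add0r !mxE.
(* [k0] and [k1] are the value and the derivative of [K] at 0; [dk0] is the derivative of the
   leading coefficient when the base point moves. *)
pose k0 := \matrix_(i, j) (phi i j 0 / (w i + w j).+1`!%:R).
pose k1 := \matrix_(i, j) (x i j 0 / (w i + w j).+2`!%:R).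
pose dk0 := \matrix_(i, j) ((phi i j)^`()%classic 0 / (w i + w j).+1`!%:R).
pose K t := \matrix_(i, j) (if t == 0 then k0 i j else A t i j / t ^+ (w i + w j).+1).
have K0 : K 0 = k0 by apply/matrixP => i j; rewrite mxE eqxx.
have dK i j : isd (fun s => K s i j) 0 (k1 i j).
  have KE : (fun s => K s i j) = fun t => if t == 0 then
     (fun s => A s i j)^`((w i + w j).+1)%classic 0 / ((w i + w j).+1)`!%:R
     else A t i j / t ^+ (w i + w j).+1.
    by apply/funext => t; rewrite !mxE dnA.
  have k1E : k1 i j =
      (fun s => A s i j)^`((w i + w j).+2)%classic 0 / ((w i + w j).+2)`!%:R.
    by rewrite mxE dnA.
  rewrite KE k1E; apply: (@isd_quot_expr _ O _ (w i + w j).+1 oO O0 (sA i j)).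
  by move=> l lw; rewrite dnA hjet_low.
have dphi i j t : O t -> isd (phi i j) t ((phi i j)^`()%classic t).
  by move=> Ot; have [] := smx_isd (smx_hjet (w i + w j).+1) Ot (rshift n i) (lshift n j).
(* The leading coefficient at base point [t]. Its determinant does not depend on [g t], hence not on
   [t]; this makes the trace [tr0] vanish. *)
pose KK t := \matrix_(i, j) (phi i j t / (w i + w j).+1`!%:R).
have detKK t : O t -> \det (KK t) = \prod_a (hilbert_low (w a) (w a) * hilbert_up (w a) (w a)).
  move=> Ot; rewrite -(@det_weighted_gram _ _ w (g t)).
  - by congr (\det _); apply/matrixP => i j; rewrite !mxE phiE// mulrAC.
  - by move=> a d; exact: g_ortho.
  - by move=> p a d; exact: g_nest.
have KK0 : KK 0 = k0 by [].
have det0 : 0 < \det k0 by rewrite -KK0 detKK//; exact: det_weighted_gram_gt0.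
have uk0 : k0 \in unitmx by rewrite unitmxE unitfE gt_eqF.
have tr0 : \tr (dk0 *m \adj k0) = 0.
  have Z : {in O, cst (\det (KK 0)) =1 (fun t => \det (KK t))}.
    by move=> t /set_mem Ot; rewrite /= !detKK.
  apply: (isd_unique _ (eq_on_isd oO Z O0 (isd_cst _ _))).
  rewrite -KK0; apply: isd_det => i j.
  have KKE : (fun s => KK s i j) = fun s => phi i j s * (w i + w j).+1`!%:R^-1.
    by apply/funext => t; rewrite mxE.
  have dE : dk0 i j = (phi i j)^`()%classic 0 * (w i + w j).+1`!%:R^-1 + phi i j 0 * 0.
    by rewrite mxE mulr0 addr0.
  rewrite KKE dE; exact: (isdM (dphi i j 0 O0) (isd_cst _ 0)).
exists K; split=> [t i j Ot||]; last by rewrite K0.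
  rewrite mxE; case: eqP => [->|/eqP t0].
    by rewrite A_init mxE expr0n mul0r.
  by rewrite mulrC divfK// expf_neq0.
suff tr1 : \tr (k1 *m \adj k0) = 0.
  have := @isd_det _ _ K 0 k1 dK; rewrite K0 tr1.
  exact.
pose S : 'M[R]_n := diag_mx (\row_i (-1) ^+ w i).
have SS : S *m S = 1%:M.
  rewrite /S mulmx_diag; apply/matrixP => i j; rewrite !mxE -expr2 sqrr_sign.
  by [].
have conjS (M : 'M[R]_n) i j : (S *m M *m S) i j = (-1) ^+ (w i + w j) * M i j.
  by rewrite mul_mx_diag mxE mul_diag_mx !mxE exprD mulrAC.
have k0T : k0^T = S *m k0 *m S.
  apply/matrixP => i j; rewrite conjS !mxE !phiE// (g_sym j i O0) [(w j + w i)%N]addnC.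
  rewrite exprD; have := sqrr_sign R (w j); rewrite expr2 => sgn2.
  set a := (-1) ^+ w i; set d := (-1) ^+ w j in sgn2 *.
  by rewrite -[LHS]mul1r -{1}sgn2; ring.
have k1T : k1^T = - (S *m (k1 - dk0) *m S).
  apply/matrixP => i j; rewrite [RHS]mxE conjS !mxE jets_sym// [(w j + w i)%N]addnC.
  rewrite (factS (w i + w j).+1) natrM.
  have n2 : (w i + w j).+2%:R != 0 :> R by rewrite pnatr_eq0.
  have f1 : (w i + w j).+1`!%:R != 0 :> R by rewrite pnatr_eq0 -lt0n fact_gt0.
  move: n2 f1; move: ((w i + w j).+2%:R : R) ((w i + w j).+1`!%:R : R) => u v n2 f1.
  field.
  by rewrite ?n2 ?f1.
pose J := invmx k0.
have adjE : \adj k0 = \det k0 *: J.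
  by rewrite /J /invmx uk0 scalerA divff ?scale1r// gt_eqF.
have JT : J^T = S *m J *m S.
  have : k0^T *m (S *m J *m S) = 1%:M.
    by rewrite k0T !mulmxA -[S *m k0 *m S *m S]mulmxA SS mulmx1 -[S *m k0 *m J]mulmxA mulmxV// mulmx1 SS.
  move=> E; rewrite -[LHS]mulmx1 -E (mulmxA J^T) -trmx_mul mulmxV// trmx1.
  by rewrite mul1mx.
(* Transposition under the trace; as [dk0 *m J] has trace 0, the trace of [k1 *m J] is its own
   opposite. *)
have trJ : \tr (k1 *m J) = - \tr ((k1 - dk0) *m J).
  rewrite -[LHS]mxtrace_tr trmx_mul JT k1T mulmxN linearN/=; congr (- _).
  rewrite !mulmxA -[S *m J *m S *m S]mulmxA SS mulmx1 mxtrace_mulC !mulmxA SS mul1mx.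
  by rewrite mxtrace_mulC.
have tr0' : \tr (dk0 *m J) = 0.
  move: tr0; rewrite adjE -scalemxAr linearZ/= => /eqP.
  by rewrite mulf_eq0 gt_eqF//= => /eqP.
rewrite mulmxBl linearB/= tr0' subr0 in trJ.
rewrite adjE -scalemxAr linearZ/=.
have -> : \tr (k1 *m J) = 0 by lra.
by rewrite mulr0.
Qed.

End HamiltonianJets.

(** * Frames adapted to the flag *)

Section Orthogonality.
Context {R : realFieldType}.

Lemma mulmx_tr_eq0 {p n} (v : 'M[R]_(p, n)) : v *m v^T = 0 -> v = 0.
Proof.
move=> v0; apply/matrixP => i j; rewrite mxE.
have : (v *m v^T) i i = 0 by rewrite v0 mxE.
rewrite mxE => /eqP; rewrite psumr_eq0 => [/allP/(_ j)|l _].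
  rewrite mem_index_enum => /(_ isT); rewrite mxE -expr2 sqrf_eq0.
  by move/eqP.
by rewrite mxE -expr2 sqr_ge0.
Qed.

Lemma gram_unit {p n} (v : 'M[R]_(p, n)) :
  (forall c : 'rV[R]_p, c *m v = 0 -> c = 0) -> v *m v^T \in unitmx.
Proof.
move=> v0; rewrite -row_free_unit; apply/row_freeP.
suff k0 : kermx (v *m v^T) = 0.
  by apply/row_freeP; rewrite -kermx_eq0 k0.
apply/row_matrixP => i; rewrite row0; apply: v0; apply: mulmx_tr_eq0.
set c := row _ _; have : c *m (v *m v^T) = 0.
  by apply/sub_kermxP; rewrite row_sub.
by rewrite trmx_mul !mulmxA => ->; rewrite mul0mx.
Qed.

(** The normal equations are solvable even if [A] is rank deficient, because A A^T and A^T have the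
    same rank. *)
Lemma orth_decomp {p q n} (A : 'M[R]_(p, n)) (v : 'M[R]_(q, n)) :
  exists x : 'M[R]_(q, p), (v - x *m A) *m A^T = 0.
Proof.
have H : (A^T <= A *m A^T)%MS.
  have le : (A *m A^T <= A^T)%MS by exact: submxMl.
  rewrite -(geq_leqif (mxrank_leqif_sup le)) mxrank_tr.
  have : (kermx (A *m A^T) <= kermx A)%MS.
    apply/sub_kermxP/mulmx_tr_eq0; rewrite trmx_mul mulmxA -[_ *m A *m A^T]mulmxA.
    by rewrite mulmx_ker mul0mx.
  move/mxrankS; rewrite !mxrank_ker => H.
  by have := rank_leq_row A; have := rank_leq_row (A *m A^T); lia.
have /submxP[x xE] : (v *m A^T <= A *m A^T)%MS by apply: submx_trans H; exact: submxMl.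
by exists x; rewrite mulmxBl xE mulmxA subrr.
Qed.

Lemma kermx_tr_cap {n} (F : 'M[R]_n) : (kermx F^T :&: F = 0)%MS.
Proof.
apply/eqP; rewrite -submx0; apply/row_subP => i.
set v := row _ _; have : (v <= kermx F^T :&: F)%MS by exact: row_sub.
rewrite sub_capmx => /andP[/sub_kermxP vF /submxP[x vE]].
rewrite (_ : v = 0) ?sub0mx//; apply: mulmx_tr_eq0.
by rewrite {2}vE trmx_mul mulmxA vF mul0mx.
Qed.

(** [proj_mx] gives no access to smooth dependence on a parameter; this replaces it by a projector
    [Q] for which an explicit formula will be available. *)
Lemma orth_proj {p n} (F Q : 'M[R]_n) (v : 'M[R]_(p, n)) :
  Q^T = Q -> Q *m Q = Q -> (Q :=: F)%MS ->
  v *m proj_mx (kermx F^T) F = v *m (1%:M - Q).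
Proof.
move=> QT QQ QF.
have FQ : F *m Q = F.
  have /submxP[x ->] : (F <= Q)%MS by rewrite QF.
  by rewrite -mulmxA QQ.
have vE : v = v *m (1%:M - Q) + v *m Q by rewrite mulmxBr mulmx1 subrK.
rewrite {1}vE [LHS]mulmxDl proj_mx_id ?kermx_tr_cap//; last first.
  apply/sub_kermxP; rewrite -mulmxA mulmxBl mul1mx.
  have -> : Q *m F^T = F^T by rewrite -QT -trmx_mul FQ.
  by rewrite subrr mulmx0.
rewrite proj_mx_0 ?kermx_tr_cap//; last by rewrite -QF submxMl.
by rewrite addr0.
Qed.

End Orthogonality.

Section BlockSelection.
Context {R : realFieldType}.

(* Sel i lists the standard basis vectors of the block of weight i. *)
Record block_selection (m n : nat) (d : nat -> nat) (w : 'I_n -> nat)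
    (Sel : forall i, 'M[R]_(d i, n)) : Prop := {
  sel_lt : forall a, (w a < m)%N;
  selK : forall i, (i < m)%N -> Sel i *m (Sel i)^T = 1%:M;
  sel_diag : forall i, (i < m)%N -> (Sel i)^T *m Sel i = diag_mx (\row_a (w a == i)%:R);
  sel_sum : forall f : nat -> nat, (\sum_a f (w a) = \sum_(i < m) f i * d i)%N
}.

Lemma block_selection_exists m n (d : nat -> nat) : (\sum_(i < m) d i = n)%N ->
  exists w Sel, @block_selection m n d w Sel.
Proof.
(* Indices are pairs of a block and a position in it, numbered by an arbitrary enumeration; [w] and
   [r] recover the two components. *)
move=> dn; pose T := {i : 'I_m & 'I_(d i)}.
have cT : #|{: T}| = n.
  rewrite card_tagged sumnE big_map big_enum/= -dn.
  by apply: eq_bigr => i _; rewrite card_ord.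
pose io (a : 'I_n) : T := enum_val (cast_ord (esym cT) a).
pose oi (x : T) : 'I_n := cast_ord cT (enum_rank x).
have ioK : cancel io oi by move=> a; rewrite /io /oi enum_valK cast_ordKV.
have oiK : cancel oi io by move=> x; rewrite /io /oi cast_ordK enum_rankK.
pose w a : nat := tag (io a).
pose r a : nat := tagged (io a).
have wr_inj a b : w a = w b -> r a = r b -> a = b.
  rewrite /w /r => H1 H2; apply: (can_inj ioK); move: H1 H2.
  case: (io a) (io b) => i s [j s'] /= ij; move: s'; rewrite -(val_inj ij) => s' ss.
  by congr existT; exact: val_inj.
pose Sel i : 'M[R]_(d i, n) := \matrix_(s, a) ((w a == i) && (r a == s))%:R.
exists w, Sel; split.
- by move=> a; rewrite /w ltn_ord.
- move=> i im; apply/matrixP => s s'; rewrite !mxE.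
  pose x (s : 'I_(d i)) : T := existT _ (Ordinal im) s.
  have wx u : w (oi (x u)) = i by rewrite /w oiK.
  have rx u : r (oi (x u)) = u by rewrite /r oiK.
  rewrite (bigD1 (oi (x s)))//= big1 ?addr0 => [|a].
    by rewrite !mxE wx rx !eqxx/= mul1r -val_eqE.
  move=> ne; rewrite !mxE; case: eqP => [wa|]; last by rewrite !mul0r.
  case: eqP => [ra|]; last by rewrite !mul0r.
  by case/eqP: ne; apply: wr_inj; rewrite ?wx ?rx.
- move=> i im; apply/matrixP => a b; rewrite !mxE.
  have [wa|wa] := eqVneq (w a) i; last first.
    rewrite mul0rn; apply: big1 => s _; rewrite !mxE (negPf wa) mul0r.
    by [].
  have ra : (r a < d i)%N by rewrite -wa /r /w ltn_ord.
  rewrite (bigD1 (Ordinal ra))//= big1 ?addr0 => [|s ne].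
    rewrite !mxE wa !eqxx mul1r; congr _%:R.
    move: (ra) => /= _; have [ab|ab] := eqVneq a b; first by rewrite -ab wa /= !eqxx.
    case: eqP => //= wb; case: eqP => //= rb.
    by case/eqP: ab; apply: wr_inj; rewrite ?wb ?rb.
  rewrite !mxE wa eqxx/=; case: eqP => [E|]; last by rewrite mul0r.
  by case/eqP: ne; exact: val_inj.
- move=> f; rewrite (reindex oi)/=; last by exists io => ? _; rewrite ?ioK ?oiK.
  rewrite (eq_bigr (fun x : T => f (tag x))); last by move=> x _; rewrite /w oiK.
  rewrite (eq_bigr (fun x : T => (fun (i : 'I_m) (_ : 'I_(d i)) => f i) (tag x) (tagged x)))//.
  rewrite -(sig_big_dep (fun _ => true) (fun _ _ => true) (fun (i : 'I_m) (_ : 'I_(d i)) => f i))/=.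
  by apply: eq_bigr => i _; rewrite sum_nat_const card_ord mulnC.
Qed.

End BlockSelection.

(** * The moving frame adapted to the flag and its Gram matrices *)

Section FlagFrames.
Context {R : realType} {n k : nat} (m : nat) (d : nat -> nat).
Variables (O : set R) (oO : open O).
Variables (D : R -> 'M[R]_(k, n)) (Lam : R -> 'M[R]_n) (F : nat -> R -> 'M[R]_n).
Variable E : forall i, R -> 'M[R]_(d i, n).
Hypotheses (sD : smx O D) (sLam : smx O Lam).

(* Covariant derivative along the curve, in the components of a frame. *)
Definition nab {p} (V : R -> 'M[R]_(p, n)) t := dmx V t + V t *m Lam t.

(** For [v] in D, [v *m (D t)^T *m njet j t] is the [j]-th Lie derivative of the extension of [v]
    with constant coefficients in [D]: modulo F^j, the value of L_T^j at [v]. *)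
Fixpoint njet j : R -> 'M[R]_(k, n) := if j is j'.+1 then nab (njet j') else D.

Hypothesis DD : forall t, O t -> D t *m (D t)^T = 1%:M.
Hypothesis F0 : forall t, O t -> F 0 t = 0.
Hypothesis FS : forall i t, O t -> (F i.+1 t :=: F i t + njet i t)%MS.
Hypothesis F_full : forall t, O t -> row_full (F m t).
Hypothesis sE : forall i, (i < m)%N -> smx O (@E i).
Hypothesis EE : forall i t, (i < m)%N -> O t -> E i t *m (E i t)^T = 1%:M.
Hypothesis EK : forall i t (v : 'rV[R]_n), (i < m)%N -> O t ->
  (v <= E i t)%MS <-> (v <= D t)%MS /\
    forall w : 'rV[R]_n, (w <= D t)%MS -> (w *m (D t)^T *m njet i t <= F i t)%MS ->
      v *m w^T = 0.

Lemma smx_nab {p} (V : R -> 'M[R]_(p, n)) : smx O V -> smx O (nab V).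
Proof. by move=> sV; apply: smxD => //; [exact: smx_dmx|exact: smxM]. Qed.

Lemma smx_njet j : smx O (njet j).
Proof. by elim: j => //= j IH; exact: smx_nab. Qed.

Lemma nabM {p q} (C : R -> 'M[R]_(q, p)) (V : R -> 'M[R]_(p, n)) t :
  smx O C -> smx O V -> O t ->
  nab (fun s => C s *m V s) t = dmx C t *m V t + C t *m nab V t.
Proof. by move=> sC sV Ot; rewrite /nab (dmxM sC sV Ot) -addrA mulmxDr mulmxA. Qed.

Lemma D_proj t p (v : 'M[R]_(p, n)) : O t -> (v <= D t)%MS ->
  v *m (D t)^T *m D t = v.
Proof.
by move=> Ot /submxP[x ->]; rewrite -[x *m D t *m _]mulmxA DD// mulmx1.
Qed.

Section Pointwise.
Variables (i : nat) (t : R) (im : (i < m)%N) (Ot : O t).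

Lemma E_sub_D : (E i t <= D t)%MS.
Proof. by apply/row_subP => r; have [] := (EK _ im Ot).1 (row_sub r (E i t)). Qed.

Lemma E_proj p (v : 'M[R]_(p, n)) : (v <= E i t)%MS -> v *m (E i t)^T *m E i t = v.
Proof. by move=> /submxP[x ->]; rewrite -[x *m E i t *m _]mulmxA EE// mulmx1. Qed.

(* The orthogonal complement of E i in D is the kernel of the i-th map: the
   double orthogonal complement of a subspace is the subspace. *)
Lemma E_perp p (z : 'M[R]_(p, n)) : (z <= D t)%MS -> z *m (E i t)^T = 0 ->
  (z *m (D t)^T *m njet i t <= F i t)%MS.
Proof.
move=> zD zE; apply/row_subP => r; rewrite !row_mul.
have {zD} : (row r z <= D t)%MS by apply: submx_trans zD; exact: row_sub.
have {zE} : row r z *m (E i t)^T = 0 by rewrite -row_mul zE row0.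
move: (row r z) => {}z zE zD.
pose K := (D t :&: kermx ((D t)^T *m njet i t *m cokermx (F i t)))%MS.
have KP (w : 'rV[R]_n) : (w <= K)%MS =
    (w <= D t)%MS && (w *m (D t)^T *m njet i t <= F i t)%MS.
  rewrite sub_capmx; congr andb; rewrite [RHS]submxE -!mulmxA.
  by apply/sub_kermxP/eqP; rewrite !mulmxA.
have [x xK] := orth_decomp K z.
have xKK : (x *m K <= K)%MS by exact: submxMl.
have xKD : (x *m K <= D t)%MS by move: xKK; rewrite KP => /andP[].
have zE' : (z - x *m K <= E i t)%MS.
  apply/(EK _ im Ot); split; first by rewrite addmx_sub// eqmx_opp.
  move=> w wD wF; have /submxP[y ->] : (w <= K)%MS by rewrite KP wD.
  by rewrite trmx_mul mulmxA xK mul0mx.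
have zK : z - x *m K = 0.
  apply: mulmx_tr_eq0; rewrite {1}mulmxBl.
  have /submxP[y yE] := zE'.
  rewrite {1}yE trmx_mul mulmxA zE mul0mx sub0r.
  rewrite -[RHS]oppr0; congr (- _).
  by rewrite -[x *m K *m _]mulmxA -(mulmx0 _ x); congr (_ *m _); rewrite -[LHS]trmxK trmx_mul trmxK xK trmx0.
have : (z <= K)%MS by rewrite -[z](subrK (x *m K)) zK add0r.
by rewrite KP => /andP[].
Qed.

Lemma E_ker (w : 'rV[R]_n) : (w <= D t)%MS ->
  (w *m (D t)^T *m njet i t <= F i t)%MS -> w *m (E i t)^T = 0.
Proof.
move=> wD wF; rewrite -[LHS]trmxK trmx_mul trmxK -[RHS]trmxK; congr _^T.
rewrite trmx0; apply/row_matrixP => r; rewrite row_mul row0.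
by have [_ H] := (EK _ im Ot).1 (row_sub r (E i t)); exact: H.
Qed.

(** The image of the frame [E j] under L_T^j. Counting starts at 0: block [j] belongs to
    F^(j+1)/F^j. *)
Definition FY j s := E j s *m (D s)^T *m njet j s.

(** The rows of [D] are split into their components along [E i] and orthogonal to it; by [E_perp]
    the latter contribute only vectors of F^i. *)
Lemma flag_FY : (F i.+1 t :=: F i t + FY i t)%MS.
Proof.
apply/eqmxP/andP; split; last first.
  rewrite addsmx_sub !FS// addsmxSl/=.
  by apply: submx_trans (addsmxSr _ _); exact: submxMl.
rewrite FS// addsmx_sub addsmxSl/=.
pose z := D t - D t *m (E i t)^T *m E i t.
have zE : z *m (E i t)^T = 0.
  by rewrite mulmxBl -[_ *m E i t *m _]mulmxA EE// mulmx1 subrr.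
have zD : (z <= D t)%MS.
  rewrite addmx_sub// eqmx_opp; apply: submx_trans E_sub_D; exact: submxMl.
have -> : njet i t = D t *m (E i t)^T *m FY i t + z *m (D t)^T *m njet i t.
  rewrite /FY !mulmxA -mulmxDl -mulmxDl /z addrC subrK DD//.
  by rewrite mul1mx.
apply: (addmx_sub (submx_trans (submxMl _ _) (addsmxSr _ _))).
by apply: submx_trans (addsmxSl _ _); exact: E_perp.
Qed.

(** If a combination of the rows of [FY i] falls into F^i, the same combination of the rows of [E i]
    lies in the kernel to which [E i] is orthogonal, hence is orthogonal to itself. *)
Lemma FY_indep p (c : 'M[R]_(p, d i)) : (c *m FY i t <= F i t)%MS -> c = 0.
Proof.
move=> cF; have cE : (c *m E i t <= D t)%MS.
  by apply: submx_trans E_sub_D; exact: submxMl.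
have H : c *m E i t = 0.
  apply/row_matrixP => r; rewrite row0; apply: mulmx_tr_eq0.
  rewrite row_mul.
  have rE : (row r c *m E i t <= E i t)%MS by exact: submxMl.
  apply: (((EK _ im Ot).1 rE).2); first exact: submx_trans rE E_sub_D.
  rewrite -!row_mul; apply: submx_trans (row_sub _ _) _.
  by move: cF; rewrite /FY !mulmxA.
by rewrite -[c]mulmx1 -(EE im Ot) mulmxA H mul0mx.
Qed.

End Pointwise.

Lemma flag_mono i j t : O t -> (i <= j)%N -> (F i t <= F j t)%MS.
Proof.
move=> Ot; elim: j => [|j IH]; first by rewrite leqn0 => /eqP ->.
rewrite leq_eqVlt => /predU1P[->//|]; rewrite ltnS => /IH ij.
by rewrite FS//; apply: submx_trans ij (addsmxSl _ _).
Qed.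

Lemma njet_flag j t : O t -> (njet j t <= F j.+1 t)%MS.
Proof. by move=> Ot; rewrite FS// addsmxSr. Qed.

Lemma FY_flag j t : O t -> (FY j t <= F j.+1 t)%MS.
Proof. by move=> Ot; apply: submx_trans (njet_flag j Ot); exact: submxMl. Qed.

Lemma smx_FY j : (j < m)%N -> smx O (FY j).
Proof.
move=> jm; rewrite /FY; apply: (@smxM _ _ oO); last exact: smx_njet.
by apply: (@smxM _ _ oO); [exact: sE|exact: smxT].
Qed.

Lemma nab_FY j t : (j < m)%N -> O t ->
  nab (FY j) t = dmx (fun s => E j s *m (D s)^T) t *m njet j t
    + E j t *m (D t)^T *m njet j.+1 t.
Proof.
move=> jm Ot; rewrite /FY nabM//; last exact: smx_njet.
by apply: (@smxM _ _ oO); [exact: sE|exact: smxT].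
Qed.

Lemma nab_FY_flag j t : (j < m)%N -> O t -> (nab (FY j) t <= F j.+2 t)%MS.
Proof.
move=> jm Ot; rewrite nab_FY// addmx_sub//; last first.
  by apply: submx_trans (njet_flag j.+1 Ot); exact: submxMl.
apply: (submx_trans (submxMl _ _)); apply: submx_trans (njet_flag j Ot) _.
exact: flag_mono.
Qed.

Variables (w : 'I_n -> nat) (Sel : forall i, 'M[R]_(d i, n)).
Hypothesis HS : block_selection m w Sel.

Lemma sel_ortho i j : (i < m)%N -> (j < m)%N -> i != j -> Sel i *m (Sel j)^T = 0.
Proof.
move=> im jm ij.
have -> : Sel i = Sel i *m ((Sel i)^T *m Sel i) by rewrite mulmxA (selK HS im) mul1mx.
have -> : (Sel j)^T = ((Sel j)^T *m Sel j) *m (Sel j)^T.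
  by rewrite -mulmxA (selK HS jm) mulmx1.
rewrite (sel_diag HS im) (sel_diag HS jm) !mulmxA -[_ *m diag_mx _ *m diag_mx _]mulmxA.
rewrite mulmx_diag (_ : \row__ _ = 0) ?linear0 ?mulmx0 ?mul0mx//.
apply/rowP => a; rewrite !mxE; case: eqP => [->|_]; last by rewrite mul0r.
by rewrite (negPf ij) mulr0.
Qed.

Lemma sel_total : \sum_(i < m) (Sel i)^T *m Sel i = 1%:M.
Proof.
apply/matrixP => a b; rewrite summxE.
under eq_bigr => i _ do rewrite (sel_diag HS (ltn_ord i)) !mxE.
rewrite sumrMnl mxE; congr (_ *+ _).
rewrite (bigD1 (Ordinal (sel_lt HS a)))//= eqxx big1 ?addr0// => i.
by rewrite -val_eqE/= eq_sym => /negPf ->.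
Qed.

Definition stack (p : nat) (V : forall i, 'M[R]_(d i, p)) : 'M[R]_(n, p) :=
  \sum_(i < m) (Sel i)^T *m V i.

Lemma sel_stack p (V : forall i, 'M[R]_(d i, p)) i : (i < m)%N -> Sel i *m stack V = V i.
Proof.
move=> im; rewrite /stack mulmx_sumr (bigD1 (Ordinal im))//= mulmxA (selK HS im) mul1mx.
rewrite big1 ?addr0// => j ij; rewrite mulmxA sel_ortho ?mul0mx//.
by rewrite eq_sym.
Qed.

Definition lowdiag i : 'M[R]_n := diag_mx (\row_a (w a < i)%:R).

Lemma lowdiag_mul i j : (i <= j)%N -> lowdiag i *m lowdiag j = lowdiag i.
Proof.
move=> ij; rewrite mulmx_diag; congr diag_mx; apply/rowP => a; rewrite !mxE.
case: (ltnP (w a) i) => wi; last by rewrite mul0r.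
by rewrite (leq_trans wi ij) mulr1.
Qed.

Lemma sel_lowdiag i j : (i < m)%N -> Sel i *m lowdiag j = if (i < j)%N then Sel i else 0.
Proof.
move=> im.
have -> : Sel i = Sel i *m ((Sel i)^T *m Sel i) by rewrite mulmxA (selK HS im) mul1mx.
rewrite (sel_diag HS im) -mulmxA mulmx_diag.
case: ifP => ij.
  congr (_ *m diag_mx _); apply/rowP => a; rewrite !mxE.
  by case: eqP => [->|_]; rewrite ?ij ?mulr1 ?mul0r.
rewrite (_ : \row__ _ = 0) ?linear0 ?mulmx0//.
by apply/rowP => a; rewrite !mxE; case: eqP => [->|_]; rewrite ?ij ?mulr0 ?mul0r.
Qed.

Lemma lowdiag_sel i j : (i < m)%N -> lowdiag j *m (Sel i)^T = if (i < j)%N then (Sel i)^T else 0.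
Proof.
move=> im; rewrite -[LHS]trmxK trmx_mul trmxK tr_diag_mx sel_lowdiag//.
by case: ifP => _; rewrite ?trmx0.
Qed.

Definition FYn t := stack (FY^~ t).

Lemma smx_stack p (V : forall i, R -> 'M[R]_(d i, p)) :
  (forall i, (i < m)%N -> smx O (V i)) -> smx O (fun t => stack (V^~ t)).
Proof.
move=> sV a b; rewrite (_ : (fun _ => _) =
    fun t => \sum_(i < m) ((Sel i)^T *m V i t) a b); last first.
  by apply/funext => t; rewrite summxE.
apply: smooth1_sum => // i _.
by apply: (@smxM _ _ oO); [exact: smx_cst|exact: sV].
Qed.

Lemma dmx_stack p (V : forall i, R -> 'M[R]_(d i, p)) t : O t ->
  (forall i, (i < m)%N -> smx O (V i)) ->
  dmx (fun t => stack (V^~ t)) t = stack (fun i => dmx (V i) t).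
Proof.
move=> Ot sV; apply/matrixP => a b; rewrite mxE /stack summxE.
rewrite (_ : (fun _ => _) =
    fun t => \sum_(i < m) ((Sel i)^T *m V i t) a b); last first.
  by apply/funext => s; rewrite summxE.
have H (i : 'I_m) : isd (fun t => ((Sel i)^T *m V i t) a b) t
    (((Sel i)^T *m dmx (V i) t) a b).
  have -> : (Sel i)^T *m dmx (V i) t = 0 *m V i t + (Sel i)^T *m dmx (V i) t.
    by rewrite mul0mx add0r.
  apply: isd_mulmx => x y; last exact: (smx_isd (sV i _) Ot).
  by rewrite [X in isd _ _ X]mxE; exact: isd_cst.
by have [_ ->] := @isd_sum R _ (index_enum 'I_m) xpredT _ t _ (fun i _ => H i).
Qed.

Lemma stack_mulmx p q (V : forall i, 'M[R]_(d i, p)) (B : 'M[R]_(p, q)) :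
  stack V *m B = stack (fun i => V i *m B).
Proof. by rewrite /stack mulmx_suml; apply: eq_bigr => i _; rewrite mulmxA. Qed.

Lemma stackD p (V W : forall i, 'M[R]_(d i, p)) :
  stack V + stack W = stack (fun i => V i + W i).
Proof. by rewrite /stack -big_split/=; apply: eq_bigr => i _; rewrite mulmxDr. Qed.

Lemma lowdiag_stack_sub p (V : forall i, 'M[R]_(d i, p)) q (G : 'M[R]_(q, p)) i :
  (forall j, (j < m)%N -> (j < i)%N -> (V j <= G)%MS) -> (lowdiag i *m stack V <= G)%MS.
Proof.
move=> VG; rewrite /stack mulmx_sumr; apply: summx_sub => j _.
rewrite mulmxA lowdiag_sel//; case: ifP => ji; last by rewrite mul0mx sub0mx.
by apply: submx_trans (VG j _ ji) => //; exact: submxMl.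
Qed.

Lemma flag_sub_FYn i t : O t -> (i <= m)%N -> (F i t <= lowdiag i *m FYn t)%MS.
Proof.
move=> Ot; elim: i => [|i IH] im; first by rewrite F0// sub0mx.
rewrite flag_FY// addsmx_sub; apply/andP; split.
  apply: submx_trans (IH (ltnW im)) _.
  by rewrite -(lowdiag_mul (leqnSn i)) -mulmxA submxMl.
rewrite -(sel_stack (FY^~ t) im).
have -> : Sel i = Sel i *m lowdiag i.+1 by rewrite sel_lowdiag// ltnSn.
by rewrite -mulmxA submxMl.
Qed.

Lemma FYn_unit t : O t -> FYn t \in unitmx.
Proof.
move=> Ot; rewrite -row_full_unit -sub1mx.
have : (1%:M <= F m t)%MS by rewrite sub1mx F_full.
move/submx_trans; apply; apply: submx_trans (flag_sub_FYn Ot (leqnn m)) _.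
exact: submxMl.
Qed.

Lemma lowdiag_FYn_sub i t : O t -> (lowdiag i *m FYn t <= F i t)%MS.
Proof.
move=> Ot; apply: lowdiag_stack_sub => j jm ji.
by apply: submx_trans (FY_flag j Ot) _; exact: flag_mono.
Qed.

(** By [flag_sub_FYn] a vector of F^i is a combination of frame vectors of weight less than [i], and
    coordinates in a frame are unique. *)
Lemma flag_coord i t p (V : 'M[R]_(p, n)) : O t -> (i <= m)%N -> (V <= F i t)%MS ->
  V *m invmx (FYn t) = V *m invmx (FYn t) *m lowdiag i.
Proof.
move=> Ot im VF; have /submxP[u ->] := submx_trans VF (flag_sub_FYn Ot im).
rewrite !mulmxA -[_ *m FYn t *m _]mulmxA mulmxV ?FYn_unit// mulmx1.
by rewrite -mulmxA lowdiag_mul.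
Qed.

Lemma flag_coord0 i t p (V : 'M[R]_(p, n)) a b : O t -> (i <= m)%N -> (V <= F i t)%MS ->
  (i <= w b)%N -> (V *m invmx (FYn t)) a b = 0.
Proof.
move=> Ot im VF ib; rewrite (flag_coord Ot im VF) mul_mx_diag mxE.
by rewrite [X in _ * X]mxE ltnNge ib mulr0.
Qed.

Lemma smx_FYn : smx O FYn.
Proof. exact: (smx_stack smx_FY). Qed.

Lemma nab_FYn t : O t -> nab FYn t = stack (fun i => nab (FY i) t).
Proof.
move=> Ot; rewrite /nab /FYn (dmx_stack Ot smx_FY) stack_mulmx stackD.
by [].
Qed.

(** The flag is merely a family of subspaces. In the frame [FYn], however, the coordinates of [V]
    are smooth and supported in weights less than [i], and so are their derivatives; differentiating
    the frame vectors costs one step of the flag. *)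
Lemma nab_flag i p (V : R -> 'M[R]_(p, n)) t : (i <= m)%N -> smx O V ->
  (forall s, O s -> (V s <= F i s)%MS) -> O t -> (nab V t <= F i.+1 t)%MS.
Proof.
move=> im sV VF Ot.
pose C s := V s *m invmx (FYn s).
have sC : smx O C by apply: (@smxM _ _ oO) => //; apply: (@smx_inv _ _ oO) => [s|]; [exact: FYn_unit|exact: smx_FYn].
have CE s : O s -> C s = C s *m lowdiag i by move=> Os; exact: (flag_coord Os im (VF s Os)).
have VE : {in O, V =1 (fun s => C s *m FYn s)}.
  by move=> s /set_mem Os; rewrite /C mulmxKV// FYn_unit.
have -> : nab V t = nab (fun s => C s *m FYn s) t.
  by rewrite /nab (eq_on_dmx oO VE Ot) -VE ?inE.
rewrite nabM//; last exact: smx_FYn.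
have dCE : dmx C t = dmx C t *m lowdiag i.
  rewrite {1}(@eq_on_dmx _ _ oO _ _ C (fun s => C s *m lowdiag i) t)//; last first.
    by move=> s /set_mem /CE.
  rewrite (dmxM sC (smx_cst _ _) Ot) dmx_cst mulmx0 addr0.
  by [].
apply: addmx_sub.
  rewrite dCE -mulmxA; apply: (submx_trans (submxMl _ _)).
  by apply: submx_trans (lowdiag_FYn_sub i Ot) _; exact: flag_mono.
rewrite CE// -mulmxA; apply: (submx_trans (submxMl _ _)).
rewrite nab_FYn//; apply: lowdiag_stack_sub => j jm ji.
by apply: submx_trans (nab_FY_flag jm Ot) _; exact: flag_mono.
Qed.

(** The part of [D] orthogonal to [E i] is sent by L_T^i into F^i at all times. Differentiating this
    by [nab_flag] shows that L_T^(i+1) sends it into F^(i+1): the kernels increase with [i]. *)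
Lemma ker_step i t : (i < m)%N -> O t ->
  ((D t - D t *m (E i t)^T *m E i t) *m (D t)^T *m njet i.+1 t <= F i.+1 t)%MS.
Proof.
move=> im Ot.
pose C s := (D s - D s *m (E i s)^T *m E i s) *m (D s)^T.
have sC : smx O C.
  apply: (@smxM _ _ oO); last exact: smxT.
  apply: (@smxB _ _ oO) => //; apply: (@smxM _ _ oO); last exact: sE.
  by apply: (@smxM _ _ oO) => //; apply: smxT; exact: sE.
have CF s : O s -> (C s *m njet i s <= F i s)%MS.
  move=> Os; apply: E_perp => //.
    rewrite addmx_sub// eqmx_opp; apply: submx_trans (E_sub_D im Os); exact: submxMl.
  by rewrite mulmxBl -[_ *m E i s *m _]mulmxA EE// mulmx1 subrr.
have H := nab_flag (ltnW im) (smxM oO sC (smx_njet i)) CF Ot.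
rewrite -/(C t) -[C t *m _](addrK (dmx C t *m njet i t)).
rewrite [X in (X - _)%R]addrC -(nabM sC (smx_njet i) Ot) addmx_sub//.
rewrite eqmx_opp; apply: (submx_trans (submxMl _ _)); exact: njet_flag.
Qed.

(** The kernels increase by [ker_step], so their orthogonal complements decrease. *)
Lemma E_nested i t : (i.+1 < m)%N -> O t -> (E i.+1 t <= E i t)%MS.
Proof.
move=> im Ot; apply/row_subP => r.
have im' : (i < m)%N by apply: ltn_trans im.
have [vD vK] := (EK _ im Ot).1 (row_sub r (E i.+1 t)).
apply/(EK _ im' Ot); split=> // u uD uF; apply: vK => //.
have uE := E_ker im' Ot uD uF.
have -> : u *m (D t)^T *m njet i.+1 t =
    u *m (D t)^T *m ((D t - D t *m (E i t)^T *m E i t) *m (D t)^T *m njet i.+1 t).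
  rewrite !mulmxA mulmxBr !mulmxA D_proj// uE mul0mx subr0.
  by [].
by apply: (submx_trans (submxMl _ _)); exact: ker_step.
Qed.

Lemma E_nest i j t : (i <= j)%N -> (j < m)%N -> O t -> (E j t <= E i t)%MS.
Proof.
elim: j => [|j IH]; first by rewrite leqn0 => /eqP ->.
rewrite leq_eqVlt => /predU1P[->//|]; rewrite ltnS => ij jm Ot.
apply: submx_trans (E_nested jm Ot) (IH ij _ Ot).
exact: ltn_trans jm.
Qed.

(** Modulo F^(j+1) the derivative of the coefficients drops out, and of [E j] only the projection
    onto [E j.+1] counts, the rest being in the kernel of L_T^(j+1). The matrix of this projection
    consists of scalar products of two quotient frames, as in [egram]. *)
Lemma nab_FY_top j t : (j.+1 < m)%N -> O t ->
  (nab (FY j) t - E j t *m (E j.+1 t)^T *m FY j.+1 t <= F j.+1 t)%MS.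
Proof.
move=> jm Ot; have jm' : (j < m)%N by apply: ltn_trans jm.
rewrite nab_FY// -addrA; apply: addmx_sub.
  by apply: (submx_trans (submxMl _ _)); exact: njet_flag.
rewrite /FY !mulmxA -!mulmxBl.
apply: E_perp => //.
  apply: addmx_sub; first exact: E_sub_D.
  by rewrite eqmx_opp; apply: submx_trans (E_sub_D jm Ot); exact: submxMl.
by rewrite mulmxBl -[_ *m E j.+1 t *m _]mulmxA EE// mulmx1 subrr.
Qed.

(** Block Gram-Schmidt: the orthogonal projector onto F^i, rational in the frame and hence smooth in
    [t]. *)
Fixpoint orthq i t : 'M[R]_n :=
  if i is j.+1 then
    let L := FY j t *m (1%:M - orthq j t) in
    orthq j t + L^T *m invmx (L *m L^T) *m L
  else 0.

Definition FYperp i t := FY i t *m (1%:M - orthq i t).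

(** With the shift of indices, the matrix of M_(i+1); see [Mmx_gram]. *)
Definition FYgram i t := FYperp i t *m (FYperp i t)^T.

Lemma FYgram_unit_aux i t : (i < m)%N -> O t -> (orthq i t :=: F i t)%MS ->
  FYgram i t \in unitmx.
Proof.
move=> im Ot QF; apply: gram_unit => c; rewrite /FYperp mulmxA mulmxBr mulmx1.
move=> /eqP; rewrite subr_eq0 => /eqP H; apply: (FY_indep im Ot).
by rewrite H -QF submxMl.
Qed.

(** Each step adds the projector onto the row space of [FYperp i], which is orthogonal to F^i and
    has independent rows by [FY_indep]. *)
Lemma orthqP i t : (i <= m)%N -> O t ->
  [/\ (orthq i t)^T = orthq i t, orthq i t *m orthq i t = orthq i t &
      (orthq i t :=: F i t)%MS].
Proof.
elim: i => [|i IH] im Ot; first by rewrite F0// trmx0 mulmx0; split.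
have [QT QQ QF] := IH (ltnW im) Ot.
have U := FYgram_unit_aux im Ot QF.
rewrite /= -/(FYperp i t) -/(FYgram i t).
set L := FYperp i t; set Q := orthq i t in QT QQ QF *; set W := invmx _.
have LQ : L *m Q = 0 by rewrite /L /FYperp -mulmxA mulmxBl mul1mx QQ subrr mulmx0.
have QL : Q *m L^T = 0 by rewrite -[LHS]trmxK trmx_mul trmxK QT LQ trmx0.
have WT : W^T = W by rewrite /W trmx_inv /FYgram trmx_mul trmxK.
have LW : L *m L^T *m W = 1%:M by rewrite mulmxV.
have LQn : L *m (Q + L^T *m W *m L) = L by rewrite mulmxDr LQ add0r !mulmxA LW mul1mx.
have QQn : Q *m (Q + L^T *m W *m L) = Q by rewrite mulmxDr QQ !mulmxA QL !mul0mx addr0.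
split.
- by rewrite linearD/= QT (trmx_mul (L^T *m W) L) (trmx_mul L^T W) trmxK WT mulmxA.
- by rewrite mulmxDl QQn -[_ *m L *m _]mulmxA LQn.
apply/eqmxP/andP; split.
  rewrite flag_FY//; apply: addmx_sub; first by rewrite QF addsmxSl.
  apply: submx_trans (submxMl _ _) _.
  rewrite /L /FYperp mulmxBr mulmx1 addmx_sub// ?addsmxSr// eqmx_opp.
  by apply: submx_trans (addsmxSl _ _); rewrite -QF submxMl.
rewrite flag_FY// addsmx_sub -QF; apply/andP; split.
  by rewrite -{1}QQn submxMl.
have -> : FY i t = L + FY i t *m Q by rewrite /L /FYperp mulmxBr mulmx1 subrK.
by apply: addmx_sub; [rewrite -{1}LQn submxMl|rewrite -{1}QQn mulmxA submxMl].
Qed.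

Lemma FYgram_unit i t : (i < m)%N -> O t -> FYgram i t \in unitmx.
Proof.
by move=> im Ot; have [_ _] := orthqP (ltnW im) Ot; exact: FYgram_unit_aux.
Qed.

Lemma smx_orthq i : (i <= m)%N -> smx O (orthq i).
Proof.
elim: i => [|i IH] im; first exact: smx_cst.
have sQ := IH (ltnW im).
have sL : smx O (FYperp i).
  apply: (@smxM _ _ oO); first exact: smx_FY.
  by apply: (@smxB _ _ oO) => //; exact: smx_cst.
apply: (@smxD _ _ oO) => //; apply: (@smxM _ _ oO) => //.
apply: (@smxM _ _ oO); first exact: smxT.
apply: (@smx_inv _ _ oO) => [t Ot|]; first exact: FYgram_unit.
by apply: (@smxM _ _ oO) => //; exact: smxT.
Qed.

Lemma smx_FYperp i : (i < m)%N -> smx O (FYperp i).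
Proof.
move=> im; apply: (@smxM _ _ oO); first exact: smx_FY.
by apply: (@smxB _ _ oO); [exact: smx_cst|exact/smx_orthq/ltnW].
Qed.

Lemma smx_FYgram i : (i < m)%N -> smx O (FYgram i).
Proof.
by move=> im; apply: (@smxM _ _ oO); [exact: smx_FYperp|apply: smxT; exact: smx_FYperp].
Qed.

Lemma FYperp_ortho i j t : (i < m)%N -> (j < m)%N -> O t -> i != j ->
  FYperp i t *m (FYperp j t)^T = 0.
Proof.
move=> + + Ot; wlog ij : i j / (i < j)%N => [H|] im jm.
  rewrite neq_ltn => /orP[ij|ji]; first by apply: H => //; rewrite ltn_eqF.
  by rewrite -[LHS]trmxK trmx_mul trmxK H ?trmx0// ltn_eqF.
move=> _; have [QT QQ QF] := orthqP (ltnW jm) Ot.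
have [_ _ QFi] := orthqP (ltnW im) Ot.
have : (FYperp i t <= orthq j t)%MS.
  rewrite QF /FYperp mulmxBr mulmx1 addmx_sub//.
    by apply: submx_trans (FY_flag i Ot) _; exact: flag_mono.
  rewrite eqmx_opp; apply: (submx_trans (submxMl _ _)); rewrite QFi.
  by apply: flag_mono => //; exact: ltnW.
move=> /submxP[u ->]; rewrite /FYperp trmx_mul linearB/= trmx1 QT.
by rewrite !mulmxA -[u *m _ *m _]mulmxA mulmxBr mulmx1 QQ subrr mulmx0 mul0mx.
Qed.

Lemma stack_entry p (V : forall i, 'M[R]_(d i, p)) a b i : w a = i ->
  stack V a b = ((Sel i)^T *m V i) a b.
Proof.
move=> wa; have im : (i < m)%N by rewrite -wa (sel_lt HS).
rewrite -(sel_stack V im) mulmxA (sel_diag HS im) mul_diag_mx !mxE wa eqxx mul1r.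
by [].
Qed.

Lemma mulmx_col0 p q (B : 'M[R]_(p, q)) r (C : 'M[R]_(q, r)) a b :
  (forall x, C x b = 0) -> (B *m C) a b = 0.
Proof. by move=> C0; rewrite mxE big1// => x _; rewrite C0 mulr0. Qed.

(** Each frame vector is modified by vectors of strictly lower weight only, a unitriangular change
    of frame. *)
Lemma det_stack_perp t : O t -> \det (stack (FYperp^~ t)) = \det (FYn t).
Proof.
move=> Ot; pose W := stack (FYperp^~ t) *m invmx (FYn t).
have -> : stack (FYperp^~ t) = W *m FYn t by rewrite /W mulmxKV// FYn_unit.
have WE : W = 1%:M - stack (fun i => FY i t *m orthq i t *m invmx (FYn t)).
  rewrite /W -(stack_mulmx (fun i => FY i t *m orthq i t)) -{1}(mulmxV (FYn_unit Ot)).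
  rewrite -mulmxBl; congr (_ *m _).
  rewrite [X in _ = X - _]/FYn /stack -sumrB; apply: eq_bigr => i _.
  by rewrite /FYperp -[RHS]mulmxBr [FY i t *m (_ - _)]mulmxBr mulmx1.
have WE0 a b : (w a <= w b)%N -> W a b = (a == b)%:R.
  move=> wab; rewrite WE !mxE (stack_entry _ _ (erefl (w a))).
  rewrite mulmx_col0 ?subr0// => x.
  have wm := ltnW (sel_lt HS a); have [_ _ QF] := orthqP wm Ot.
  by apply: (flag_coord0 (i := w a)) => //; rewrite -QF submxMl.
rewrite det_mulmx (det_weight_trig (w := w)) => [|a b ab /WE0 ->]; last first.
  by rewrite (negPf ab).
by rewrite big1 ?mul1r// => a _; rewrite WE0// eqxx.
Qed.

Definition blockdiag (B : forall i, 'M[R]_(d i)) : 'M[R]_n :=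
  \sum_(i < m) (Sel i)^T *m B i *m Sel i.

Lemma blockdiag_mul (B C : forall i, 'M[R]_(d i)) :
  blockdiag B *m blockdiag C = blockdiag (fun i => B i *m C i).
Proof.
rewrite /blockdiag mulmx_suml; apply: eq_bigr => i _.
rewrite mulmx_sumr (bigD1 i)//= big1 ?addr0 => [|j ji].
  by rewrite !mulmxA -[_ *m Sel i *m _]mulmxA (selK HS)// mulmx1.
rewrite !mulmxA -[_ *m Sel i *m _]mulmxA sel_ortho//.
  by rewrite mulmx0 !mul0mx.
by rewrite eq_sym.
Qed.

Lemma mxtrace_blockdiag (B : forall i, 'M[R]_(d i)) :
  \tr (blockdiag B) = \sum_(i < m) \tr (B i).
Proof.
rewrite /blockdiag raddf_sum; apply: eq_bigr => i _ /=.
by rewrite mxtrace_mulC mulmxA (selK HS)// mul1mx.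
Qed.

Lemma stack_perp_gram t : O t ->
  stack (FYperp^~ t) *m (stack (FYperp^~ t))^T = blockdiag (FYgram^~ t).
Proof.
move=> Ot; rewrite {1}/stack mulmx_suml; apply: eq_bigr => i _.
have trE j : ((Sel j)^T *m FYperp j t)^T = (FYperp j t)^T *m Sel j.
  by rewrite trmx_mul trmxK.
rewrite /stack raddf_sum mulmx_sumr (bigD1 i)//= trE big1 ?addr0 => [|j ji].
  by rewrite !mulmxA.
rewrite trE mulmxA -(mulmxA (Sel i)^T) FYperp_ortho//.
  by rewrite mulmx0 mul0mx.
by rewrite eq_sym.
Qed.

(** After Gram-Schmidt the square of the determinant of [FYn] is that of a block diagonal matrix
    with blocks [FYgram i]; Jacobi's formula is applied to both. *)
Lemma trace_FYgram t : O t ->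
  (\sum_(i < m) \tr (invmx (FYgram i t) *m dmx (FYgram i) t)) * \det (FYn t) =
  2 * (fun s => \det (FYn s))^`()%classic t.
Proof.
move=> Ot; pose G s := blockdiag (FYgram^~ s).
have GE s : O s -> \det (G s) = \det (FYn s) * \det (FYn s).
  by move=> Os; rewrite /G -stack_perp_gram// det_mulmx det_tr det_stack_perp.
have dG a b : isd (fun s => G s a b) t (blockdiag (fun i => dmx (FYgram i) t) a b).
  rewrite (_ : (fun _ => _) = fun s => \sum_(i < m) ((Sel i)^T *m FYgram i s *m Sel i) a b).
    rewrite /blockdiag summxE; apply: isd_sum => i _.
    have -> : (Sel i)^T *m dmx (FYgram i) t *m Sel i =
       (0 *m FYgram i t + (Sel i)^T *m dmx (FYgram i) t) *m Sel i
       + ((Sel i)^T *m FYgram i t) *m 0 by rewrite mul0mx mulmx0 addr0 add0r.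
    apply: isd_mulmx => x y; last by rewrite [X in isd _ _ X]mxE; exact: isd_cst.
    apply: isd_mulmx => x' y'; last exact: (smx_isd (smx_FYgram _) Ot).
    by rewrite [X in isd _ _ X]mxE; exact: isd_cst.
  by apply/funext => s; rewrite /G /blockdiag summxE.
have H1 := isd_det dG.
have sdet := smooth1_det oO smx_FYn.
have ddet : isd (fun s => \det (FYn s)) t ((fun s => \det (FYn s))^`()%classic t).
  by split=> //; exact: derivable_smooth1 sdet Ot.
have Z : {in O, (fun s => \det (FYn s) * \det (FYn s)) =1 (fun s => \det (G s))}.
  by move=> s /set_mem Os; rewrite GE.
have := isd_unique (eq_on_isd oO Z Ot (isdM ddet ddet)) H1.
have uF := FYn_unit Ot; have dF0 : \det (FYn t) != 0 by rewrite -unitfE -unitmxE.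
have GV : G t *m blockdiag (fun i => invmx (FYgram i t)) = 1%:M.
  rewrite /G blockdiag_mul -sel_total; apply: eq_bigr => i _.
  by rewrite mulmxV ?FYgram_unit// mulmx1.
have [uG VG] := mulmx1_unit GV.
have adjG : \adj (G t) = \det (G t) *: blockdiag (fun i => invmx (FYgram i t)).
  have <- : invmx (G t) = blockdiag (fun i => invmx (FYgram i t)).
    by rewrite -[LHS]mulmx1 -GV mulKmx.
  by rewrite /invmx uG scalerA divff ?scale1r// -unitfE -unitmxE.
rewrite adjG -scalemxAr linearZ/= blockdiag_mul mxtrace_blockdiag GE//.
under eq_bigr do rewrite mxtrace_mulC.
set T := \sum_(i < m) _; set th := \det _; set dth := derive1 _ _ => H.
apply: (mulfI dF0); rewrite -/th; transitivity (th * th * T); first by ring.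
by rewrite -[LHS]H; ring.
Qed.

Definition egram t := stack (E^~ t) *m (stack (E^~ t))^T.

Lemma egramE t i j a b : w a = i -> w b = j ->
  egram t a b = ((Sel i)^T *m (E i t *m (E j t)^T) *m Sel j) a b.
Proof.
move=> wa wb; rewrite /egram stack_mulmx (stack_entry _ _ wa) mulmxA.
have trE p q r (X : 'M[R]_(p, q)) (Y : 'M[R]_(r, q)) x y :
    (X *m Y^T) x y = (Y *m X^T) y x.
  by rewrite -[Y *m _]trmxK trmx_mul trmxK !mxE.
by rewrite trE stack_mulmx (stack_entry _ _ wb) mulmxA trE trmx_mul trmxK !mulmxA.
Qed.

Lemma egram_ortho t a b : O t -> w a = w b -> egram t a b = (a == b)%:R.
Proof.
move=> Ot wab; rewrite (egramE t (erefl (w a)) (esym wab)) EE ?(sel_lt HS)//.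
by rewrite mulmx1 (sel_diag HS) ?(sel_lt HS)// !mxE eqxx.
Qed.

Lemma egram_sym t a b : egram t a b = egram t b a.
Proof.
have gT : (egram t)^T = egram t by rewrite /egram trmx_mul trmxK.
by rewrite -{1}gT mxE.
Qed.

(** For [p <= w a] the vector of index [a] lies in the span of [E p] by [E_nest], so the projection
    onto this span fixes it. *)
Lemma egram_nest t p a b : O t -> (p <= w a)%N ->
  \sum_(c | w c == p) egram t a c * egram t c b = egram t a b.
Proof.
move=> Ot pa; have wm := sel_lt HS a; have pm := leq_ltn_trans pa wm.
have -> : \sum_(c | w c == p) egram t a c * egram t c b =
    (egram t *m ((Sel p)^T *m Sel p) *m egram t) a b.
  rewrite (sel_diag HS pm) mxE big_mkcond; apply: eq_bigr => c _.
  rewrite mul_mx_diag [X in _ = X * _]mxE [X in _ = _ * X * _]mxE.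
  by case: eqP => _; rewrite ?mulr1 ?mulr0 ?mul0r.
rewrite /egram !mulmxA -[_ *m Sel p *m stack _]mulmxA (sel_stack (E^~ t) pm).
have -> : stack (E^~ t) *m (stack (E^~ t))^T *m (Sel p)^T = stack (E^~ t) *m (E p t)^T.
  by rewrite -mulmxA -trmx_mul (sel_stack (E^~ t) pm).
rewrite !stack_mulmx !(stack_entry _ _ (erefl (w a))) E_proj//.
exact: E_nest.
Qed.

(** Both sides are the orthogonal projector onto the distribution: since F^0 = 0, [E 0] is an
    orthonormal basis of it, and it is the block of weight 0 of [FYn]. *)
Lemma DTD t : O t -> (D t)^T *m D t = (FYn t)^T *m lowdiag 1 *m FYn t.
Proof.
move=> Ot; have [m0|m0] := posnP m.
  apply/matrixP => i; exfalso.
  by have := sel_lt HS i; rewrite m0.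
have E0 : FY 0 t = E 0 t by rewrite /FY /= D_proj//; exact: E_sub_D.
have -> : lowdiag 1 = (Sel 0)^T *m Sel 0.
  rewrite (sel_diag HS m0); congr diag_mx; apply/rowP => a; rewrite !mxE.
  by rewrite ltnS leqn0.
rewrite -!mulmxA (sel_stack (FY^~ t) m0) mulmxA -trmx_mul (sel_stack (FY^~ t) m0) E0.
have DE : (D t <= E 0 t)%MS.
  apply/row_subP => r; apply/(EK _ m0 Ot); split; first exact: row_sub.
  move=> u uD; rewrite /= D_proj// F0// submx0 => /eqP ->.
  by rewrite trmx0 mulmx0.
have H1 := E_proj m0 Ot DE.
have H2 := D_proj Ot (E_sub_D m0 Ot).
have : (E 0 t)^T = (D t)^T *m D t *m (E 0 t)^T.
  by rewrite -{1}H2 trmx_mul trmx_mul trmxK mulmxA.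
by move=> ->; rewrite -!mulmxA; congr (_ *m _); rewrite mulmxA H1.
Qed.

Variables (a c : R -> 'M[R]_n).
Hypotheses (sa : smx O a) (sc : smx O c).
Hypothesis c_sym : forall t, O t -> (c t)^T = c t.
Hypothesis aD : forall t, O t -> ((a t + Lam t)%R <= D t)%MS.

(** The coefficient that replaces [a] in the equation for [A t *m invmx (FYn t)]: a gauge
    transformation. *)
Definition fsys t := (FYn t *m a t - dmx FYn t) *m invmx (FYn t).

Lemma smx_invFYn : smx O (fun t => invmx (FYn t)).
Proof. by apply: (@smx_inv _ _ oO) => [t|]; [exact: FYn_unit|exact: smx_FYn]. Qed.

Lemma smx_fsys : smx O fsys.
Proof.
apply: (@smxM _ _ oO); last exact: smx_invFYn.
apply: (@smxB _ _ oO); last by apply: smx_dmx; exact: smx_FYn.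
by apply: (@smxM _ _ oO) => //; exact: smx_FYn.
Qed.

(** Inserting [Lam] separates a term with values in D, which has coordinates of weight 0 only, from
    the covariant derivative of the frame. *)
Lemma fsysE t : fsys t = FYn t *m (a t + Lam t) *m invmx (FYn t) - nab FYn t *m invmx (FYn t).
Proof.
rewrite /fsys /nab -mulmxBl; congr (_ *m _).
by rewrite mulmxDr opprD addrACA subrr addr0.
Qed.

Lemma fsys_D t x y : O t -> (0 < w y)%N ->
  (FYn t *m (a t + Lam t) *m invmx (FYn t)) x y = 0.
Proof.
move=> Ot wy; apply: (flag_coord0 (i := 1)) => //.
  exact: leq_ltn_trans (sel_lt HS x).
apply: (submx_trans (submxMl (FYn t) (a t + Lam t))).
by apply: (submx_trans (aD Ot)); exact: (njet_flag 0%N Ot).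
Qed.

Lemma fsys0 t x y : O t -> (w x + 1 < w y)%N -> fsys t x y = 0.
Proof.
move=> Ot wxy; rewrite fsysE mxE fsys_D ?add0r//; last by apply: leq_ltn_trans wxy.
rewrite nab_FYn// stack_mulmx mxE (stack_entry _ _ (erefl (w x))) mulmx_col0 ?oppr0// => r.
apply: (flag_coord0 (i := (w x).+2)) => //.
- by apply: leq_trans (ltnW (sel_lt HS y)); rewrite -addn1.
- by apply: nab_FY_flag => //; exact: (sel_lt HS).
- by rewrite -addn1.
Qed.

(** From [nab_FY_top]: the remainder lies in F^(w x + 1) and has no coordinate of weight w x + 1. *)
Lemma fsys1 t x y : O t -> w y = (w x + 1)%N -> fsys t x y = - egram t x y.
Proof.
move=> Ot wxy; rewrite fsysE mxE fsys_D ?add0r//; last by rewrite wxy addn1.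
rewrite addn1 in wxy.
have ym : ((w x).+1 < m)%N by rewrite -wxy (sel_lt HS).
rewrite nab_FYn// stack_mulmx mxE (stack_entry _ _ (erefl (w x))); congr (- _).
rewrite (egramE t (erefl (w x)) wxy).
set X := nab _ t; set Y := E _ t *m _.
rewrite -[X](subrK (Y *m FY (w x).+1 t)) mulmxDl mulmxDr mxE.
rewrite [Z in Z + _]mulmx_col0 ?add0r => [|r]; last first.
  apply: (flag_coord0 (i := (w x).+1)) => //; first exact: ltnW.
    exact: nab_FY_top.
  by rewrite wxy.
rewrite -(sel_stack (FY^~ t) ym) -/(FYn t) !mulmxA mulmxK ?FYn_unit//.
Qed.

Variables (A B : R -> 'M[R]_n).
Hypothesis O0 : O 0.
Hypothesis dA : forall t i j, O t ->
  isd (fun s => A s i j) t ((A t *m a t + B t *m ((D t)^T *m D t)) i j).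
Hypothesis dB : forall t i j, O t ->
  isd (fun s => B s i j) t ((- (A t *m c t) - B t *m (a t)^T) i j).
Hypothesis A_init : A 0 = 0.
Hypothesis B_init : B 0 \in unitmx.

Lemma flow_det_expansion : exists K : R -> 'M[R]_n,
  [/\ forall t, O t -> \det (A t) / \det (B 0) =
        t ^+ (\sum_(i < m) i.*2.+1 * d i) * (\det (FYn 0) * \det (FYn t) * \det (K t)),
      isd (fun t => \det (K t)) 0 0 & 0 < \det (K 0)].
Proof.
(* A constant factor on the left, compatible with the system acting from the right; it normalizes
   the initial value of [Bh] to the identity. *)
pose N := invmx (B 0 *m (FYn 0)^T).
have uN : B 0 *m (FYn 0)^T \in unitmx.
  by rewrite unitmx_mul B_init unitmx_tr FYn_unit.
have isdFY t i j : O t -> isd (fun s => (FYn s)^T i j) t ((dmx FYn t)^T i j).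
  move=> Ot; have := smx_isd smx_FYn Ot j i; rewrite [X in _ -> isd _ _ X]mxE.
  by rewrite (_ : (fun s => (FYn s)^T i j) = fun s => FYn s j i)//; apply/funext => s; rewrite mxE.
(* The linear symplectic change of coordinates: the inverse of [FYn] on positions, its transpose on
   momenta. *)
pose Ah t := N *m (A t *m invmx (FYn t)).
pose Bh t := N *m (B t *m (FYn t)^T).
pose ch t := FYn t *m c t *m (FYn t)^T.
have isdN (V dV : R -> 'M[R]_n) t i j : (forall x y, isd (fun s => V s x y) t (dV t x y)) ->
    isd (fun s => (N *m V s) i j) t ((N *m dV t) i j).
  move=> HV; have -> : N *m dV t = 0 *m V t + N *m dV t by rewrite mul0mx add0r.
  by apply: isd_mulmx => // x y; rewrite [X in isd _ _ X]mxE; exact: isd_cst.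
have VF t : O t -> invmx (FYn t) *m FYn t = 1%:M by move=> Ot; rewrite mulVmx ?FYn_unit.
have VFT t : O t -> (FYn t)^T *m (invmx (FYn t))^T = 1%:M.
  by move=> Ot; rewrite -trmx_mul VF ?trmx1.
have [|||||||||||||K [KE dK K0]] := @weighted_flow_expansion R n O fsys ch (lowdiag 1) oO
   smx_fsys _ _ _ w egram _ _ _ _ _ _ Ah Bh O0 _ _ _ _.
- apply: (@smxM _ _ oO); last by apply: smxT; exact: smx_FYn.
  by apply: (@smxM _ _ oO) => //; exact: smx_FYn.
- by move=> t Ot; rewrite /ch !trmx_mul trmxK c_sym// mulmxA.
- exact: tr_diag_mx.
- by move=> t x y Ot; exact: egram_ortho.
- by move=> t x y _; exact: egram_sym.
- by move=> t p x y Ot; exact: egram_nest.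
- by move=> i j; rewrite !mxE ltnS leqn0; case: (i == j); rewrite ?andbF ?mulr0n ?mulr1n.
- by move=> t i j Ot; exact: fsys0.
- by move=> t i j Ot; exact: fsys1.
- move=> t i j Ot.
  have -> : Ah t *m fsys t + Bh t *m lowdiag 1 =
      N *m ((A t *m a t + B t *m ((D t)^T *m D t)) *m invmx (FYn t)
        + A t *m - (invmx (FYn t) *m dmx FYn t *m invmx (FYn t))).
    rewrite DTD// /Ah /Bh /fsys -!mulmxA -mulmxDr; congr (_ *m _).
    rewrite [in RHS]mulmxDl mulmxN !mulmxA [in RHS]mulmxK ?FYn_unit//.
    by rewrite mulmxBr !mulmxA mulmxKV ?FYn_unit// mulmxBl addrAC.
  apply: (isdN (fun s => A s *m invmx (FYn s)) (fun t => (A t *m a t + B t *m ((D t)^T *m D t)) *m invmx (FYn t)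
        + A t *m - (invmx (FYn t) *m dmx FYn t *m invmx (FYn t)))) => x y.
  apply: isd_mulmx => x' y'; first exact: dA.
  rewrite -(dmx_inv oO FYn_unit smx_FYn Ot); exact: (smx_isd smx_invFYn Ot).
- move=> t i j Ot.
  have -> : - (Ah t *m ch t) - Bh t *m (fsys t)^T =
      N *m ((- (A t *m c t) - B t *m (a t)^T) *m (FYn t)^T + B t *m (dmx FYn t)^T).
    rewrite /Ah /Bh /ch /fsys -!mulmxA -[X in X - _ = _]mulmxN -mulmxBr; congr (_ *m _).
    rewrite !mulmxA -[A t *m invmx (FYn t) *m FYn t]mulmxA VF// mulmx1.
    rewrite trmx_mul !mulmxA -[B t *m _ *m _]mulmxA VFT// mulmx1.
    rewrite linearB/= trmx_mul mulmxBr mulmxBl mulNmx !mulmxA.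
    by rewrite opprB addrA [RHS]addrAC.
  apply: (isdN (fun s => B s *m (FYn s)^T) (fun t => (- (A t *m c t) - B t *m (a t)^T) *m (FYn t)^T + B t *m (dmx FYn t)^T)) => x y.
  apply: isd_mulmx => x' y'; [exact: dB|exact: isdFY].
- by rewrite /Ah A_init mul0mx mulmx0.
- by rewrite /Bh mulVmx.
exists K; split=> // t Ot.
have detAh : \det (Ah t) = t ^+ (\sum_(i < m) i.*2.+1 * d i) * \det (K t).
  rewrite -(sel_sum HS (fun i => i.*2.+1)).
  (* Row [x] contributes the exponent w x + 1 and column [x] the exponent w x, in all 2 (w x) +
     1. *)
  have -> : Ah t = diag_mx (\row_x t ^+ (w x).+1) *m K t *m diag_mx (\row_x t ^+ w x).
    apply/matrixP => x y; rewrite KE// mul_mx_diag mxE mul_diag_mx !mxE mulrAC.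
    by rewrite -exprD addSn.
  rewrite !det_mulmx !det_diag mulrAC; congr (_ * _).
  rewrite -big_split/= -prodrXr; apply: eq_bigr => x _; rewrite !mxE -exprD.
  by rewrite -addnn addSn.
have dB0 : \det (B 0) != 0 by rewrite -unitfE -unitmxE.
have dF0 : \det (FYn 0) != 0 by rewrite -unitfE -unitmxE FYn_unit.
have -> : A t = B 0 *m (FYn 0)^T *m Ah t *m FYn t.
  by rewrite /Ah !mulmxA mulmxV// mul1mx mulmxKV// FYn_unit.
rewrite det_mulmx (det_mulmx _ (Ah t)) detAh det_mulmx det_tr; field.
by [].
Qed.

Theorem flow_log_derivative : exists2 r : R, 0 < r &
  isd (fun t => ln (if t == 0 then r
     else t ^- (\sum_(i < m) i.*2.+1 * d i) * (\det (A t) / \det (B 0)))) 0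
   (2^-1 * \sum_(i < m) \tr (invmx (FYgram i 0) *m dmx (FYgram i) 0)).
Proof.
have [K [KE dK K0]] := flow_det_expansion.
have dF0 : \det (FYn 0) != 0 by rewrite -unitfE -unitmxE FYn_unit.
pose u t := \det (FYn 0) * \det (FYn t) * \det (K t).
(* At 0 the determinant of [FYn] occurs squared, so its sign does not matter. *)
have u0 : 0 < u 0 by rewrite mulr_gt0// -expr2 exprn_even_gt0.
exists (u 0) => //.
have Z : {in O, (fun t => ln (u t)) =1 (fun t => ln (if t == 0 then u 0
     else t ^- (\sum_(i < m) i.*2.+1 * d i) * (\det (A t) / \det (B 0))))}.
  move=> t /set_mem Ot /=; case: eqP => [->//|/eqP t0].
  by rewrite KE// mulKf// expf_neq0.
apply: (eq_on_isd oO Z O0).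
have sdet := smooth1_det oO smx_FYn.
have ddet : isd (fun s => \det (FYn s)) 0 ((fun s => \det (FYn s))^`()%classic 0).
  by split=> //; exact: derivable_smooth1 sdet O0.
have du := isdM (isdM (isd_cst (\det (FYn 0)) 0) ddet) dK.
have dln : is_derive (u 0) 1 (@ln R) (u 0)^-1 by exact: is_derive1_ln.
have [du1 du2] := du.
have du3 : is_derive (0 : R) 1 u (u^`()%classic 0).
  by apply: DeriveDef; [rewrite -dableE|rewrite derive1E].
have [e1 e2] := @is_derive1_comp R (@ln R) u 0 _ _ dln du3.
split; first by rewrite dableE.
rewrite derive1E e2 du2.
(* As the derivative of det K vanishes, only det [FYn] contributes to the logarithmic derivative. *)
have := trace_FYgram O0; set T := \sum_(i < m) _; set th := derive1 _ _ => H.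
rewrite /u mul0r add0r mulr0 addr0.
have k0 : \det (K 0) != 0 by rewrite gt_eqF.
have -> : th = 2^-1 * (T * \det (FYn 0)) by rewrite H mulrA mulVf ?mul1r// pnatr_eq0.
by field; rewrite dF0 k0.
Qed.

End FlagFrames.

(** * Smooth functions of several variables *)

Section CkGeneral.
Context {R : realType} {V W : normedModType R}.
Implicit Types (A : set V) (f g : V -> W).

(** What makes differentiability a local property: [near_eq_differentiable] applies it to a
    difference. *)
Lemma near0_differentiable f x : (\near x, f x = 0) -> differentiable f x.
Proof.
move=> f0.
have fx : f x = 0 := nbhs_singleton f0.
have f0' : \forall h \near (0 : V), f (h + x) = 0.
  by move: f0; rewrite (near_shift 0 x) subr0.
have H : f \o shift x = cst (f x) + (\0 : V -> W) +o_ 0 id.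
  apply/eqaddoP => e e0; near=> h.
  have -> : (f \o shift x - (cst (f x) + (\0 : V -> W))) h = 0.
    rewrite !fctE /= fx addr0 subr0.
    by near: h.
  by rewrite normr0 mulr_ge0// ltW.
apply/diff_locallyP.
have E : 'd f x = (\0 : V -> W) :> (V -> W).
  by apply: diff_unique H => y; exact: cst_continuous.
split; first by rewrite E => y; exact: cst_continuous.
by rewrite E.
Unshelve. all: by end_near. Qed.

Lemma near_eq_differentiable f g x : (\near x, f x = g x) ->
  differentiable f x -> differentiable g x.
Proof.
move=> fg df.
have -> : g = f + (g - f) by apply/funext => y; rewrite !fctE /= addrC subrK.
apply: differentiableD => //; apply: near0_differentiable.
near=> y; rewrite -[(g - f) y]/(g y - f y).
by apply/eqP; rewrite subr_eq0 eq_sym; apply/eqP; near: y.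
Unshelve. all: by end_near. Qed.

Lemma eq_on_near A f g x : open A -> {in A, f =1 g} -> A x -> \near x, f x = g x.
Proof.
move=> oA fg Ax; near=> y; apply: fg; rewrite inE; near: y; exact: open_nbhs_nbhs.
Unshelve. all: by end_near. Qed.

End CkGeneral.

Lemma isdN {R : realType} (f : R -> R) x a : isd f x a -> isd (fun t => - f t) x (- a).
Proof.
have -> : (fun t => - f t) = (fun t => (fun=> -1) t * f t).
  by apply/funext => t; rewrite mulN1r.
have -> : - a = 0 * f x + (-1) * a by rewrite mul0r add0r mulN1r.
by apply: isdM; exact: isd_cst.
Qed.

Section SmoothScalar.
Context {R : realType} {V : normedModType R}.
Implicit Types (A : set V) (f g : V -> R).

Definition smf A f := smooth_on A (f : V -> R^o).

(* The clause on continuity is redundant from order 1 on. *)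
Fixpoint smk (k : nat) A f : Prop :=
  if k is k'.+1 then
    (forall x, A x -> differentiable (f : V -> R^o) x) /\
    (forall v : V, smk k' A (fun x => 'D_v (f : V -> R^o) x))
  else True.

Lemma smfP A f : smf A f <-> forall k, smk k A f.
Proof.
split=> [sf k|sf k].
  move: (sf k); elim: k f {sf} => // k IH f [df sf]; split => // v; exact: (IH _ (sf v)).
have {sf} : smk k.+1 A f by exact: sf.
elim: k f => [|k IH] f [df sf]; first by move=> x /df dfx; exact: (differentiable_continuous dfx).
by split => // v; exact: (IH _ (sf v)).
Qed.

Lemma smkW k A f : smk k.+1 A f -> smk k A f.
Proof. by elim: k f => // k IH f [df sf]; split => // v; exact: IH. Qed.

Lemma smf_diff A f x : smf A f -> A x -> differentiable (f : V -> R^o) x.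
Proof. by move=> /(_ 1%N)[+ _]; apply. Qed.

Lemma smf_D A f v : smf A f -> smf A (fun x => 'D_v (f : V -> R^o) x).
Proof. by move=> sf k; have [_] := sf k.+1; apply. Qed.

Lemma eq_on_smk k A f g : open A -> {in A, f =1 g} -> smk k A f -> smk k A g.
Proof.
move=> oA; elim: k f g => // k IH f g fg [df sf]; split.
  by move=> x Ax; apply: (near_eq_differentiable (eq_on_near oA fg Ax)); exact: df.
move=> v; apply: (IH _ _ _ (sf v)) => x /set_mem Ax.
exact: near_eq_derive (eq_on_near oA fg Ax).
Qed.

Lemma eq_on_smf A f g : open A -> {in A, f =1 g} -> smf A f -> smf A g.
Proof. by move=> oA fg /smfP sf; apply/smfP => k; exact: eq_on_smk (sf k). Qed.

Lemma smfS A B f : B `<=` A -> smf A f -> smf B f.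
Proof.
move=> BA /smfP sf; apply/smfP => k; move: (sf k); elim: k f {sf} => // k IH f [df sf].
by split=> [x /BA/df//|v]; exact: (IH _ (sf v)).
Qed.

Lemma smk_cst k A (c : R) : smk k A (fun=> c).
Proof.
elim: k c => // k IH c; split=> [x _|v]; first exact: differentiable_cst.
have -> : (fun x => 'D_v ((fun=> c) : V -> R^o) x) = fun=> 0.
  by apply/funext => x; exact: derive_cst.
exact: IH.
Qed.

Lemma smf_cst A c : smf A (fun=> c).
Proof. by apply/smfP => k; exact: smk_cst. Qed.

Section Closure.
Variable A : set V.
Hypothesis oA : open A.

Lemma smkD k f g : smk k A f -> smk k A g -> smk k A (fun x => f x + g x).
Proof.
elim: k f g => // k IH f g [df sf] [dg sg]; split.
  by move=> x Ax; exact: (differentiableD (df x Ax) (dg x Ax)).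
move=> v; apply: (@eq_on_smk _ _
  (fun x => 'D_v (f : V -> R^o) x + 'D_v (g : V -> R^o) x)) => //; last exact: (IH _ _ (sf v) (sg v)).
move=> x /set_mem Ax; apply/esym.
by apply: (@deriveD R V R^o f g x v); apply: diff_derivable; [exact: df|exact: dg].
Qed.

Lemma smkM k f g : smk k A f -> smk k A g -> smk k A (fun x => f x * g x).
Proof.
elim: k f g => // k IH f g sf sg.
have [df sf'] := sf; have [dg sg'] := sg; split.
  by move=> x Ax; exact: (differentiableM (df x Ax) (dg x Ax)).
move=> v; apply: (@eq_on_smk _ _
  (fun x => f x * 'D_v (g : V -> R^o) x + g x * 'D_v (f : V -> R^o) x)) => //.
  move=> x /set_mem Ax; apply/esym.
  by apply: (@deriveM R V f g x v); apply: diff_derivable; [exact: df|exact: dg].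
by apply: smkD; [exact: (IH _ _ (smkW sf) (sg' v))|exact: (IH _ _ (smkW sg) (sf' v))].
Qed.

Lemma smfD f g : smf A f -> smf A g -> smf A (fun x => f x + g x).
Proof. by move=> /smfP sf /smfP sg; apply/smfP => k; exact: smkD. Qed.

Lemma smfM f g : smf A f -> smf A g -> smf A (fun x => f x * g x).
Proof. by move=> /smfP sf /smfP sg; apply/smfP => k; exact: smkM. Qed.

Lemma smfN f : smf A f -> smf A (fun x => - f x).
Proof.
move=> sf; rewrite (_ : (fun x => - f x) = (fun x => (fun=> -1) x * f x)).
  by apply: smfM => //; exact: smf_cst.
by apply/funext => x; rewrite mulN1r.
Qed.

Lemma smf_sum (J : Type) (r : seq J) (P : pred J) (F : J -> V -> R) :
  (forall j, P j -> smf A (F j)) -> smf A (fun x => \sum_(j <- r | P j) F j x).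
Proof.
move=> sF; elim: r => [|j r IH]; first by rewrite fun_big_nil; exact: smf_cst.
rewrite fun_big_cons; case: ifP => // Pj.
by apply: smfD => //; exact: sF.
Qed.

End Closure.

Lemma derive1_line f x v t :
  (fun s => f (x + s *: v))^`()%classic t = 'D_v (f : V -> R^o) (x + t *: v).
Proof.
have E : (fun h : R => h^-1 *: (f (x + (h + t) *: v) - f (x + t *: v))) =
    (fun h : R => h^-1 *: (((f : V -> R^o) \o shift (x + t *: v)) (h *: v)
       - f (x + t *: v))).
  by apply/funext => h /=; rewrite scalerDl addrCA addrA.
by rewrite /derive1 E.
Qed.

Lemma derivable_line f x v t : derivable (f : V -> R^o) (x + t *: v) v ->
  isd (fun s => f (x + s *: v)) t ('D_v (f : V -> R^o) (x + t *: v)).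
Proof.
move=> df; split; last exact: derive1_line.
rewrite dableE; move: df; rewrite /derivable.
have -> : (fun h : R => h^-1 *: (((fun s : R => f (x + s *: v)) \o shift t) h%:A
    - f (x + t *: v))) = (fun h : R => h^-1 *: (((f : V -> R^o) \o shift (x + t *: v)) (h *: v)
       - f (x + t *: v))).
  by apply/funext => h /=; rewrite [h%:A]mulr1 scalerDl addrCA addrA.
by [].
Qed.

Lemma isd_line A f x v t : smf A f -> A (x + t *: v) ->
  isd (fun s => f (x + s *: v)) t ('D_v (f : V -> R^o) (x + t *: v)).
Proof. by move=> sf At; apply: derivable_line; apply: diff_derivable; exact: smf_diff sf At. Qed.

Lemma smooth1_line A f x v (O : set R) : open O -> (forall t, O t -> A (x + t *: v)) ->
  smf A f -> smooth1 O (fun s => f (x + s *: v)).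
Proof.
move=> oO OA sf k; elim: k f sf => // k IH f sf; split.
  by move=> t /OA/(smf_diff sf)/diff_derivable/derivable_line[].
apply: (@eq_on_sm _ _ _ (fun t => 'D_v (f : V -> R^o) (x + t *: v))) => //.
  move=> t /set_mem/OA/(smf_diff sf)/diff_derivable df.
  by have [_ ->] := derivable_line (df v).
exact: (IH _ (smf_D v sf)).
Qed.

End SmoothScalar.

Section CkLinear.
Context {R : realType} {V W : normedModType R}.

(** Stated for an abstract functional in order to cover entries of matrices and entries of
    components of pairs alike; continuous linear maps commute with directional derivatives. *)
Lemma smf_linear (A : set V) (f : V -> W) (L0 : W -> R^o) :
  open A -> linear L0 -> continuous L0 -> smooth_on A f -> smf A (fun x => L0 (f x)).
Proof.
move=> oA lL cL sf.
pose LM := GRing.isLinear.Build _ _ _ _ _ lL.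
pose L : {linear W -> R^o} := HB.pack L0 LM.
rewrite -[L0]/(L : W -> R^o) in cL *; apply/smfP => k; move: (sf k.+1).
elim: k f {sf} => // k IH f [df sf].
have dL y : differentiable (L : W -> R^o) y by exact: linear_differentiable.
split=> [x Ax|v]; first by apply: differentiable_comp => //; exact: df.
apply: (@eq_on_smk _ _ _ _ (fun x => L ('D_v f x))) => //.
  move=> x /set_mem Ax; have dfx := df x Ax.
  rewrite [RHS]deriveE; last by apply: differentiable_comp.
  rewrite deriveE// (@diff_comp _ _ _ _ f (L : W -> R^o) x dfx (dL _)) /=.
  by rewrite (diff_lin (f x) cL).
exact: (IH _ (sf v)).
Qed.

End CkLinear.

Section Entries.
Context {R : realType} {V : normedModType R}.

Lemma entry_linear {p q} i j :
  linear ((fun N => N i j) : 'M[R]_(p, q) -> R^o).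
Proof. by move=> c M N; rewrite !mxE. Qed.

Lemma smf_entry {p q} (A : set V) (f : V -> 'M[R]_(p, q)) i j :
  open A -> smooth_on A f -> smf A (fun x => f x i j).
Proof.
move=> oA sf.
apply: (smf_linear oA (@entry_linear p q i j) _ sf).
exact: coord_continuous.
Qed.

Lemma smf_entry1 {p q p' q'} (A : set V) (f : V -> 'M[R]_(p, q) * 'M[R]_(p', q')) i j :
  open A -> smooth_on A f -> smf A (fun x => (f x).1 i j).
Proof.
move=> oA sf.
have lin : linear ((fun N => N.1 i j) : 'M[R]_(p, q) * 'M[R]_(p', q') -> R^o).
  by move=> c M N; rewrite /= !mxE.
apply: (smf_linear oA lin _ sf) => x.
apply: (@continuous_comp _ _ _ fst (fun N : 'M[R]_(p, q) => N i j)); first exact: cvg_fst.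
exact: coord_continuous.
Qed.

Lemma smf_entry2 {p q p' q'} (A : set V) (f : V -> 'M[R]_(p, q) * 'M[R]_(p', q')) i j :
  open A -> smooth_on A f -> smf A (fun x => (f x).2 i j).
Proof.
move=> oA sf.
have lin : linear ((fun N => N.2 i j) : 'M[R]_(p, q) * 'M[R]_(p', q') -> R^o).
  by move=> c M N; rewrite /= !mxE.
apply: (smf_linear oA lin _ sf) => x.
apply: (@continuous_comp _ _ _ snd (fun N : 'M[R]_(p', q') => N i j)); first exact: cvg_snd.
exact: coord_continuous.
Qed.

End Entries.

(** * Symmetry of second derivatives *)

Section Schwarz.
Context {R : realType} {V : normedModType R}.

Lemma plane_near (A : set V) x (v w : V) : nbhs x A -> exists2 d : R, 0 < d &
  forall r q : R, `|r| < d -> `|q| < d -> A (x + r *: v + q *: w).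
Proof.
move=> /nbhs_ballP[e /= e0 eA].
have s0 : 0 < `|v| + `|w| + 1 by rewrite ltr_wpDl// addr_ge0.
exists (e / (`|v| + `|w| + 1)); first by rewrite divr_gt0.
move=> r q; rewrite !ltr_pdivlMr// => rd qd; apply: eA.
rewrite -ball_normE /ball_/= -addrA opprD addrA subrr sub0r normrN.
apply: (le_lt_trans (ler_normD _ _)); rewrite !normrZ.
have [rq|rq] := leP `|r| `|q|.
  apply: le_lt_trans qd; rewrite !mulrDr mulr1 -[leLHS]addr0 lerD// lerD//.
  by rewrite ler_wpM2r.
apply: le_lt_trans rd; rewrite !mulrDr mulr1 -[leLHS]addr0 lerD// lerD//.
by rewrite ler_wpM2r// ltW.
Qed.

Variables (A : set V) (f : V -> R) (x : V).
Hypotheses (oA : open A) (Ax : A x).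

Let D2 (v w : V) : V -> R := 'D_w ('D_v (f : V -> R^o) : V -> R^o).

(** The mean value theorem twice: along [v] for the increment in the direction [w], then along [w]
    for the derivative in the direction [v]. *)
Lemma second_difference (v w : V) (d s : R) : smf A f ->
  (forall r q : R, `|r| < d -> `|q| < d -> A (x + r *: v + q *: w)) -> `|s| < d ->
  exists r q : R, [/\ `|r| <= `|s|, `|q| <= `|s| &
    f (x + s *: v + s *: w) - f (x + s *: v) - (f (x + s *: w) - f x) =
    s * s * D2 v w (x + r *: v + q *: w)].
Proof.
move=> sf dA sd; pose O := ball (0 : R) d.
have OE t : O t = (`|t| < d) by rewrite /O -ball_normE /ball_/= sub0r normrN.
have d0 : 0 < d by exact: le_lt_trans sd.
have oO : open O by exact: ball_open.
have sD := smf_D v sf.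
pose h t := f (x + s *: w + t *: v) - f (x + t *: v).
have h1 : smooth1 O (fun t => f (x + s *: w + t *: v)).
  by apply: (smooth1_line oO _ sf) => t; rewrite OE => td; rewrite addrAC; exact: dA.
have h2 : smooth1 O (fun t => f (x + t *: v)).
  apply: (smooth1_line oO _ sf) => t; rewrite OE => td.
  by have := dA t 0 td; rewrite scale0r addr0 normr0; apply.
have sh : smooth1 O h by apply: smooth1D => //; exact: smooth1N.
have [t ts|r rs Hr] := @mvt0 R O h s _ sh; first by rewrite OE (le_lt_trans ts).
have rd : `|r| < d by exact: le_lt_trans sd.
have dh : h^`()%classic r = 'D_v (f : V -> R^o) (x + r *: v + s *: w) - 'D_v (f : V -> R^o) (x + r *: v).
  have Ar : A (x + s *: w + r *: v) by rewrite addrAC; exact: dA.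
  have Ar' : A (x + r *: v) by have := dA r 0 rd; rewrite scale0r addr0 normr0; apply.
  by have [_] := isdD (isd_line sf Ar) (isdN (isd_line sf Ar')); rewrite [x + s *: w + _]addrAC.
have h3 : smooth1 O (fun q => 'D_v (f : V -> R^o) (x + r *: v + q *: w)).
  by apply: (smooth1_line oO _ sD) => t; rewrite OE => td; exact: dA.
have [t ts|q qs Hq] := @mvt0 R O _ s _ h3; first by rewrite OE (le_lt_trans ts).
exists r, q; split=> //.
have qd : `|q| < d by exact: le_lt_trans sd.
have [_ e5] := isd_line sD (dA r q rd qd).
rewrite e5 scale0r addr0 in Hq.
rewrite dh Hq /h scale0r !addr0 [x + s *: w + s *: v]addrAC in Hr.
rewrite /D2; set Y := 'D_w _ _ in Hr *.
have rot (b c : R) : c * b * b = b * b * c by ring.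
by apply: (etrans Hr); exact: rot.
Qed.

(** The second difference is symmetric in [v] and [w], so the two mixed derivatives take a common
    value at suitable points close to [x]; their continuity concludes. *)
Lemma schwarz (v w : V) : smf A f ->
  'D_w ('D_v (f : V -> R^o)) x = 'D_v ('D_w (f : V -> R^o)) x.
Proof.
move=> sf; have [d d0 dA] := plane_near v w (open_nbhs_nbhs (conj oA Ax)).
have dA' r q : `|r| < d -> `|q| < d -> A (x + r *: w + q *: v).
  by move=> rd qd; rewrite addrAC; exact: dA.
have cD v' w' : {for x, continuous (D2 v' w' : V -> R^o)}.
  by apply: differentiable_continuous; exact: (smf_diff (smf_D w' (smf_D v' sf)) Ax).
apply/eqP; rewrite -subr_eq0 -normr_le0; apply/ler_addgt0Pl => e e0; rewrite addr0.
have e2 : 0 < e / 2 by rewrite divr_gt0.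
have near_D v' w' : exists2 d' : R, 0 < d' & forall r q : R, `|r| < d' -> `|q| < d' ->
    `|D2 v' w' x - D2 v' w' (x + r *: v' + q *: w')| <= e / 2.
  have Hz : nbhs x [set y | `|D2 v' w' x - D2 v' w' y| <= e / 2].
    by have /cvgrPdist_le/(_ _ e2) := cD v' w'.
  have [d' d'0 Hd'] := plane_near v' w' Hz.
  by exists d'.
have [d1 d10 H1] := near_D v w; have [d2 d20 H2] := near_D w v.
pose s := Num.min d (Num.min d1 d2) / 2.
have m0 : 0 < Num.min d (Num.min d1 d2) by rewrite !lt_min d0 d10 d20.
have s0 : 0 < s by rewrite divr_gt0.
have : `|s| < Num.min d (Num.min d1 d2).
  by rewrite gtr0_norm// /s ltr_pdivrMr// ltr_pMr// ltr1n.
rewrite !lt_min => /andP[sd /andP[sd1 sd2]].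
have [r [q [rs qs E1]]] := second_difference sf dA sd.
have [r' [q' [rs' qs' E2]]] := second_difference sf dA' sd.
have E : D2 v w (x + r *: v + q *: w) = D2 w v (x + r' *: w + q' *: v).
  have ss : s * s != 0 by rewrite mulf_neq0 ?gt_eqF.
  have swap (a b c e' : R) : a - b - (c - e') = a - c - (b - e') by ring.
  apply: (mulfI ss); apply: (etrans (esym E1)); apply: (etrans _ E2).
  by rewrite [x + s *: w + s *: v]addrAC; exact: swap.
have B1 := H1 r q (le_lt_trans rs sd1) (le_lt_trans qs sd1).
have B2 := H2 r' q' (le_lt_trans rs' sd2) (le_lt_trans qs' sd2).
rewrite -/(D2 v w x) -/(D2 w v x).
have -> : D2 v w x - D2 w v x = (D2 v w x - D2 v w (x + r *: v + q *: w)) -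
    (D2 w v x - D2 w v (x + r' *: w + q' *: v)) by rewrite E opprB addrA subrK.
have two_halves (a b : R) : `|a| <= e / 2 -> `|b| <= e / 2 -> `|a - b| <= e.
  by move=> ae be; rewrite [leRHS]splitr; apply: le_trans (ler_normB _ _) _; exact: lerD.
exact: (two_halves _ _ B1 B2).
Qed.

End Schwarz.

Section ChainRule.
Context {R : realType} {n : nat}.
Implicit Types (f : 'rV[R]_n -> R) (g : R -> 'rV[R]_n).

Fact pd_key : unit. Proof. by []. Qed.

(* Partial derivatives are locked, for unification would otherwise unfold them. *)
Definition pd f (l : 'I_n) : 'rV[R]_n -> R :=
  locked_with pd_key ('D_(delta_mx 0 l) (f : 'rV[R]_n -> R^o)).

Lemma pdE f l : pd f l = 'D_(delta_mx 0 l) (f : 'rV[R]_n -> R^o).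
Proof. by rewrite /pd unlock. Qed.

Lemma derive_pd f u v : differentiable (f : 'rV[R]_n -> R^o) u ->
  'D_v (f : 'rV[R]_n -> R^o) u = \sum_l v 0 l * pd f l u.
Proof.
move=> df; rewrite deriveE// {1}(row_sum_delta v) linear_sum; apply: eq_bigr => l _.
by rewrite linearZ /= pdE deriveE.
Qed.

Lemma isd_comp f g t (dg : 'rV[R]_n) : differentiable (f : 'rV[R]_n -> R^o) (g t) ->
  (forall j, isd (fun s => g s 0 j) t (dg 0 j)) ->
  isd (fun s => f (g s)) t (\sum_l dg 0 l * pd f l (g t)).
Proof.
move=> df dgj.
have dG : derivable g t 1.
  by apply/derivable_mxP => i j; rewrite ord1; have [+ _] := dgj j; rewrite dableE.
have Dg : 'D_1 g t = dg.
  rewrite derive_mx//; apply/matrixP => i j; rewrite mxE ord1.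
  by have [_] := dgj j; rewrite derive1E.
have dG' : differentiable g t by apply/derivable1_diffP.
have dfg : differentiable (fun s => f (g s) : R^o) t.
  exact: (differentiable_comp dG' df).
split; first by rewrite dableE; apply/derivable1_diffP.
rewrite derive1E deriveE//.
rewrite (@diff_comp _ _ _ _ g (f : 'rV[R]_n -> R^o) t dG' df) /=.
have E1 : 'd g t 1 = dg by rewrite -deriveE.
by rewrite E1 -derive_pd// deriveE.
Qed.

Lemma smf_pd A f l : smf A f -> smf A (pd f l).
Proof. by rewrite pdE; exact: smf_D. Qed.

(** Induction on the order for all [f] at once: the derivative of the composite is a sum of
    derivatives of [g] times partial derivatives of [f] along [g]. *)
Lemma smooth1_comp (A : set 'rV[R]_n) (O : set R) f g : open O -> smf A f ->
  (forall t, O t -> A (g t)) -> smx O g -> smooth1 O (fun s => f (g s)).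
Proof.
move=> oO + gA sg k; elim: k f => // k IH f sf.
have H t : O t -> isd (fun s => f (g s)) t (\sum_l dmx g t 0 l * pd f l (g t)).
  move=> Ot; apply: isd_comp; first exact: smf_diff sf (gA t Ot).
  by move=> j; exact: (smx_isd sg Ot).
split; first by move=> t /H[].
apply: (@eq_on_sm _ _ _ (fun t => \sum_l dmx g t 0 l * pd f l (g t))) => //.
  by move=> t /set_mem /H[].
elim: (index_enum _) => [|l r IHr]; first by rewrite fun_big_nil; exact: smooth1_cst.
rewrite fun_big_cons; apply: smD => //; apply: smM => //.
  exact: (smx_dmx sg).
by apply: IH; exact: smf_pd.
Qed.

Lemma pd_comm A f l j u : open A -> A u -> smf A f -> pd (pd f l) j u = pd (pd f j) l u.
Proof. by move=> oA Au sf; rewrite !pdE; exact: schwarz oA Au _ _ sf. Qed.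

Lemma isd_pd A f r u : smf A f -> A u ->
  isd (fun s => f (u + s *: delta_mx 0 r)) 0 (pd f r u).
Proof.
move=> sf Au; have E0 : u + 0 *: delta_mx 0 r = u by rewrite scale0r addr0.
have := @isd_line _ _ A f u (delta_mx 0 r) 0 sf; rewrite E0 pdE; exact.
Qed.

Lemma near_eq_pd f h l u : (\near u, f u = h u) -> pd f l u = pd h l u.
Proof. by move=> fh; rewrite !pdE; exact: near_eq_derive fh. Qed.

End ChainRule.

(** * Vector fields and changes of charts *)

Section Jacobians.
Context {R : realType} {n : nat}.

Lemma derive_entries (f : 'rV[R]_n -> 'rV[R]_n) u v :
  (forall j, differentiable ((fun w => f w 0 j) : 'rV[R]_n -> R^o) u) ->
  derivable f u v /\
  forall j, ('D_v f u) 0 j = \sum_l v 0 l * pd (fun w => f w 0 j) l u.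
Proof.
move=> df; have dv : derivable f u v.
  by apply/derivable_mxP => i j; rewrite ord1; apply: diff_derivable; exact: df.
by split=> // j; rewrite derive_mx// mxE -derive_pd.
Qed.

Lemma jacobianE (f : 'rV[R]_n -> 'rV[R]_n) u l j : differentiable f u ->
  jacobian f u l j = pd (fun w => f w 0 j) l u.
Proof.
move=> df; have := deriveEjacobian (delta_mx 0 l) df; rewrite -rowE => H.
have : ('D_(delta_mx 0 l) f u) 0 j = jacobian f u l j by rewrite H mxE.
move=> <-; rewrite pdE derive_mx ?mxE//; exact: diff_derivable.
Qed.

Lemma jacobian_comp (f g : 'rV[R]_n -> 'rV[R]_n) u : differentiable f u ->
  differentiable g (f u) -> jacobian (g \o f) u = jacobian f u *m jacobian g (f u).
Proof.
move=> df dg; have dgf : differentiable (g \o f) u by exact: (differentiable_comp df dg).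
have H (v : 'rV[R]_n) : v *m jacobian (g \o f) u = v *m jacobian f u *m jacobian g (f u).
  apply: (etrans (esym (deriveEjacobian v dgf))); apply: (etrans (deriveE v dgf)).
  have e1 : 'd f u v = v *m jacobian f u.
    exact: (etrans (esym (deriveE v df)) (deriveEjacobian v df)).
  apply: (etrans (congr1 (fun F : _ -> _ => F v) (diff_comp df dg))).
  apply: (etrans (congr1 ('d g (f u)) e1)).
  exact: (etrans (esym (deriveE _ dg)) (deriveEjacobian _ dg)).
by apply/row_matrixP => i; rewrite rowE H -mulmxA -rowE.
Qed.

Lemma row_jacobian (f : 'rV[R]_n -> 'rV[R]_n) u i : differentiable f u ->
  row i (jacobian f u) = 'D_(delta_mx 0 i) f u.
Proof.
by move=> df; apply: (etrans (rowE _ _)); apply/esym; exact: (deriveEjacobian _ df).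
Qed.

Lemma near_eq_jacobian (f g : 'rV[R]_n -> 'rV[R]_n) u : (\near u, f u = g u) ->
  differentiable f u -> jacobian f u = jacobian g u.
Proof.
move=> fg df; have dg := near_eq_differentiable fg df.
apply/row_matrixP => i; apply: (etrans (row_jacobian i df)).
apply: (etrans _ (esym (row_jacobian i dg))).
exact: near_eq_derive fg.
Qed.

Lemma jacobian_id u : jacobian (id : 'rV[R]_n -> 'rV[R]_n) u = 1%:M.
Proof.
have did : differentiable (id : 'rV[R]_n -> 'rV[R]_n) u.
  exact: (@linear_differentiable _ _ _ idfun u (fun x => cvg_id)).
apply/row_matrixP => i; apply: (etrans (row_jacobian i did)).
by rewrite row1; exact: derive_id.
Qed.

Lemma pd_line (f : 'rV[R]_n -> R) u r :
  pd f r u = (fun s => f (u + s *: delta_mx 0 r))^`()%classic 0.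
Proof.
by rewrite derive1_line scale0r addr0 pdE.
Qed.

Lemma pd_comp (f : 'rV[R]_n -> R) (phi : 'rV[R]_n -> 'rV[R]_n) (A : set 'rV[R]_n) u r :
  A u -> (forall j, smf A (fun v => phi v 0 j)) ->
  differentiable (f : 'rV[R]_n -> R^o) (phi u) ->
  pd (fun v => f (phi v)) r u =
  \sum_m pd (fun v => phi v 0 m) r u * pd f m (phi u).
Proof.
move=> Au sphi df.
have E0 : u + 0 *: delta_mx 0 r = u by rewrite scale0r addr0.
pose g s := phi (u + s *: delta_mx 0 r).
pose dg : 'rV[R]_n := \row_m pd (fun v => phi v 0 m) r u.
have g0 : g 0 = phi u by rewrite /g E0.
have [||_ H] := @isd_comp _ _ f g 0 dg; first by rewrite g0.
  by move=> j; rewrite mxE; exact: isd_pd (sphi j) Au.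
by rewrite pd_line H g0; apply: eq_bigr => m _; rewrite mxE.
Qed.

End Jacobians.

Section Transitions.
Context {R : realType} {n : nat} {M : smoothManifold R n}.
Implicit Types (a b c : chart M) (x : M) (U : set M).

Lemma open_chart_image a U : open U -> open (chart_map a @` (dom a `&` U)).
Proof.
move=> oU.
have -> : chart_map a @` (dom a `&` U) = (chart_map a @` dom a) `&` (param a @^-1` U).
  apply/seteqP; split=> u /=.
    move=> [x [ax Ux] <-]; split; first by exists x.
    by rewrite /preimage/= chart_mapK.
  move=> [[x ax <-]]; rewrite /preimage/= chart_mapK// => Ux.
  by exists x.
rewrite openE => u [iu pu]; apply: filterI.
  by apply: open_nbhs_nbhs; split => //; exact: open_chart_map_dom.
by apply: (param_continuous iu); apply: open_nbhs_nbhs.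
Qed.

Lemma trans_chart a b x : dom a x -> trans a b (chart_map a x) = chart_map b x.
Proof. by move=> ax; rewrite /trans /= chart_mapK. Qed.

Definition overlap a b := chart_map a @` (dom a `&` dom b).

Lemma open_overlap a b : open (overlap a b).
Proof. by apply: open_chart_image; exact: open_dom. Qed.

Lemma trans_smf a b j : smf (overlap a b) (fun u => trans a b u 0 j).
Proof. by apply: smf_entry; [exact: open_overlap|exact: transition_smooth]. Qed.

Lemma trans_differentiable a b u : overlap a b u -> differentiable (trans a b) u.
Proof. by move=> ou; have [+ _] := @transition_smooth _ _ M a b 1%N; apply. Qed.

Definition tmx a b x := jacobian (trans a b) (chart_map a x).

Lemma tmxE a b x l j : dom a x -> dom b x ->
  tmx a b x l j = pd (fun u => trans a b u 0 j) l (chart_map a x).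
Proof.
move=> ax bx; apply: jacobianE; apply: trans_differentiable.
by exists x.
Qed.

Lemma tmx_comp a b c x : dom a x -> dom b x -> dom c x ->
  tmx a c x = tmx a b x *m tmx b c x.
Proof.
move=> ax bx cx.
have dab : differentiable (trans a b) (chart_map a x).
  by apply: trans_differentiable; exists x.
have tE := trans_chart b ax.
have dbc : differentiable (trans b c) (trans a b (chart_map a x)).
  rewrite tE; apply: trans_differentiable; by exists x.
have H := jacobian_comp dab dbc; rewrite tE in H.
apply: (etrans _ H).
apply/esym/near_eq_jacobian; last exact: (differentiable_comp dab dbc).
have oW : open (chart_map a @` (dom a `&` dom b)) by exact: open_overlap.
near=> u.
have [y [ay by_] <-] : (chart_map a @` (dom a `&` dom b)) u.
  by near: u; apply: open_nbhs_nbhs; split=> //; exists x.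
by rewrite /= !trans_chart.
Unshelve. all: by end_near. Qed.

Lemma tmx_id a x : dom a x -> tmx a a x = 1%:M.
Proof.
move=> ax.
transitivity (jacobian (id : 'rV[R]_n -> 'rV[R]_n) (chart_map a x)); last first.
  exact: jacobian_id.
rewrite /tmx.
have daa : differentiable (trans a a) (chart_map a x).
  by apply: trans_differentiable; exists x.
apply: (near_eq_jacobian _ daa).
near=> u.
have [y ay <-] : (chart_map a @` dom a) u.
  by near: u; apply: open_nbhs_nbhs; split; [exact: open_chart_map_dom|exists x].
by rewrite trans_chart.
Unshelve. all: by end_near. Qed.

Lemma tmxK a b x : dom a x -> dom b x -> tmx a b x *m tmx b a x = 1%:M.
Proof. by move=> ax bx; rewrite -tmx_comp// tmx_id. Qed.

Lemma tmx_unit a b x : dom a x -> dom b x -> tmx a b x \in unitmx.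
Proof. by move=> ax bx; exact: (proj1 (mulmx1_unit (tmxK ax bx))). Qed.

(* Componentwise version of smooth_vfield_on. *)
Definition gvf U (Z : vfield M) :=
  (forall a j, smf (chart_map a @` (dom a `&` U)) (fun u => Z a u 0 j)) /\
  (forall a b x, U x -> dom a x -> dom b x ->
     Z b (chart_map b x) = Z a (chart_map a x) *m tmx a b x).

Lemma gvf_smooth U Z : open U -> smooth_vfield_on U Z -> gvf U Z.
Proof.
move=> oU [sZ tZ]; split=> // a j; apply: smf_entry; first exact: open_chart_image.
exact: sZ.
Qed.

Lemma gvfS U U' Z : U' `<=` U -> gvf U Z -> gvf U' Z.
Proof.
move=> UU [sZ tZ]; split=> [a j|a b x /UU Ux]; last exact: tZ.
by apply: smfS (sZ a j) => u [x [ax /UU Ux] <-]; exists x.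
Qed.

Section Bracket.
Variables (U : set M) (oU : open U).

Lemma lieE a u (Z1 Z2 : vfield M) j : gvf U Z1 -> gvf U Z2 ->
  (chart_map a @` (dom a `&` U)) u ->
  lie Z1 Z2 a u 0 j =
  \sum_l (Z1 a u 0 l * pd (fun v => Z2 a v 0 j) l u
         - Z2 a u 0 l * pd (fun v => Z1 a v 0 j) l u).
Proof.
move=> [s1 _] [s2 _] Wu; rewrite /lie 2!mxE.
have [_ ->] := derive_entries (Z1 a u) (fun j => smf_diff (s2 a j) Wu).
have [_ ->] := derive_entries (Z2 a u) (fun j => smf_diff (s1 a j) Wu).
by rewrite sumrB.
Qed.

Lemma lie_smf Z1 Z2 a j : gvf U Z1 -> gvf U Z2 ->
  smf (chart_map a @` (dom a `&` U)) (fun u => lie Z1 Z2 a u 0 j).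
Proof.
move=> g1 g2; have oW := open_chart_image (a := a) oU; have [s1 _] := g1; have [s2 _] := g2.
apply: (@eq_on_smf _ _ _ (fun u => \sum_l (Z1 a u 0 l * pd (fun v => Z2 a v 0 j) l u
         - Z2 a u 0 l * pd (fun v => Z1 a v 0 j) l u))) => //.
  by move=> u /set_mem Wu; rewrite (lieE j g1 g2 Wu).
apply: smf_sum => // l _; apply: smfD => //.
  by apply: smfM => //; apply: smf_pd; exact: s2.
apply: smfN => //; apply: smfM => //; apply: smf_pd; exact: s1.
Qed.

(* First derivative of the transformation rule. *)
Lemma gvf_pd Z a b x r j : gvf U Z -> U x -> dom a x -> dom b x ->
  \sum_m tmx a b x r m * pd (fun v => Z b v 0 j) m (chart_map b x) =
  \sum_l (pd (fun v => Z a v 0 l) r (chart_map a x) * tmx a b x l j +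
    Z a (chart_map a x) 0 l *
      pd (pd (fun v => trans a b v 0 j) l) r (chart_map a x)).
Proof.
move=> [sZ tZ] Ux ax bx; set u := chart_map a x.
pose W := chart_map a @` (dom a `&` (dom b `&` U)).
have oW : open W by apply: open_chart_image; apply: openI => //; exact: open_dom.
have Wu : W u by exists x.
have Wab : W `<=` overlap a b by move=> _ [y [ay [by_ _]] <-]; exists y.
have WU : W `<=` chart_map a @` (dom a `&` U) by move=> _ [y [ay [_ Uy]] <-]; exists y.
have dZb : differentiable ((fun v => Z b v 0 j) : _ -> R^o) (trans a b u).
  by apply: (smf_diff (sZ b j)); rewrite /u trans_chart//; exists x.
have L := pd_comp r (Wab _ Wu) (trans_smf a b) dZb.
rewrite {2}/u trans_chart// in L.
transitivity (pd (fun v => Z b (trans a b v) 0 j) r u).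
  by rewrite L; apply: eq_bigr => m _; rewrite tmxE.
transitivity (pd (fun v => \sum_l Z a v 0 l * pd (fun v => trans a b v 0 j) l v) r u).
  apply: near_eq_pd; near=> v.
  have [y [ay [by_ Uy]] <-] : W v by near: v; apply: open_nbhs_nbhs.
  rewrite trans_chart// (tZ a b y)// mxE; apply: eq_bigr => l _.
  by rewrite tmxE.
rewrite pd_line.
have E0 : u + 0 *: delta_mx 0 r = u by rewrite scale0r addr0.
have H1 l : isd (fun s => Z a (u + s *: delta_mx 0 r) 0 l) 0 (pd (fun v => Z a v 0 l) r u).
  by apply: isd_pd (sZ a l) _; exact: WU.
have H2 l : isd (fun s => pd (fun v => trans a b v 0 j) l (u + s *: delta_mx 0 r)) 0
    (pd (pd (fun v => trans a b v 0 j) l) r u).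
  by apply: isd_pd (smf_pd l (trans_smf a b j)) _; exact: Wab.
have [_ ->] := isd_sum (index_enum 'I_n) (P := xpredT) (fun l _ => isdM (H1 l) (H2 l)).
by apply: eq_bigr => l _; rewrite E0 tmxE.
Unshelve. all: by end_near. Qed.

(** The derivative of one field along the other transforms with an extra term containing the second
    derivatives of the transition map. This term is symmetric in the two fields and cancels in the
    bracket. *)
Theorem lie_gvf Z1 Z2 : gvf U Z1 -> gvf U Z2 -> gvf U (lie Z1 Z2).
Proof.
move=> g1 g2; split=> [a j|a b x Ux ax bx]; first exact: lie_smf.
have [s1 t1] := g1; have [s2 t2] := g2.
apply/rowP => j; rewrite [RHS]mxE.
have Wb : (chart_map b @` (dom b `&` U)) (chart_map b x) by exists x.
have Wa : (chart_map a @` (dom a `&` U)) (chart_map a x) by exists x.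
apply: (etrans (lieE j g1 g2 Wb)).
under [RHS]eq_bigr => l _ do rewrite (lieE l g1 g2 Wa).
set u := chart_map a x.
have half Z Z' : gvf U Z -> gvf U Z' ->
    \sum_m Z b (chart_map b x) 0 m * pd (fun v => Z' b v 0 j) m (chart_map b x) =
    \sum_r Z a u 0 r * \sum_l (pd (fun v => Z' a v 0 l) r u * tmx a b x l j +
      Z' a u 0 l * pd (pd (fun v => trans a b v 0 j) l) r u).
  move=> g g'; under [RHS]eq_bigr do rewrite -gvf_pd// mulr_sumr.
  rewrite exchange_big; apply: eq_bigr => m _.
  rewrite (g.2 a b x Ux ax bx) mxE mulr_suml.
  by apply: eq_bigr => r _; rewrite mulrA.
rewrite sumrB (half _ _ g1 g2) (half _ _ g2 g1).
set H := fun l r => pd (pd (fun v => trans a b v 0 j) l) r u.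
have Hsym l r : H l r = H r l.
  apply: (@pd_comm _ _ (overlap a b)); [exact: open_overlap| |exact: trans_smf].
  by exists x.
have split_half (Z Z' : vfield M) : \sum_r Z a u 0 r * \sum_l (pd (fun v => Z' a v 0 l) r u * tmx a b x l j +
      Z' a u 0 l * H l r) =
   \sum_l (\sum_r Z a u 0 r * pd (fun v => Z' a v 0 l) r u) * tmx a b x l j +
   \sum_r \sum_l Z a u 0 r * Z' a u 0 l * H l r.
  under [X in _ = X + _]eq_bigr do rewrite mulr_suml.
  rewrite exchange_big -big_split/=; apply: eq_bigr => r _.
  rewrite mulr_sumr -big_split; apply: eq_bigr => l _ /=.
  by rewrite mulrDr !mulrA.
rewrite (split_half Z1 Z2) (split_half Z2 Z1).
have -> : \sum_r \sum_l Z2 a u 0 r * Z1 a u 0 l * H l r =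
    \sum_r \sum_l Z1 a u 0 r * Z2 a u 0 l * H l r.
  rewrite exchange_big; apply: eq_bigr => r _; apply: eq_bigr => l _ /=.
  by rewrite Hsym [Z2 _ _ _ _ * _]mulrC.
rewrite opprD addrACA subrr addr0 -sumrB; apply: eq_bigr => l _.
by rewrite -mulrBl -sumrB.
Qed.

End Bracket.
End Transitions.

(** * The Hamiltonian system and its linearization *)

Lemma isd_eq {R : realType} (f : R -> R) t a b : isd f t a -> a = b -> isd f t b.
Proof. by move=> H <-. Qed.

Section LocalHamiltonian.
Context {R : realType} {n k : nat}.
Variables (W : set 'rV[R]_n) (oW : open W).
Variables (Z0 : 'rV[R]_n -> 'rV[R]_n) (Z : 'I_k -> 'rV[R]_n -> 'rV[R]_n).
Variable q : 'rV[R]_n -> R.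
Hypothesis sZ0 : forall j, smf W (fun u => Z0 u 0 j).
Hypothesis sZ : forall i j, smf W (fun u => Z i u 0 j).
Hypothesis sq : smf W q.

Definition lham (p u : 'rV[R]_n) : R :=
  2^-1 * (\sum_(i < k) pairing p (Z i u) ^+ 2) + pairing p (Z0 u) + 2^-1 * q u.

Lemma pairingE (p v : 'rV[R]_n) : pairing p v = \sum_l p 0 l * v 0 l.
Proof. by rewrite /pairing mxE; apply: eq_bigr => l _; rewrite mxE. Qed.

Definition dpairing (V : 'rV[R]_n -> 'rV[R]_n) (p u : 'rV[R]_n) j : R :=
  \sum_l p 0 l * pd (fun v => V v 0 l) j u.

Definition ham_p (p u : 'rV[R]_n) : 'rV[R]_n :=
  \row_j (\sum_(i < k) pairing p (Z i u) * Z i u 0 j + Z0 u 0 j).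

Definition ham_x (p u : 'rV[R]_n) : 'rV[R]_n :=
  \row_j (\sum_(i < k) pairing p (Z i u) * dpairing (Z i) p u j + dpairing Z0 p u j
    + 2^-1 * pd q j u).

(** Second derivatives of the Hamiltonian. Here rows are positions and columns momenta, so that a
    variation of the position, a row vector, acts from the left. *)
Definition ham_xp (p u : 'rV[R]_n) : 'M[R]_n :=
  \matrix_(m, j) (\sum_(i < k) (dpairing (Z i) p u m * Z i u 0 j
      + pairing p (Z i u) * pd (fun v => Z i v 0 j) m u)
    + pd (fun v => Z0 v 0 j) m u).

Definition ham_pp (u : 'rV[R]_n) : 'M[R]_n :=
  (\matrix_(i < k) Z i u)^T *m (\matrix_(i < k) Z i u).

Definition ddpairing (V : 'rV[R]_n -> 'rV[R]_n) (p u : 'rV[R]_n) m j : R :=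
  \sum_l p 0 l * pd (pd (fun v => V v 0 l) j) m u.

Definition ham_xx (p u : 'rV[R]_n) : 'M[R]_n :=
  \matrix_(m, j) (\sum_(i < k) (dpairing (Z i) p u m * dpairing (Z i) p u j
      + pairing p (Z i u) * ddpairing (Z i) p u m j)
    + ddpairing Z0 p u m j + 2^-1 * pd (pd q j) m u).

Section Curves.
Variables (x xi : R -> 'rV[R]_n) (t : R) (dx dxi : 'rV[R]_n).
Hypothesis Wx : W (x t).
Hypothesis Hx : forall j, isd (fun s => x s 0 j) t (dx 0 j).
Hypothesis Hxi : forall j, isd (fun s => xi s 0 j) t (dxi 0 j).

Lemma isd_curve (f : 'rV[R]_n -> R) : smf W f ->
  isd (fun s => f (x s)) t (\sum_m dx 0 m * pd f m (x t)).
Proof. by move=> sf; apply: isd_comp => //; exact: smf_diff sf Wx. Qed.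

Lemma isd_pairing (V : 'rV[R]_n -> 'rV[R]_n) : (forall j, smf W (fun u => V u 0 j)) ->
  isd (fun s => pairing (xi s) (V (x s))) t
    (pairing dxi (V (x t)) + \sum_m dx 0 m * dpairing V (xi t) (x t) m).
Proof.
move=> sV.
have -> : (fun s => pairing (xi s) (V (x s))) = fun s => \sum_l xi s 0 l * V (x s) 0 l.
  by apply/funext => s; rewrite pairingE.
have -> : pairing dxi (V (x t)) + \sum_m dx 0 m * dpairing V (xi t) (x t) m =
   \sum_l (dxi 0 l * V (x t) 0 l + xi t 0 l * \sum_m dx 0 m * pd (fun u => V u 0 l) m (x t)).
  rewrite pairingE big_split/=; congr (_ + _).
  under [RHS]eq_bigr do rewrite mulr_sumr.
  rewrite exchange_big; apply: eq_bigr => m _ /=.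
  by rewrite mulr_sumr; apply: eq_bigr => l _; rewrite mulrCA.
by apply: isd_sum => l _; exact: (isdM (Hxi l) (isd_curve (sV l))).
Qed.

Lemma isd_dpair (V : 'rV[R]_n -> 'rV[R]_n) j : (forall j, smf W (fun u => V u 0 j)) ->
  isd (fun s => dpairing V (xi s) (x s) j) t
    (dpairing V dxi (x t) j + \sum_m dx 0 m * ddpairing V (xi t) (x t) m j).
Proof.
move=> sV; rewrite /dpairing.
apply: (isd_eq (isd_sum (index_enum 'I_n) (P := xpredT)
  (fun l _ => isdM (Hxi l) (isd_curve (smf_pd j (sV l)))))).
rewrite big_split.
have E : \sum_l xi t 0 l * (\sum_m dx 0 m * pd (pd (fun v => V v 0 l) j) m (x t)) =
    \sum_m dx 0 m * ddpairing V (xi t) (x t) m j.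
  transitivity (\sum_l \sum_m xi t 0 l * (dx 0 m * pd (pd (fun v => V v 0 l) j) m (x t))).
    by apply: eq_bigr => l _; rewrite mulr_sumr.
  rewrite exchange_big.
  apply: eq_bigr => m _.
  rewrite /ddpairing mulr_sumr.
  apply: eq_bigr => l _.
  by rewrite mulrCA.
exact: (congr1 (fun z => _ + z) E).
Qed.

(** Applied to curves obtained by varying the initial covector at fixed time, this and [isd_ham_x]
    give the linearized system. *)
Lemma isd_ham_p j :
  isd (fun s => ham_p (xi s) (x s) 0 j) t
    ((dx *m ham_xp (xi t) (x t) + dxi *m ham_pp (x t)) 0 j).
Proof.
have -> : (fun s => ham_p (xi s) (x s) 0 j) = fun s =>
    \sum_(i < k) pairing (xi s) (Z i (x s)) * Z i (x s) 0 j + Z0 (x s) 0 j.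
  by apply/funext => s; rewrite mxE.
have dZi i := isdM (isd_pairing (sZ i)) (isd_curve (sZ i j)).
apply: (isd_eq (isdD (isd_sum (index_enum 'I_k) (P := xpredT) (fun i _ => dZi i))
  (isd_curve (sZ0 j)))).
apply/esym.
  rewrite mxE /ham_pp mulmxA.
  rewrite [X in X + _]mxE [X in _ + X]mxE.
  under [X in X + _]eq_bigr do rewrite mxE mulrDr mulr_sumr.
  rewrite big_split/= addrAC; congr (_ + _).
  rewrite exchange_big -big_split/=; apply: eq_bigr => i _.
  have -> : (dxi *m (\matrix_(i < k) Z i (x t))^T) 0 i = pairing dxi (Z i (x t)).
    by rewrite mxE pairingE; apply: eq_bigr => l _; rewrite !mxE.
  rewrite mxE mulrDl addrC -addrA; congr (_ + _).
  rewrite mulr_suml mulr_sumr -big_split; apply: eq_bigr => m _ /=.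
  by rewrite mulrDr mulrA [X in _ + X]mulrCA.
Qed.

Lemma isd_ham_x j :
  isd (fun s => ham_x (xi s) (x s) 0 j) t
    ((dx *m ham_xx (xi t) (x t) + dxi *m (ham_xp (xi t) (x t))^T) 0 j).
Proof.
have -> : (fun s => ham_x (xi s) (x s) 0 j) = fun s =>
    \sum_(i < k) pairing (xi s) (Z i (x s)) * dpairing (Z i) (xi s) (x s) j
    + dpairing Z0 (xi s) (x s) j + 2^-1 * pd q j (x s).
  by apply/funext => s; rewrite mxE.
have dZi i := isdM (isd_pairing (sZ i)) (isd_dpair j (sZ i)).
apply: (isd_eq (isdD (isdD (isd_sum (index_enum 'I_k) (P := xpredT) (fun i _ => dZi i))
  (isd_dpair j sZ0)) (isdM (isd_cst (2^-1) t) (isd_curve (smf_pd j sq))))).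
apply/esym.
  rewrite mxE [X in X + _]mxE [X in _ + X]mxE.
  under [X in X + _]eq_bigr do rewrite mxE 2!mulrDr mulr_sumr.
  under [X in _ + X]eq_bigr do rewrite 2!mxE mulrDr mulr_sumr.
  rewrite !big_split/= mul0r add0r.
  rewrite [X in X + _ + _ + _]exchange_big [X in _ + (X + _)]exchange_big/=.
  have -> : 2^-1 * \sum_m dx 0 m * pd (pd q j) m (x t) =
      \sum_m dx 0 m * (2^-1 * pd (pd q j) m (x t)).
    by rewrite mulr_sumr; apply: eq_bigr => m _; rewrite mulrCA.
  have -> (a b c d e : R) : a + b + c + (d + e) = (a + d) + (e + b) + c by ring.
  congr (_ + _ + _).
  rewrite -!big_split/=; apply: eq_bigr => i _.
  have -> : \sum_(m < n) dx 0 m * (dpairing (Z i) (xi t) (x t) m * dpairing (Z i) (xi t) (x t) j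
      + pairing (xi t) (Z i (x t)) * ddpairing (Z i) (xi t) (x t) m j) =
     (\sum_m dx 0 m * dpairing (Z i) (xi t) (x t) m) * dpairing (Z i) (xi t) (x t) j +
     pairing (xi t) (Z i (x t)) * (\sum_m dx 0 m * ddpairing (Z i) (xi t) (x t) m j).
    rewrite mulr_suml mulr_sumr -big_split; apply: eq_bigr => m _ /=.
    by rewrite mulrDr mulrA [X in _ + X]mulrCA.
  have -> : \sum_(m < n) dxi 0 m * (dpairing (Z i) (xi t) (x t) j * Z i (x t) 0 m
      + pairing (xi t) (Z i (x t)) * pd (fun v => Z i v 0 m) j (x t)) =
     pairing dxi (Z i (x t)) * dpairing (Z i) (xi t) (x t) j +
     pairing (xi t) (Z i (x t)) * dpairing (Z i) dxi (x t) j.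
    rewrite (pairingE dxi) mulr_suml [dpairing (Z i) dxi _ _]/dpairing [X in _ = _ + X]mulr_sumr -big_split; apply: eq_bigr => m _ /=.
    by ring.
  ring.
Qed.

End Curves.

Lemma ham_xx_sym p u : W u -> (ham_xx p u)^T = ham_xx p u.
Proof.
move=> Wu; apply/matrixP => m j; rewrite [LHS]mxE [LHS]mxE [RHS]mxE.
have cg (a b c a' b' c' : R) : a = a' -> b = b' -> c = c' -> a + b + c = a' + b' + c'.
  by move=> -> -> ->.
have dd (V : 'rV[R]_n -> 'rV[R]_n) : (forall j, smf W (fun u => V u 0 j)) -> ddpairing V p u j m = ddpairing V p u m j.
  by move=> sV; apply: eq_bigr => l _; rewrite (pd_comm _ _ oW Wu (sV l)).
have e1 := dd Z0 sZ0; have e2 := pd_comm m j oW Wu sq.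
have e3 i := dd (Z i) (sZ i).
apply: cg; [|exact: e1|exact: (congr1 (fun z => 2^-1 * z) e2)].
by apply: eq_bigr => i _; rewrite e3 [dpairing _ _ _ j * _]mulrC.
Qed.

Lemma ham_pE p u j : 'D_(delta_mx 0 j) (fun r => lham r u : R^o) p = ham_p p u 0 j.
Proof.
have H V : isd (fun s => pairing (p + s *: delta_mx 0 j) V) 0 (V 0 j).
  have E (r : 'rV[R]_n) : pairing r V = \sum_l r 0 l * V 0 l by exact: pairingE.
  have -> : (fun s => pairing (p + s *: delta_mx 0 j) V) =
      fun s : R => (fun=> pairing p V) s + s * (fun=> V 0 j) s.
    apply/funext => s; rewrite !E -[RHS]/(_ + s * V 0 j).
    have -> : s * V 0 j = \sum_l (s *: (delta_mx 0 j : 'rV[R]_n)) 0 l * V 0 l.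
      rewrite (bigD1 j)//= big1 ?addr0 => [|l lj]; rewrite !mxE eqxx/=.
        by rewrite eqxx mulr1.
      by rewrite (negPf lj) mulr0 mul0r.
    by rewrite -big_split; apply: eq_bigr => l _; rewrite mxE mulrDl.
  apply: (isd_eq (isdD (isd_cst _ _) (isdM (_ : isd id 0 1) (isd_cst _ _)))).
    by split; [rewrite dableE; exact: derivable_id|rewrite derive1_id].
  by rewrite /= mulr0 addr0 add0r mul1r.
have p0 : p + 0 *: delta_mx 0 j = p by rewrite scale0r addr0.
rewrite -{1}p0 -(derive1_line (fun r => lham r u)).
have Hi i := isdM (H (Z i u)) (H (Z i u)).
have [_ ->] := isdD (isdD (isdM (isd_cst (2^-1) 0)
  (isd_sum (index_enum 'I_k) (P := xpredT) (fun i _ => Hi i))) (H (Z0 u)))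
  (isd_cst (2^-1 * q u) 0).
rewrite mxE p0 mul0r add0r addr0; congr (_ + _).
rewrite mulr_sumr; apply: eq_bigr => i _.
by field.
Qed.

Lemma ham_xE p u j : W u -> 'D_(delta_mx 0 j) (fun v => lham p v : R^o) u = ham_x p u 0 j.
Proof.
move=> Wu; pose x s := u + s *: delta_mx 0 j.
have u0 : x 0 = u by rewrite /x scale0r addr0.
have Wx : W (x 0) by rewrite u0.
have Hx l : isd (fun s => x s 0 l) 0 ((delta_mx 0 j : 'rV[R]_n) 0 l).
  have -> : (fun s => x s 0 l) = fun s : R => (fun=> u 0 l) s + s * (fun=> (delta_mx 0 j : 'rV[R]_n) 0 l) s.
    by apply/funext => s; rewrite /x mxE [X in _ + X]mxE.
  apply: (isd_eq (isdD (isd_cst _ _) (isdM (_ : isd id 0 1) (isd_cst _ _)))).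
    by split; [rewrite dableE; exact: derivable_id|rewrite derive1_id].
  by rewrite /= mulr0 addr0 add0r mul1r.
have Hp l : isd (fun s => (fun=> p) s 0 l) 0 ((0 : 'rV[R]_n) 0 l).
  by rewrite mxE; exact: isd_cst.
rewrite -{1}u0 /x -(derive1_line (fun v => lham p v)).
have sumd f : \sum_m (delta_mx 0 j : 'rV[R]_n) 0 m * f m = f j :> R.
  rewrite (bigD1 j)//= big1 ?addr0 => [|l lj]; rewrite !mxE eqxx/= ?eqxx ?mul1r//.
  by rewrite (negPf lj) mul0r.
have pair0 V : pairing (0 : 'rV[R]_n) V = 0.
  by rewrite pairingE; apply: big1 => l _; rewrite mxE mul0r.
have Hi i := isdM (isd_pairing Wx Hx Hp (sZ i)) (isd_pairing Wx Hx Hp (sZ i)).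
have [_ ->] := isdD (isdD (isdM (isd_cst (2^-1) 0)
  (isd_sum (index_enum 'I_k) (P := xpredT) (fun i _ => Hi i)))
  (isd_pairing Wx Hx Hp sZ0)) (isdM (isd_cst (2^-1) 0) (isd_curve Wx Hx sq)).
rewrite mxE !sumd pair0 u0 !mul0r !add0r; congr (_ + _ + _).
rewrite mulr_sumr; apply: eq_bigr => i _; rewrite sumd pair0 add0r.
by field.
Qed.

Section SmoothAlong.
Variables (O : set R) (oO : open O) (x xi : R -> 'rV[R]_n).
Hypotheses (sx : smx O x) (sxi : smx O xi) (Wx : forall t, O t -> W (x t)).

Let comp f : smf W f -> smooth1 O (fun t => f (x t)).
Proof. by move=> sf; exact: smooth1_comp oO sf Wx sx. Qed.

Let pair (V : 'rV[R]_n -> 'rV[R]_n) : (forall j, smf W (fun u => V u 0 j)) -> smooth1 O (fun t => pairing (xi t) (V (x t))).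
Proof.
move=> sV; have -> : (fun s => pairing (xi s) (V (x s))) = fun s => \sum_l xi s 0 l * V (x s) 0 l.
  by apply/funext => s; rewrite pairingE.
apply: (smooth1_sum oO) => l _; apply: (smooth1M oO); [exact: sxi|exact: (comp (sV l))].
Qed.

Let dpairs (V : 'rV[R]_n -> 'rV[R]_n) j : (forall j, smf W (fun u => V u 0 j)) -> smooth1 O (fun t => dpairing V (xi t) (x t) j).
Proof.
move=> sV; apply: (smooth1_sum oO) => l _; apply: (smooth1M oO); first exact: sxi.
exact: (comp (smf_pd j (sV l))).
Qed.

Let ddpairs (V : 'rV[R]_n -> 'rV[R]_n) m j : (forall j, smf W (fun u => V u 0 j)) ->
  smooth1 O (fun t => ddpairing V (xi t) (x t) m j).
Proof.
move=> sV; apply: (smooth1_sum oO) => l _; apply: (smooth1M oO); first exact: sxi.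
exact: (comp (smf_pd m (smf_pd j (sV l)))).
Qed.

Lemma smx_ham_xp : smx O (fun t => ham_xp (xi t) (x t)).
Proof.
move=> m j; rewrite (_ : (fun _ => _) = fun t => \sum_(i < k) (dpairing (Z i) (xi t) (x t) m * Z i (x t) 0 j
      + pairing (xi t) (Z i (x t)) * pd (fun v => Z i v 0 j) m (x t))
    + pd (fun v => Z0 v 0 j) m (x t)); last by apply/funext => t; rewrite mxE.
apply: (smooth1D oO); last exact: (comp (smf_pd m (sZ0 j))).
apply: (smooth1_sum oO) => i _; apply: (smooth1D oO); apply: (smooth1M oO).
- exact: (dpairs m (sZ i)).
- exact: (comp (sZ i j)).
- exact: (pair (sZ i)).
- exact: (comp (smf_pd m (sZ i j))).
Qed.

Lemma smx_ham_xx : smx O (fun t => ham_xx (xi t) (x t)).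
Proof.
move=> m j; rewrite (_ : (fun _ => _) = fun t => \sum_(i < k) (dpairing (Z i) (xi t) (x t) m * dpairing (Z i) (xi t) (x t) j
      + pairing (xi t) (Z i (x t)) * ddpairing (Z i) (xi t) (x t) m j)
    + ddpairing Z0 (xi t) (x t) m j + 2^-1 * pd (pd q j) m (x t)); last by apply/funext => t; rewrite mxE.
apply: (smooth1D oO); last first.
  by apply: (smooth1M oO); [exact: smooth1_cst|exact: (comp (smf_pd m (smf_pd j sq)))].
apply: (smooth1D oO); last exact: (ddpairs m j sZ0).
apply: (smooth1_sum oO) => i _; apply: (smooth1D oO); apply: (smooth1M oO).
- exact: (dpairs m (sZ i)).
- exact: (dpairs j (sZ i)).
- exact: (pair (sZ i)).
- exact: (ddpairs m j (sZ i)).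
Qed.

End SmoothAlong.

End LocalHamiltonian.

Lemma near_eq_isd {R : realType} (f g : R -> R) t d : (\near t, f t = g t) ->
  isd f t d -> isd g t d.
Proof.
move=> /nbhs_interior fg; have tO := nbhs_singleton fg.
apply: (eq_on_isd (open_interior _) _ tO).
by move=> s /set_mem /interior_subset.
Qed.

Lemma is_derive_entries {R : realType} {n : nat} (x : R -> 'rV[R]_n) (t : R) d :
  is_derive (t : R^o) (1 : R^o) (x : R^o -> 'rV[R]_n) d ->
  forall j, isd (fun s => x s 0 j) t (d 0 j).
Proof.
move=> [dx <-] j; split; first by rewrite dableE; move/derivable_mxP : dx => /(_ 0 j).
by rewrite derive_mx// mxE derive1E.
Qed.

(** * Hamilton's equations in an arbitrary chart *)

Section HamiltonCharts.
Context {R : realType} {n k : nat} {M : smoothManifold R n}.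
Variables (X0 : vfield M) (X : 'I_k -> vfield M) (Q : M -> R).
Hypotheses (gX0 : gvf setT X0) (gX : forall i, gvf setT (X i)).
Hypothesis sQ : forall a : chart M, smf (chart_map a @` dom a) (fun u => Q (param a u)).
Implicit Types (a b : chart M) (x : M).

Definition chart_ham_p a p u := ham_p (X0 a) (X^~ a) p u.
Definition chart_ham_x a p u := ham_x (X0 a) (X^~ a) (Q \o param a) p u.

Lemma gvf_dom (Z : vfield M) a j : gvf setT Z -> smf (chart_map a @` dom a) (fun u => Z a u 0 j).
Proof. by move=> [+ _] => /(_ a j); rewrite setIT. Qed.

Lemma dham_dpE a p u : dham_dp X0 X Q a p u = chart_ham_p a p u.
Proof. by apply/rowP => j; rewrite [LHS]mxE; exact: (ham_pE _ _ (Q \o param a)). Qed.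

Lemma dham_dxE a p u : (chart_map a @` dom a) u -> dham_dx X0 X Q a p u = chart_ham_x a p u.
Proof.
move=> au; apply/rowP => j; rewrite [LHS]mxE.
apply: (@ham_xE _ _ _ _ _ _ (Q \o param a) _ _ _ p u j au).
- by move=> l; apply: gvf_dom.
- by move=> i l; apply: gvf_dom.
- exact: sQ.
Qed.

Section ChangeOfChart.
Variables (a b : chart M) (x : M) (ax : dom a x) (bx : dom b x) (pa : 'rV[R]_n).
Let u := chart_map a x.
Let v := chart_map b x.
Let pb := pa *m (tmx b a x)^T.
Let K := tmx b a x.

Lemma pairing_chart (Z : vfield M) : gvf setT Z -> pairing pb (Z b v) = pairing pa (Z a u).
Proof.
move=> [_ tZ]; rewrite /pairing (tZ a b x)// trmx_mul mulmxA -(mulmxA pa) -trmx_mul.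
by rewrite tmxK// trmx1 mulmx1.
Qed.

Lemma chart_ham_pE : chart_ham_p b pb v = chart_ham_p a pa u *m tmx a b x.
Proof.
have [_ tX0] := gX0.
apply/rowP => j; rewrite [LHS]mxE [RHS]mxE (tX0 a b x)//.
under [X in X + _]eq_bigr => i _ do
  rewrite (pairing_chart (gX i)) (proj2 (gX i) a b x)// mxE mulr_sumr.
rewrite exchange_big [X in _ + X]mxE -big_split; apply: eq_bigr => l _ /=.
rewrite [X in _ = X * _]mxE mulrDl mulr_suml; congr (_ + _).
by apply: eq_bigr => i _; rewrite mulrA.
Qed.

(** The covector contracted with the second derivatives of the transition map, the inhomogeneous
    term in the transformation of dH/dx. *)
Let G m j := \sum_l pa 0 l * pd (pd (fun w => trans b a w 0 l) m) j v.

Lemma dpair_chart (Z : vfield M) j : gvf setT Z ->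
  dpairing (Z b) pb v j + \sum_m Z b v 0 m * G m j = \sum_m K j m * dpairing (Z a) pa u m.
Proof.
move=> gZ.
have e l := gvf_pd openT j l gZ (I : [set: M] x) bx ax.
transitivity (\sum_l pa 0 l * (\sum_m K j m * pd (fun w => Z a w 0 l) m u)); last first.
  transitivity (\sum_l \sum_m pa 0 l * (K j m * pd (fun w => Z a w 0 l) m u)).
    by apply: eq_bigr => l _; rewrite mulr_sumr.
  rewrite exchange_big; apply: eq_bigr => m _ /=; rewrite /dpairing mulr_sumr.
  by apply: eq_bigr => l _; rewrite mulrCA.
transitivity (\sum_l pa 0 l * (\sum_m (pd (fun w => Z b w 0 m) j v * K m l +
    Z b v 0 m * pd (pd (fun w => trans b a w 0 l) m) j v))); last first.
  by apply: eq_bigr => l _; rewrite e.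
transitivity (\sum_l \sum_m (pa 0 l * (pd (fun w => Z b w 0 m) j v * K m l) +
    pa 0 l * (Z b v 0 m * pd (pd (fun w => trans b a w 0 l) m) j v))); last first.
  by apply: eq_bigr => l _; rewrite mulr_sumr; apply: eq_bigr => m _; rewrite mulrDr.
rewrite exchange_big -big_split; apply: eq_bigr => m _ /=.
rewrite big_split/= /G mulr_sumr; congr (_ + _).
  rewrite /pb mxE mulr_suml; apply: eq_bigr => l _.
  by rewrite mxE -mulrA [X in _ = _ * X]mulrC.
by apply: eq_bigr => l _; rewrite mulrCA.
Qed.

Lemma Q_chart j : pd (Q \o param b) j v = \sum_m K j m * pd (Q \o param a) m u.
Proof.
have ov : overlap b a v by exists x.
have tv : trans b a v = u by rewrite /v trans_chart.
have dQ : differentiable ((Q \o param a) : _ -> R^o) (trans b a v).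
  by rewrite tv; apply: (smf_diff (sQ a)); exists x.
have := pd_comp j ov (trans_smf b a) dQ; rewrite tv => H.
transitivity (pd (fun w => (Q \o param a) (trans b a w)) j v); last first.
  by rewrite H; apply: eq_bigr => m _; rewrite /K tmxE.
apply: near_eq_pd; near=> w.
have [y [yb ya] <-] : overlap b a w.
  by near: w; apply: open_nbhs_nbhs; split => //; exact: open_overlap.
by rewrite /= trans_chart// !chart_mapK.
Unshelve. all: by end_near. Qed.

(** The derivative in the position of the invariance of the Hamiltonian: at fixed [pa], the
    components [pb] vary with the position through the Jacobian, which produces [G]. *)
Lemma chart_ham_xE j :
  chart_ham_x b pb v 0 j + \sum_m chart_ham_p b pb v 0 m * G m j = \sum_m K j m * chart_ham_x a pa u 0 m.
Proof.
transitivity (\sum_(i < k) pairing pa (X i a u) * (dpairing (X i b) pb v j + \sum_m X i b v 0 m * G m j)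
   + (dpairing (X0 b) pb v j + \sum_m X0 b v 0 m * G m j) + 2^-1 * pd (Q \o param b) j v).
  rewrite [X in X + _]mxE.
  under [X in X + _ + _ + _]eq_bigr => i _ do rewrite (pairing_chart (gX i)).
  under [X in _ = X + _ + _]eq_bigr => i _ do rewrite mulrDr.
  rewrite big_split/=.
  have -> : \sum_m chart_ham_p b pb v 0 m * G m j =
    \sum_(i < k) pairing pa (X i a u) * (\sum_m X i b v 0 m * G m j) + \sum_m X0 b v 0 m * G m j.
    have -> : \sum_(i < k) pairing pa (X i a u) * (\sum_m X i b v 0 m * G m j) =
        \sum_(i < k) \sum_m pairing pa (X i a u) * X i b v 0 m * G m j.
      by apply: eq_bigr => i _; rewrite mulr_sumr; apply: eq_bigr => m _; rewrite mulrA.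
    rewrite exchange_big -big_split; apply: eq_bigr => m _ /=.
    rewrite mxE mulrDl mulr_suml; congr (_ + _).
    by apply: eq_bigr => i _; rewrite (pairing_chart (gX i)).
  set A1 := \sum_(i < k) _; set A2 := \sum_(i < k) _.
  set B1 := dpairing _ _ _ _; set B2 := \sum_m _; set C := _ * pd _ _ _.
  by ring.
rewrite (dpair_chart j gX0) Q_chart.
under [X in X + _ + _]eq_bigr => i _ do rewrite (dpair_chart j (gX i)) mulr_sumr.
rewrite exchange_big/= mulr_sumr -!big_split; apply: eq_bigr => m _ /=.
rewrite [chart_ham_x a pa u 0 m]mxE 2!mulrDr; congr (_ + _ + _).
  by rewrite mulr_sumr; apply: eq_bigr => i _; rewrite mulrCA.
by rewrite mulrCA.
Qed.

Lemma second_transition_sym m j : G m j = G j m.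
Proof.
have cg (f g : 'I_n -> R) : (forall l, f l = g l) ->
    \sum_l pa 0 l * f l = \sum_l pa 0 l * g l.
  by move=> fg; apply: eq_bigr => l _; rewrite fg.
have ov : overlap b a v by exists x.
apply: (cg (fun l => pd (pd (fun w => trans b a w 0 l) m) j v)
  (fun l => pd (pd (fun w => trans b a w 0 l) j) m v)) => l.
exact: (pd_comm m j (open_overlap (a:=b) (b:=a)) ov (trans_smf b a l)).
Qed.

End ChangeOfChart.

Lemma ct_coord1 b (z : cotangent M) : (ct_coord b z).1 = chart_map b z.1.
Proof. by []. Qed.

Lemma ct_coord2 b (z : cotangent M) : (ct_coord b z).2 = z.2 *m (tmx b (chart_at z.1) z.1)^T.
Proof. by []. Qed.

Lemma ct_coord2_chart a b (z : cotangent M) : dom a z.1 -> dom b z.1 ->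
  (ct_coord b z).2 = (ct_coord a z).2 *m (tmx b a z.1)^T.
Proof.
move=> az bz; have cz := dom_chart_at z.1.
apply: (etrans (ct_coord2 b z)); apply/esym.
apply: (etrans (congr1 (fun p => p *m (tmx b a z.1)^T) (ct_coord2 a z))).
apply: (etrans (esym (mulmxA _ _ _))); apply: (congr1 (fun N => z.2 *m N)).
apply: (etrans (esym (trmx_mul _ _))); apply: (congr1 trmx).
exact: (esym (tmx_comp bz az cz)).
Qed.

(** [hamilton_at] uses the chart selected at the current point, which may change with time, whereas
    linearization takes place in a fixed chart. The inhomogeneous term cancels against the
    derivative of the Jacobian along the curve. *)
Lemma hamilton_chart (z : R -> cotangent M) t b : hamilton_at X0 X Q z t -> dom b (z t).1 ->
  let x s := (ct_coord b (z s)).1 in let p s := (ct_coord b (z s)).2 in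
  (forall j, isd (fun s => x s 0 j) t (chart_ham_p b (p t) (x t) 0 j)) /\
  (forall j, isd (fun s => p s 0 j) t (- chart_ham_x b (p t) (x t) 0 j)).
Proof.
set y := (z t).1; set a := chart_at y => -[cz Hx Hp] bx /=.
have ax : dom a y by exact: dom_chart_at.
have oab : open (dom a `&` dom b) by apply: openI; exact: open_dom.
have nab : \near t, (dom a `&` dom b) (z t).1.
  by apply: cz; apply: open_nbhs_nbhs; split.
set xa := fun s => (ct_coord a (z s)).1 in Hx.
set pa := fun s => (ct_coord a (z s)).2 in Hp.
have {}Hx j : isd (fun s => xa s 0 j) t (chart_ham_p a (pa t) (xa t) 0 j).
  by rewrite -dham_dpE; exact: is_derive_entries.
have {}Hp j : isd (fun s => pa s 0 j) t (- chart_ham_x a (pa t) (xa t) 0 j).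
  have -> : - chart_ham_x a (pa t) (xa t) 0 j = (- dham_dx X0 X Q a (pa t) (xa t)) 0 j.
    have au : (chart_map a @` dom a) (xa t) by exists y.
    by rewrite (dham_dxE _ au) [RHS]mxE.
  exact: is_derive_entries.
set xb := fun s => (ct_coord b (z s)).1; set pb := fun s => (ct_coord b (z s)).2.
have xbt : xb t = chart_map b y by [].
have xat : xa t = chart_map a y by [].
have pbt : pb t = pa t *m (tmx b a y)^T by exact: ct_coord2_chart.
have Hxb j : isd (fun s => xb s 0 j) t (chart_ham_p b (pb t) (xb t) 0 j).
  apply: (@near_eq_isd _ (fun s => trans a b (xa s) 0 j)).
    near=> s; have [az bz] : (dom a `&` dom b) (z s).1 by near: s.
    by rewrite [xa s]ct_coord1 trans_chart.
  have dt : differentiable ((fun w => trans a b w 0 j) : _ -> R^o) (xa t).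
    by apply: (smf_diff (trans_smf a b j)); exists y.
  apply: (isd_eq (isd_comp dt Hx)).
  rewrite pbt xbt chart_ham_pE// mxE; apply: eq_bigr => l _.
  by rewrite tmxE.
split=> [j|j]; first exact: Hxb.
apply: (@near_eq_isd _ (fun s => \sum_l pa s 0 l * pd (fun w => trans b a w 0 l) j (xb s))).
  near=> s; have [az bz] : (dom a `&` dom b) (z s).1 by near: s.
  have e : pb s = pa s *m (tmx b a (z s).1)^T by exact: ct_coord2_chart.
  apply: (etrans _ (congr1 (fun p : 'rV[R]_n => p 0 j) (esym e))).
  rewrite [RHS]mxE; apply: eq_bigr => l _.
  by rewrite [(_)^T _ _]mxE tmxE.
have Hl l : isd (fun s => pd (fun w => trans b a w 0 l) j (xb s)) t
    (\sum_m chart_ham_p b (pb t) (xb t) 0 m * pd (pd (fun w => trans b a w 0 l) j) m (xb t)).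
  apply: (isd_comp _ Hxb); apply: (smf_diff (smf_pd j (trans_smf b a l))).
  by exists y.
apply: (isd_eq (isd_sum (index_enum 'I_n) (P := xpredT) (fun l _ => isdM (Hp l) (Hl l)))).
pose G m := \sum_l pa t 0 l * pd (pd (fun w => trans b a w 0 l) j) m (xb t).
have E : chart_ham_x b (pb t) (xb t) 0 j = \sum_m tmx b a y j m * chart_ham_x a (pa t) (xa t) 0 m -
   \sum_m chart_ham_p b (pb t) (xb t) 0 m * G m.
  have H := chart_ham_xE ax bx (pa t) j; rewrite -pbt in H.
  apply: (canRL (addrK _)); apply: (etrans _ H).
  apply: (congr1 (fun c => chart_ham_x b (pb t) (xb t) 0 j + c)).
  apply: eq_bigr => m _; apply: (congr1 (fun c => chart_ham_p b (pb t) (xb t) 0 m * c)).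
  exact: (second_transition_sym ax bx (pa t) j m).
apply: (etrans _ (congr1 -%R (esym E))).
have gen (F T p h : 'I_n -> R) (D : 'I_n -> 'I_n -> R) :
    \sum_l (- F l * T l + p l * \sum_m h m * D l m) =
    - (\sum_m T m * F m - \sum_m h m * \sum_l p l * D l m).
  rewrite big_split/= opprB [RHS]addrC -sumrN; congr (_ + _).
    by apply: eq_bigr => l _; rewrite mulNr mulrC.
  under eq_bigr do rewrite mulr_sumr.
  rewrite exchange_big; apply: eq_bigr => m _ /=; rewrite mulr_sumr.
  by apply: eq_bigr => l _; rewrite mulrCA.
apply: (etrans (gen (chart_ham_x a (pa t) (xa t) 0) (fun l => pd (fun w => trans b a w 0 l) j (xb t))
  (pa t 0) (chart_ham_p b (pb t) (xb t) 0)
  (fun l m => pd (pd (fun w => trans b a w 0 l) j) m (xb t)))).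
apply: (congr1 (fun c => - (c - _))); apply: eq_bigr => l _.
apply: (congr1 (fun c => c * _)); apply: esym; exact: tmxE.
Unshelve. all: by end_near. Qed.

End HamiltonCharts.

Lemma smooth1_ext {R : realType} (O : set R) (f g : R -> R) : f =1 g ->
  smooth1 O f -> smooth1 O g.
Proof. by move=> /funext ->. Qed.

Lemma isd_ext {R : realType} (f g : R -> R) t d : f =1 g -> isd f t d -> isd g t d.
Proof. by move=> /funext ->. Qed.

(** * Derivative of the flow with respect to the initial covector *)

Section LinearizedFlow.
Context {R : realType} {n k : nat} {M : smoothManifold R n}.
Variables (X0 : vfield M) (X : 'I_k -> vfield M) (Q : M -> R).
Hypotheses (gX0 : gvf setT X0) (gX : forall i, gvf setT (X i)).
Hypothesis sQ : forall a : chart M, smf (chart_map a @` dom a) (fun u => Q (param a u)).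
Variables (dPhi : set (R * cotangent M)) (Phi : R -> cotangent M -> cotangent M).
Hypothesis Phi_flow : hamiltonian_flow X0 X Q dPhi Phi.
Variables (lam : cotangent M).
Let a := chart_at lam.1.
Let u0 := chart_map a lam.1.
Let p0 := lam.2.

Let Y : normedModType R := (R^o * ('rV[R]_n * 'rV[R]_n))%type.

Definition Psi (y : Y) := ct_coord a (Phi y.1 (ct_param a y.2)).

Definition flow_domain (A : set Y) := [/\ open A, A (0, (u0, p0)),
  forall y, A y -> dPhi (y.1, ct_param a y.2) /\ dom a (Phi y.1 (ct_param a y.2)).1 &
  smooth_on A Psi].

Let alam : dom a lam.1 := dom_chart_at lam.1.

Lemma ct_param_fiber p : ct_param a (u0, p) = (lam.1, p).
Proof.
have pu : param a u0 = lam.1 by exact: chart_mapK.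
have e := tmx_id alam.
rewrite /ct_param /=; rewrite pu.
apply: (congr1 (fun q => (lam.1, q))).
apply: (etrans (congr1 (fun N : 'M[R]_n => p *m N^T) e)).
by rewrite trmx1 mulmx1.
Qed.

Lemma ct_coord_fiber p : ct_coord a (lam.1, p) = (u0, p).
Proof.
apply: (congr1 (fun q => (u0, q))).
apply: (etrans (congr1 (fun N : 'M[R]_n => p *m N^T) (tmx_id alam))).
by rewrite trmx1 mulmx1.
Qed.

Lemma Psi_fiber t p : Psi (t, (u0, p)) = ct_coord a (Phi t (lam.1, p)).
Proof. by rewrite /Psi /= ct_param_fiber. Qed.

Lemma flow_domain_exists : exists A, flow_domain A.
Proof.
have [d0 P0] := flow_init Phi_flow lam.
have aP : dom a (Phi 0 lam).1 by rewrite P0.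
have [A [oA A0 HA sA]] := flow_smooth Phi_flow d0 alam aP.
exists A; split=> //.
  have e : ct_coord a lam = (u0, p0).
    by rewrite -ct_coord_fiber /p0; case: (lam).
  by rewrite -e.
by move=> [s w] /HA[].
Qed.

Variables (A : set Y) (HA : flow_domain A).

Let oA : open A. Proof. by case: HA. Qed.

(** The direction of time; [eps i] is that of a component of the initial covector. *)
Let h : Y := (1, (0, 0)).
Let eps (i : 'I_n) : Y := (0, (0, delta_mx 0 i)).

Let Psi1 j (y : Y) := (Psi y).1 0 j.
Let Psi2 j (y : Y) := (Psi y).2 0 j.

Let sPsi1 j : smf A (Psi1 j).
Proof. by case: HA => _ _ _ /(smf_entry1 0 j oA). Qed.

Let sPsi2 j : smf A (Psi2 j).
Proof. by case: HA => _ _ _ /(smf_entry2 0 j oA). Qed.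

Let lineh (y : Y) s : ((0, y.2) : Y) + s *: h = (s, y.2).
Proof.
case: y => t [u p] /=.
rewrite /h; congr (_, (_, _)) => /=.
- by rewrite add0r; exact: mulr1.
- by rewrite scaler0 addr0.
- by rewrite scaler0 addr0.
Qed.

Let APsi y : A y -> (chart_map a @` dom a) (Psi y).1.
Proof. by move=> Ay; case: HA => _ _ /(_ _ Ay)[_ ad] _; eexists; first exact: ad. Qed.

Lemma Psi_hamilton y j : A y ->
  isd (fun s => Psi1 j (s, y.2)) y.1 (chart_ham_p X0 X a (Psi y).2 (Psi y).1 0 j) /\
  isd (fun s => Psi2 j (s, y.2)) y.1 (- chart_ham_x X0 X Q a (Psi y).2 (Psi y).1 0 j).
Proof.
move=> Ay; case: HA => _ _ /(_ _ Ay)[dy ady] _.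
have [H1 H2] := hamilton_chart gX0 gX sQ (flow_hamilton Phi_flow dy) ady.
by split; [exact: H1|exact: H2].
Qed.

Let Dh1 y j : A y -> 'D_h (Psi1 j : Y -> R^o) y = chart_ham_p X0 X a (Psi y).2 (Psi y).1 0 j.
Proof.
move=> Ay; have [H _] := Psi_hamilton j Ay.
have Ay' : A ((0, y.2) + y.1 *: h) by rewrite lineh; case: (y) Ay.
have L := isd_line (sPsi1 j) Ay'.
have e : (fun s => Psi1 j ((0, y.2) + s *: h)) = fun s => Psi1 j (s, y.2).
  by apply/funext => s; rewrite lineh.
rewrite e lineh in L; have := isd_unique L H.
by case: (y).
Qed.

Let Dh2 y j : A y -> 'D_h (Psi2 j : Y -> R^o) y = - chart_ham_x X0 X Q a (Psi y).2 (Psi y).1 0 j.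
Proof.
move=> Ay; have [_ H] := Psi_hamilton j Ay.
have Ay' : A ((0, y.2) + y.1 *: h) by rewrite lineh; case: (y) Ay.
have L := isd_line (sPsi2 j) Ay'.
have e : (fun s => Psi2 j ((0, y.2) + s *: h)) = fun s => Psi2 j (s, y.2).
  by apply/funext => s; rewrite lineh.
rewrite e lineh in L; have := isd_unique L H.
by case: (y).
Qed.

Definition geo_x t := chart_map a (Phi t lam).1.
Definition geo_p t := (ct_coord a (Phi t lam)).2.

Definition fiber_dx t : 'M[R]_n := \matrix_(i, j) 'D_(eps i) (Psi1 j : Y -> R^o) (t, (u0, p0)).
Definition fiber_dp t : 'M[R]_n := \matrix_(i, j) 'D_(eps i) (Psi2 j : Y -> R^o) (t, (u0, p0)).

Let Psi_geo t : Psi (t, (u0, p0)) = (geo_x t, geo_p t).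
Proof. by rewrite Psi_fiber /p0 /geo_x /geo_p; case: (lam). Qed.

Variables (O : set R) (oO : open O).
Hypothesis OA : forall t, O t -> A (t, (u0, p0)).

Let along f : smf A f -> smooth1 O (fun t => f (t, (u0, p0))).
Proof.
move=> sf; have -> : (fun t => f (t, (u0, p0))) = fun t : R => f ((0, (u0, p0)) + t *: h).
  by apply/funext => t; rewrite (lineh (0, (u0, p0))).
apply: (smooth1_line (A := A) oO) => // t Ot.
by rewrite (lineh (0, (u0, p0))); exact: OA.
Qed.

Lemma smx_geo_x : smx O geo_x.
Proof.
move=> i j; rewrite ord1; apply: (smooth1_ext _ (along (sPsi1 j))) => t.
exact: (congr1 (fun z : 'rV[R]_n * 'rV[R]_n => z.1 0 j) (Psi_geo t)).
Qed.

Lemma smx_geo_p : smx O geo_p.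
Proof.
move=> i j; rewrite ord1; apply: (smooth1_ext _ (along (sPsi2 j))) => t.
exact: (congr1 (fun z : 'rV[R]_n * 'rV[R]_n => z.2 0 j) (Psi_geo t)).
Qed.

Lemma isd_geo_x t j : O t -> isd (fun s => geo_x s 0 j) t (chart_ham_p X0 X a (geo_p t) (geo_x t) 0 j).
Proof.
move=> Ot; have [H _] := Psi_hamilton j (OA Ot).
apply: (isd_eq (isd_ext _ H)) => [s|].
  exact: (congr1 (fun z : 'rV[R]_n * 'rV[R]_n => z.1 0 j) (Psi_geo s)).
exact: (congr1 (fun z : 'rV[R]_n * 'rV[R]_n => chart_ham_p X0 X a z.2 z.1 0 j) (Psi_geo t)).
Qed.

Let lin_xp t := ham_xp (X0 a) (X^~ a) (geo_p t) (geo_x t).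
Let lin_pp t := ham_pp (X^~ a) (geo_x t).
Let lin_xx t := ham_xx (X0 a) (X^~ a) (Q \o param a) (geo_p t) (geo_x t).

(** By Schwarz, the time derivative of a fibre derivative is the fibre derivative of the time
    derivative, which Hamilton's equations give as [F] on [A]. *)
Let swap f F i t : smf A f -> (forall y, A y -> 'D_h (f : Y -> R^o) y = F y) -> O t ->
  forall d, isd (fun s => F ((t, (u0, p0)) + s *: eps i)) 0 d ->
  isd (fun t => 'D_(eps i) (f : Y -> R^o) (t, (u0, p0))) t d.
Proof.
move=> sf Df Ot d Hd; have At := OA Ot.
have E0 : ((t, (u0, p0)) : Y) + 0 *: eps i = (t, (u0, p0)) by rewrite scale0r addr0.
have At' : A ((0, (u0, p0)) + t *: h) by rewrite (lineh (0, (u0, p0))).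
have := isd_line (smf_D (eps i) sf) At'.
have -> : (fun s : R => 'D_(eps i) (f : Y -> R^o) ((0, (u0, p0)) + s *: h)) =
    fun s => 'D_(eps i) (f : Y -> R^o) (s, (u0, p0)).
  by apply/funext => s; rewrite (lineh (0, (u0, p0))).
rewrite (lineh (0, (u0, p0))) /=; move=> H; apply: (isd_eq H).
apply: (etrans (schwarz oA At (eps i) h sf)).
have At0 : A ((t, (u0, p0)) + 0 *: eps i) by rewrite E0.
have L := isd_line (smf_D h sf) At0; rewrite E0 in L.
(* [Df] is available on [A] only, hence along the line for small parameters, which is enough to
   differentiate. *)
have N : \forall s \near (0 : R), 'D_h (f : Y -> R^o) ((t, (u0, p0)) + s *: eps i) =
    F ((t, (u0, p0)) + s *: eps i).
  have [r r0 Hpl] := plane_near (eps i) (eps i) (open_nbhs_nbhs (conj oA At)).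
  near=> s; apply: Df.
  have sr : `|s| < r by near: s; apply/nbhs_ballP; exists r => //= x; rewrite /ball /= sub0r normrN.
  by have := Hpl s 0 sr; rewrite scale0r addr0 normr0; apply.
exact: (isd_unique (near_eq_isd N L) Hd).
Unshelve. all: by end_near. Qed.

Let vline t i s : ((t, (u0, p0)) : Y) + s *: eps i = (t, (u0, p0 + s *: delta_mx 0 i)).
Proof.
rewrite /eps; congr (_, (_, _)) => /=.
- by apply: (etrans _ (addr0 _)); congr (_ + _); exact: mulr0.
- by rewrite scaler0 addr0.
Qed.

Let curve1 t i j : O t -> isd (fun s => (Psi ((t, (u0, p0)) + s *: eps i)).1 0 j) 0 (row i (fiber_dx t) 0 j).
Proof.
move=> Ot; have E0 : ((t, (u0, p0)) : Y) + 0 *: eps i = (t, (u0, p0)) by rewrite scale0r addr0.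
have At0 : A ((t, (u0, p0)) + 0 *: eps i) by rewrite E0; exact: OA.
have L := isd_line (sPsi1 j) At0; rewrite E0 in L.
by apply: (isd_eq L); rewrite mxE mxE.
Qed.

Let curve2 t i j : O t -> isd (fun s => (Psi ((t, (u0, p0)) + s *: eps i)).2 0 j) 0 (row i (fiber_dp t) 0 j).
Proof.
move=> Ot; have E0 : ((t, (u0, p0)) : Y) + 0 *: eps i = (t, (u0, p0)) by rewrite scale0r addr0.
have At0 : A ((t, (u0, p0)) + 0 *: eps i) by rewrite E0; exact: OA.
have L := isd_line (sPsi2 j) At0; rewrite E0 in L.
by apply: (isd_eq L); rewrite mxE mxE.
Qed.

Let P0 t i : Psi ((t, (u0, p0)) + 0 *: eps i) = (geo_x t, geo_p t).
Proof.
have E0 : ((t, (u0, p0)) : Y) + 0 *: eps i = (t, (u0, p0)) by rewrite scale0r addr0.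
by rewrite E0 Psi_geo.
Qed.

Let Wgeo t i : O t -> (chart_map a @` dom a) (Psi ((t, (u0, p0)) + 0 *: eps i)).1.
Proof.
move=> Ot; have E0 : ((t, (u0, p0)) : Y) + 0 *: eps i = (t, (u0, p0)) by rewrite scale0r addr0.
by rewrite E0; apply: APsi; exact: OA.
Qed.

Lemma isd_fiber_dx t i j : O t ->
  isd (fun s => fiber_dx s i j) t ((fiber_dx t *m lin_xp t + fiber_dp t *m lin_pp t) i j).
Proof.
move=> Ot.
have sX0 l : smf (chart_map a @` dom a) (fun u => X0 a u 0 l) by exact: gvf_dom.
have sX i' l : smf (chart_map a @` dom a) (fun u => X i' a u 0 l) by exact: gvf_dom.
have D := isd_ham_p sX0 sX
  (x := fun s => (Psi ((t, (u0, p0)) + s *: eps i)).1) (xi := fun s => (Psi ((t, (u0, p0)) + s *: eps i)).2)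
  (Wgeo i Ot) (fun j => curve1 i j Ot) (fun j => curve2 i j Ot) j.
apply: (isd_ext (f := fun s => 'D_(eps i) (Psi1 j : Y -> R^o) (s, (u0, p0)))).
  by move=> s; rewrite [RHS]mxE.
apply: (@swap (Psi1 j) (fun y => chart_ham_p X0 X a (Psi y).2 (Psi y).1 0 j) i t (sPsi1 j)) => //.
  by move=> y; exact: Dh1.
apply: (isd_eq D).
rewrite P0 /=; rewrite [LHS]mxE [RHS]mxE; congr (_ + _).
  by rewrite -row_mul mxE.
by rewrite -row_mul mxE.
Qed.

Lemma isd_fiber_dp t i j : O t ->
  isd (fun s => fiber_dp s i j) t ((- (fiber_dx t *m lin_xx t) - fiber_dp t *m (lin_xp t)^T) i j).
Proof.
move=> Ot.
have sX0 l : smf (chart_map a @` dom a) (fun u => X0 a u 0 l) by exact: gvf_dom.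
have sX i' l : smf (chart_map a @` dom a) (fun u => X i' a u 0 l) by exact: gvf_dom.
have D := isd_ham_x (q := Q \o param a) sX0 sX (sQ a)
  (x := fun s => (Psi ((t, (u0, p0)) + s *: eps i)).1) (xi := fun s => (Psi ((t, (u0, p0)) + s *: eps i)).2)
  (Wgeo i Ot) (fun j => curve1 i j Ot) (fun j => curve2 i j Ot) j.
apply: (isd_ext (f := fun s => 'D_(eps i) (Psi2 j : Y -> R^o) (s, (u0, p0)))).
  by move=> s; rewrite [RHS]mxE.
apply: (@swap (Psi2 j) (fun y => - chart_ham_x X0 X Q a (Psi y).2 (Psi y).1 0 j) i t (sPsi2 j)) => //.
  by move=> y; exact: Dh2.
apply: (isd_eq (isdN D)).
rewrite P0 /=; rewrite [X in - X]mxE -opprD [RHS]mxE [X in _ = - X]mxE; congr (- (_ + _)).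
  by rewrite -row_mul mxE.
by rewrite -row_mul mxE.
Qed.

Let fiber (t : R) (p : 'rV[R]_n) : Y := (t, (u0, p)).

Let fiber_diff t : differentiable (fiber t) p0.
Proof.
apply: differentiable_pair; first exact: differentiable_cst.
apply: differentiable_pair; first exact: differentiable_cst.
exact: (@linear_differentiable _ _ _ idfun p0 (fun x => cvg_id)).
Qed.

Lemma Psi_fiber_differentiable t : O t ->
  differentiable (fun p => (Psi (fiber t p)).1) p0.
Proof.
move=> Ot; have dP : differentiable Psi (fiber t p0).
  by case: HA => _ _ _ /(_ 1%N)[+ _]; apply; exact: OA.
have d1 : differentiable (fun p => Psi (fiber t p)) p0.
  exact: (differentiable_comp (fiber_diff t) dP).
have df : differentiable (fst : 'rV[R]_n * 'rV[R]_n -> 'rV[R]_n) (Psi (fiber t p0)).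
  by apply: linear_differentiable => z; exact: cvg_fst.
exact: (differentiable_comp d1 df).
Qed.

Lemma near_fiber_domain t : O t -> \forall p \near p0, A (fiber t p).
Proof.
move=> Ot; have c := differentiable_continuous (fiber_diff t).
by apply: c; apply: open_nbhs_nbhs; split=> //; exact: OA.
Qed.

Lemma jacobian_Psi_fiber t : O t -> jacobian (fun p => (Psi (fiber t p)).1) p0 = fiber_dx t.
Proof.
move=> Ot; apply/matrixP => i j.
apply: (etrans (jacobianE i j (Psi_fiber_differentiable Ot))).
have e : (fun s => (Psi ((t, (u0, p0)) + s *: eps i)).1 0 j) =1
    (fun s => (Psi (fiber t (p0 + s *: delta_mx 0 i))).1 0 j).
  by move=> s; rewrite vline.
have C := isd_ext e (curve1 i j Ot).
apply: (etrans (pd_line _ _ _)); apply: (etrans (proj2 C)).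
by rewrite mxE.
Qed.

Hypothesis O0 : O 0.

Let Psi0 p : Psi (0, (u0, p)) = (u0, p).
Proof.
rewrite Psi_fiber; have [_ ->] := flow_init Phi_flow (lam.1, p).
exact: ct_coord_fiber.
Qed.

Lemma fiber_dx0 : fiber_dx 0 = 0.
Proof.
apply/matrixP => i j; rewrite [RHS]mxE.
have C : isd (fun s => (Psi ((0, (u0, p0)) + s *: eps i)).1 0 j) 0 0.
  apply: (isd_ext _ (isd_cst (u0 0 j) 0)) => s.
  by rewrite vline Psi0.
by have := isd_unique (curve1 i j O0) C; rewrite mxE.
Qed.

Lemma fiber_dp0 : fiber_dp 0 = 1%:M.
Proof.
apply/matrixP => i j; rewrite [RHS]mxE.
have C : isd (fun s => (Psi ((0, (u0, p0)) + s *: eps i)).2 0 j) 0 (i == j)%:R.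
  have E : (fun s : R => p0 0 j + s * (i == j)%:R) =1 (fun s => (Psi ((0, (u0, p0)) + s *: eps i)).2 0 j).
    by move=> s; rewrite vline Psi0 /= !mxE eqxx /= eq_sym.
  apply: (isd_ext E).
  apply: (isd_eq (isdD (isd_cst _ _) (isdM (_ : isd id 0 1) (isd_cst _ _)))).
    by split; [rewrite dableE; exact: derivable_id|rewrite derive1_id].
  by rewrite /= mulr0 addr0 add0r mul1r.
by have := isd_unique (curve2 i j O0) C; rewrite mxE.
Qed.

End LinearizedFlow.

(** * Frame components and the flag *)

Section FrameComponents.
Context {R : realType} {n : nat} {M : smoothManifold R n}.
Variables (a : chart M) (gam : R -> M) (O : set R) (oO : open O).
Variables (U : set M) (oU : open U) (Y : 'I_n -> vfield M).
Let gx t := chart_map a (gam t).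
Hypothesis agam : forall t, O t -> dom a (gam t).
Hypothesis Ugam : forall t, O t -> U (gam t).
Hypothesis sgx : smx O gx.
Hypothesis gY : forall i, gvf U (Y i).
Hypothesis Y_basis : forall x, U x -> frame_mx Y x \in unitmx.

Definition fmx {p} (Z : 'I_p -> vfield M) u : 'M[R]_(p, n) := \matrix_i Z i a u.

Lemma fmxE {p} (Z : 'I_p -> vfield M) u i j : fmx Z u i j = Z i a u 0 j.
Proof. by rewrite mxE. Qed.

Lemma frame_mx_chart {p} (Z : 'I_p -> vfield M) x : (forall i, gvf U (Z i)) ->
  U x -> dom a x -> frame_mx Z x = fmx Z (chart_map a x) *m tmx a (chart_at x) x.
Proof.
move=> gZ Ux ax; apply/row_matrixP => i; rewrite row_mul 2!rowK /ev.
have [_ tZ] := gZ i; exact: tZ (dom_chart_at x).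
Qed.

Let Ugx t : O t -> (chart_map a @` (dom a `&` U)) (gx t).
Proof. by move=> Ot; exists (gam t) => //; split; [exact: agam|exact: Ugam]. Qed.

Lemma smx_fmx {p} (Z : 'I_p -> vfield M) : (forall i, gvf U (Z i)) ->
  smx O (fun t => fmx Z (gx t)).
Proof.
move=> gZ i j; have [sZ _] := gZ i.
apply: (smooth1_ext (f := fun t => Z i a (gx t) 0 j)) => [t|].
  by rewrite fmxE.
exact: (smooth1_comp oO (sZ a j) Ugx sgx).
Qed.

Definition ymx t := fmx Y (gx t).

Lemma ymx_unit t : O t -> ymx t \in unitmx.
Proof.
move=> Ot; have := Y_basis (Ugam Ot).
rewrite (frame_mx_chart gY (Ugam Ot) (agam Ot)) unitmx_mul => /andP[+ _].
by [].
Qed.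

Lemma smx_ymx : smx O ymx. Proof. exact: smx_fmx. Qed.

Lemma smx_inv_ymx : smx O (fun t => invmx (ymx t)).
Proof. by apply: (smx_inv oO); [exact: ymx_unit|exact: smx_ymx]. Qed.

Definition zcm {p} (Z : 'I_p -> vfield M) t : 'M[R]_(p, n) := fmx Z (gx t) *m invmx (ymx t).

Lemma smx_zcm {p} (Z : 'I_p -> vfield M) : (forall i, gvf U (Z i)) -> smx O (zcm Z).
Proof. by move=> gZ; apply: (smxM oO); [exact: smx_fmx|exact: smx_inv_ymx]. Qed.

(** The Jacobian to the chart selected at [gam t] cancels: components in the frame [Y] can be
    computed in the fixed chart [a]. *)
Lemma ycomp_frame {p} (Z : 'I_p -> vfield M) t : (forall i, gvf U (Z i)) -> O t ->
  ycomp gam Y t (frame_mx Z (gam t)) = zcm Z t.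
Proof.
move=> gZ Ot; have Ug := Ugam Ot; have ag := agam Ot.
have ty := tmx_unit ag (dom_chart_at (gam t)).
have iy : frame_mx Y (gam t) = ymx t *m tmx a (chart_at (gam t)) (gam t).
  exact: frame_mx_chart gY Ug ag.
have iz : frame_mx Z (gam t) = fmx Z (gx t) *m tmx a (chart_at (gam t)) (gam t).
  exact: frame_mx_chart gZ Ug ag.
rewrite /ycomp iy iz.
have yu := ymx_unit Ot.
apply: (can_inj (mulmxK (_ : ymx t *m tmx a (chart_at (gam t)) (gam t) \in unitmx))).
  by rewrite unitmx_mul yu ty.
move: ty; move: (tmx _ _ _) => J ty.
rewrite mulmxKV ?unitmx_mul ?yu//.
by rewrite /zcm mulmxA mulmxKV.
Qed.

Lemma ev_frame1 (Z : vfield M) x : ev Z x = frame_mx (fun _ : 'I_1 => Z) x.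
Proof. by apply/rowP => j; rewrite [RHS]mxE. Qed.

Variable T : vfield M.
Hypothesis gT : gvf U T.
Hypothesis gx_der : forall t j, O t -> isd (fun s => gx s 0 j) t (T a (gx t) 0 j).

Definition tau t : 'M[R]_n := \matrix_(l, j) pd (fun v => T a v 0 j) l (gx t).

(* Chosen so that nab clam is the Lie derivative along T in the components of Y. *)
Definition clam t : 'M[R]_n := (dmx ymx t - ymx t *m tau t) *m invmx (ymx t).

Lemma smx_tau : smx O tau.
Proof.
move=> l j; have [sT _] := gT.
apply: (smooth1_ext (f := fun t => pd (fun v => T a v 0 j) l (gx t))) => [t|].
  by rewrite [RHS]mxE.
exact: (smooth1_comp oO (smf_pd l (sT a j)) Ugx sgx).
Qed.

Lemma smx_clam : smx O clam.
Proof.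
apply: (smxM oO); last exact: smx_inv_ymx.
apply: (smxB oO); first by apply: smx_dmx; exact: smx_ymx.
by apply: (smxM oO); [exact: smx_ymx|exact: smx_tau].
Qed.

Lemma nab_conj {p} (V : R -> 'M[R]_(p, n)) t : smx O V -> O t ->
  nab clam (fun s => V s *m invmx (ymx s)) t = (dmx V t - V t *m tau t) *m invmx (ymx t).
Proof.
move=> sV Ot; rewrite /nab (dmxM sV smx_inv_ymx Ot) (dmx_inv oO ymx_unit smx_ymx Ot).
have yu := ymx_unit Ot.
have e : V t *m invmx (ymx t) *m clam t =
    V t *m (invmx (ymx t) *m dmx ymx t *m invmx (ymx t)) - V t *m tau t *m invmx (ymx t).
  by rewrite /clam mulmxBl mulmxBr !mulmxA (mulmxKV yu (V t)).
rewrite e mulmxN [RHS]mulmxBl.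
by rewrite addrA subrK.
Qed.

(** The curve has velocity [T], so [dmx] differentiates the fields of [Z] along [T], and [tau]
    supplies the derivative of [T] along them: the two terms of the bracket. *)
Lemma nab_zcm {p} (Z : 'I_p -> vfield M) t : (forall i, gvf U (Z i)) -> O t ->
  nab clam (zcm Z) t = zcm (fun i => lie T (Z i)) t.
Proof.
move=> gZ Ot; apply: (etrans (nab_conj (smx_fmx gZ) Ot)).
apply: (congr1 (fun N => N *m invmx (ymx t))); apply/matrixP => i j.
have [sZ _] := gZ i.
have H := isd_comp (smf_diff (sZ a j) (Ugx Ot)) (fun j => gx_der j Ot).
rewrite fmxE (lieE j gT (gZ i) (Ugx Ot)) [LHS]mxE [X in X + _]mxE.
have -> : (fun s => fmx Z (gx s) i j) = fun s => Z i a (gx s) 0 j.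
  by apply/funext => s; rewrite fmxE.
have [_ ->] := H; rewrite [X in _ + X]mxE [X in _ - X]mxE sumrB; congr (_ - _).
by apply: eq_bigr => l _; rewrite fmxE [tau _ _ _]mxE.
Qed.

Lemma gvf_iter (Z : vfield M) j : gvf U Z -> gvf U (iter j (lie T) Z).
Proof. by move=> gZ; elim: j => //= j IH; exact: (lie_gvf oU gT IH). Qed.

Lemma eq_on_nab {p} (V W : R -> 'M[R]_(p, n)) t : {in O, V =1 W} -> O t ->
  nab clam V t = nab clam W t.
Proof. by move=> VW Ot; rewrite /nab (eq_on_dmx oO VW Ot) VW// inE. Qed.

Lemma njet_zcm {k} (X : 'I_k -> vfield M) (D : R -> 'M[R]_(k, n)) j t :
  (forall i, gvf U (X i)) -> {in O, D =1 zcm X} -> O t ->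
  njet D clam j t = zcm (fun i => iter j (lie T) (X i)) t.
Proof.
move=> gX DX; elim: j t => [|j IH] t Ot; first by rewrite /= DX// inE.
have IH' : {in O, njet D clam j =1 zcm (fun i => iter j (lie T) (X i))}.
  by move=> s /set_mem; exact: IH.
rewrite /= (eq_on_nab IH' Ot) nab_zcm// => i; exact: gvf_iter.
Qed.

End FrameComponents.

(** * Iterated Lie derivatives of sections of the distribution *)

Section JetCombinations.
Context {R : realType} {n k : nat}.
Variables (O : set R) (oO : open O) (D : R -> 'M[R]_(k, n)) (Lam : R -> 'M[R]_n).
Hypotheses (sD : smx O D) (sLam : smx O Lam).

Lemma nab_sum {p} N (F : nat -> R -> 'M[R]_(p, n)) t : (forall l, smx O (F l)) -> O t ->
  nab Lam (fun s => \sum_(l < N) F l s) t = \sum_(l < N) nab Lam (F l) t /\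
  smx O (fun s => \sum_(l < N) F l s).
Proof.
move=> sF Ot; elim: N => [|N [IH sN]].
  have -> : (fun s => \sum_(l < 0) F l s) = fun=> 0 by apply/funext => s; rewrite big_ord0.
  by rewrite big_ord0 /nab dmx_cst mul0mx addr0; split=> //; exact: smx_cst.
have -> : (fun s => \sum_(l < N.+1) F l s) = fun s => \sum_(l < N) F l s + F N s.
  by apply/funext => s; rewrite big_ord_recr.
split; last exact: (smxD oO sN (sF N)).
by rewrite big_ord_recr /= -IH /nab (dmxD sN (sF N) Ot) mulmxDl addrACA.
Qed.

(* Leibniz rule: modulo lower jets, differentiating c D amounts to differentiating D. *)
Lemma iter_nab_jets {p} (c : R -> 'M[R]_(p, k)) (V : nat -> R -> 'M[R]_(p, n)) :
  smx O c -> (forall t, O t -> V 0%N t = c t *m D t) ->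
  (forall j t, O t -> V j.+1 t = nab Lam (V j) t) ->
  forall j t, O t ->
    ((V j t - c t *m njet D Lam j t)%R <= \sum_(l < j) <<njet D Lam l t>>)%MS.
Proof.
move=> sc V0 VS j.
(* Stronger claim for the induction: [V j] is a combination of the jets of order up to [j] with
   smooth coefficients, the top one being [c]. *)
suff [w [sw wj wV]] : exists w : nat -> R -> 'M[R]_(p, k), [/\ forall l, smx O (w l),
    w j = c & forall t, O t -> V j t = \sum_(l < j.+1) w l t *m njet D Lam l t].
  move=> t Ot; rewrite wV// big_ord_recr /= wj addrK.
  apply: summx_sub => l _; apply: (submx_trans (submxMl _ _)).
  by apply: (sumsmx_sup l) => //; rewrite genmxE.
elim: j => [|j [w [sw wj wV]]].
  by exists (fun=> c); split=> // t Ot; rewrite big_ord1 V0.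
(* Coefficients arising from the derivative of the jets, which moves each of them up by one
   order. *)
pose sh l : R -> 'M[R]_(p, k) := if l is l'.+1 then w l' else fun=> 0.
have ssh l : smx O (sh l) by case: l => [|l]; [exact: smx_cst|exact: sw].
exists (fun l => if l == j.+1 then c else fun t => dmx (w l) t + sh l t); split.
- move=> l; case: eqP => // _; apply: (smxD oO); last exact: ssh.
  exact: smx_dmx.
- by rewrite eqxx.
- move=> t Ot; rewrite VS//.
  have sj l := smx_njet oO sD sLam l.
  pose F l t := w l t *m njet D Lam l t.
  have e : {in O, V j =1 fun s => \sum_(l < j.+1) F l s}.
    by move=> s /set_mem; exact: wV.
  have sF l : smx O (F l) by apply: (smxM oO); [exact: sw|exact: sj].
  have -> : nab Lam (V j) t = nab Lam (fun s => \sum_(l < j.+1) F l s) t.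
    by rewrite /nab (eq_on_dmx oO e Ot) e// inE.
  have [-> _] := nab_sum j.+1 sF Ot.
  rewrite [RHS]big_ord_recr /= eqxx.
  have -> : \sum_(l < j.+1) nab Lam (F l) t =
     \sum_(l < j.+1) dmx (w l) t *m njet D Lam l t + \sum_(l < j.+1) w l t *m njet D Lam l.+1 t.
    rewrite -big_split; apply: eq_bigr => l _ /=.
    by rewrite /F (nabM Lam (sw l) (sj l) Ot).
  rewrite [X in _ + X = _]big_ord_recr /= wj addrA; congr (_ + _).
  have -> : \sum_(l < j) w l t *m njet D Lam l.+1 t = \sum_(l < j.+1) sh l t *m njet D Lam l t.
    by rewrite [RHS]big_ord_recl /= mul0mx add0r.
  rewrite -big_split; apply: eq_bigr => l _ /=.
  by rewrite (ltn_eqF (ltn_ord l)) mulmxDl.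
Qed.

End JetCombinations.

Section CkLincomb.
Context {R : realType} {V W : normedModType R}.
Implicit Types (A : set V) (f g : V -> W).

Lemma eq_on_Ck k A f g : open A -> {in A, f =1 g} -> Ck k A f -> Ck k A g.
Proof.
move=> oA; elim: k f g => [|k IH] f g fg.
  move=> cf x Ax; have N := eq_on_near oA fg Ax.
  have := cf x Ax; rewrite /prop_for /continuous_at -(fg x (mem_set Ax)) => c.
  apply: cvg_trans c; apply: near_eq_cvg.
  by near=> y; apply: (near N).
move=> [df cf]; split=> [x Ax|v].
  by apply: near_eq_differentiable (eq_on_near oA fg Ax) (df x Ax).
apply: IH (cf v) => x /set_mem Ax.
exact: near_eq_derive (eq_on_near oA fg Ax).
Unshelve. all: by end_near. Qed.

(** [section] demands smoothness of vector-valued maps rather than of their entries; this serves to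
    build [sec_lincomb]. *)
Lemma Ck_lincomb k A (c : R) f g : open A -> Ck k A f -> Ck k A g ->
  Ck k A (fun x => c *: f x + g x).
Proof.
move=> oA; elim: k f g => [|k IH] f g.
  move=> cf cg x Ax.
  have H : (c \*: f) @ x --> c *: f x by exact: (cvgZl_tmp (cf x Ax)).
  have := cvgD H (cg x Ax).
  exact.
move=> [df cf] [dg cg].
have dZ x : A x -> differentiable (c \*: f) x by move=> Ax; apply: differentiableZ; exact: df.
split=> [x Ax|v]; first by apply: differentiableD; [exact: dZ|exact: dg].
apply: (eq_on_Ck oA _ (IH _ _ (cf v) (cg v))) => x /set_mem Ax; apply/esym.
have f1 : derivable f x v by apply: diff_derivable; exact: df.
have g1 : derivable g x v by apply: diff_derivable; exact: dg.
have f2 : derivable (c \*: f) x v by apply: diff_derivable; exact: dZ.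
by apply: (etrans (deriveD f2 g1)); rewrite deriveZ.
Qed.

Lemma Ck_cst k A (w : W) : Ck k A (fun=> w).
Proof.
elim: k w => [|k IH] w; first by move=> x _; exact: cst_continuous.
split=> [x _|v]; first exact: differentiable_cst.
have -> : (fun x : V => 'D_v (fun=> w) x) = fun=> 0.
  by apply/funext => x; exact: derive_cst.
exact: IH.
Qed.

End CkLincomb.

Section FlagJets.
Context {R : realType} {n k : nat} {M : smoothManifold R n}.
Variables (a : chart M) (gam : R -> M) (O : set R) (oO : open O).
Variables (U : set M) (oU : open U) (Y : 'I_n -> vfield M).
Hypothesis agam : forall t, O t -> dom a (gam t).
Hypothesis Ugam : forall t, O t -> U (gam t).
Hypothesis sgx : smx O (fun t => chart_map a (gam t)).
Hypothesis gY : forall i, gvf U (Y i).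
Hypothesis Y_basis : forall x, U x -> frame_mx Y x \in unitmx.
Variables (X : 'I_k -> vfield M) (T : vfield M).
Hypothesis X_smooth : forall i, smooth_vfield (X i).
Hypothesis gT : gvf setT T.
Hypothesis gx_der : forall t j, O t ->
  isd (fun s => chart_map a (gam s) 0 j) t (T a (chart_map a (gam t)) 0 j).

Let gvfU Z : gvf setT Z -> gvf U Z. Proof. exact: gvfS. Qed.
Let gTU := gvfU gT.
Let gX i : gvf U (X i). Proof. by apply: gvfU; exact: (gvf_smooth openT (X_smooth i)). Qed.

(** Constant coefficients suffice to extend any vector of the distribution at one point to a global
    section. *)
Definition sec_lincomb (c : 'rV[R]_k) : vfield M := fun b u => \sum_i c 0 i *: X i b u.

Lemma section_lincomb c : section X (sec_lincomb c).
Proof.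
split; last first.
  move=> x; have -> : ev (sec_lincomb c) x = c *m frame_mx X x.
    by rewrite mulmx_sum_row; apply: eq_bigr => i _; rewrite rowK.
  exact: submxMl.
split=> [b j|b b' x Ux bx b'x].
  rewrite setIT /sec_lincomb.
  elim: (index_enum _) => [|i r IH].
    have -> : (fun u => \sum_(i <- [::]) c 0 i *: X i b u) = fun=> 0.
      by apply/funext => u; rewrite big_nil.
    exact: Ck_cst.
  have -> : (fun u => \sum_(l <- i :: r) c 0 l *: X l b u) =
      fun u => c 0 i *: X i b u + \sum_(l <- r) c 0 l *: X l b u.
    by apply/funext => u; rewrite big_cons.
  apply: Ck_lincomb; [exact: open_chart_map_dom| |exact: IH].
  by have [+ _] := X_smooth i; move=> /(_ b); rewrite setIT; apply.
rewrite /sec_lincomb mulmx_suml; apply: eq_bigr => i _; rewrite -scalemxAl; congr (_ *: _).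
by have [_ +] := X_smooth i; apply.
Qed.

Lemma section_X i : section X (X i).
Proof. by split=> // x; have <- : row i (frame_mx X x) = ev (X i) x; [rewrite rowK|exact: row_sub]. Qed.

Let D := zcm a gam Y X.
Let Lam := clam a gam Y T.

Let sD : smx O D.
Proof. exact: (smx_zcm oO agam Ugam sgx gY Y_basis gX). Qed.

Let sLam : smx O Lam.
Proof. exact: (smx_clam oO agam Ugam sgx gY Y_basis gTU). Qed.

Lemma distr_compE t : O t -> distr_comp X gam Y t = D t.
Proof. by move=> Ot; exact: (ycomp_frame agam Ugam gY Y_basis gX Ot). Qed.

Lemma section_gvf V : section X V -> gvf U V.
Proof. by move=> [sV _]; apply: gvfU; exact: (gvf_smooth openT sV). Qed.

Let zc (V : vfield M) := zcm a gam Y (fun _ : 'I_1 => V).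

Lemma ycomp_ev V t : gvf U V -> O t -> ycomp gam Y t (ev V (gam t)) = zc V t.
Proof.
move=> gV Ot; rewrite ev_frame1.
exact: (ycomp_frame agam Ugam gY Y_basis (fun=> gV) Ot).
Qed.

Lemma section_sub V t : section X V -> O t -> (zc V t <= D t)%MS.
Proof.
move=> sV Ot; rewrite -(ycomp_ev (section_gvf sV) Ot) -(distr_compE Ot).
by apply: submxMr; have [_] := sV; exact.
Qed.

Hypothesis DD : forall t, O t -> D t *m (D t)^T = 1%:M.

Let nj := njet D Lam.
Let J i t := (\sum_(l < i) <<nj l t>>)%MS.

(** The Leibniz rule for [V] written as a combination of the [X i] with smooth coefficients: modulo
    lower jets, its [j]-th Lie derivative depends only on its value at the point. *)
Lemma section_jets V j t : section X V -> O t ->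
  ((zc (iter j (lie T) V) t - zc V t *m (D t)^T *m nj j t)%R <= J j t)%MS.
Proof.
move=> sV Ot; have gV := section_gvf sV.
have sz := smx_zcm oO agam Ugam sgx gY Y_basis (fun _ : 'I_1 => gV).
apply: (iter_nab_jets oO sD sLam (V := fun j => zc (iter j (lie T) V)) (c := fun t => zc V t *m (D t)^T)) => //.
- by apply: (smxM oO) => //; exact: smxT.
- move=> s Os /=; have /submxP[x ->] := section_sub sV Os.
  by rewrite -[x *m D s *m _]mulmxA DD// mulmx1.
move=> i s Os; apply/esym.
by apply: (nab_zcm oO agam Ugam sgx gY Y_basis gTU gx_der) => // _; apply: gvf_iter.
Qed.

Lemma njet_row j t r : O t -> row r (nj j t) = zc (iter j (lie T) (X r)) t.
Proof.
move=> Ot.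
rewrite /nj (njet_zcm oO oU agam Ugam sgx gY Y_basis gTU gx_der j gX _ Ot)//.
by rewrite row_mul rowK; congr (_ *m _); apply/rowP => c; rewrite [RHS]mxE.
Qed.

Let F i t := ycomp gam Y t (flag X gam T i t).

(** By [section_jets], arbitrary sections contribute nothing beyond the iterated derivatives of the
    [X i]. *)
Lemma flag_jets i t : O t -> (F i t :=: J i t)%MS.
Proof.
move=> Ot; have yu := Y_basis (Ugam Ot).
have [S1 S2] := span_mxP [set v | exists j V,
    [/\ (j < i)%N, section X V & v = ev (iter j (lie T) V) (gam t)]].
apply/eqmxP/andP; split.
  have H : (flag X gam T i t <= J i t *m frame_mx Y (gam t))%MS.
    apply: S2 => v [j [V [ji sV ->]]].
    have -> : ev (iter j (lie T) V) (gam t) = zc (iter j (lie T) V) t *m frame_mx Y (gam t).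
      rewrite -(ycomp_ev _ Ot); last by apply: gvf_iter => //; exact: section_gvf.
      by rewrite /ycomp mulmxKV.
    apply: submxMr.
    have := section_jets j sV Ot; set w := (_ - _)%R => wJ.
    have -> : zc (iter j (lie T) V) t = w + zc V t *m (D t)^T *m nj j t by rewrite subrK.
    apply: addmx_sub.
      apply: (submx_trans wJ); apply/sumsmx_subP => l _.
      by apply: (sumsmx_sup (Ordinal (ltn_trans (ltn_ord l) ji))).
    apply: (submx_trans (submxMl _ _)).
    by apply: (sumsmx_sup (Ordinal ji)) => //; rewrite genmxE.
  have := submxMr (invmx (frame_mx Y (gam t))) H; rewrite mulmxK//.
apply/sumsmx_subP => l _; rewrite genmxE; apply/row_subP => r.
rewrite njet_row// -(ycomp_ev _ Ot); last by apply: gvf_iter.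
apply: submxMr; apply: S1; exists l, (X r); split=> //; exact: section_X.
Qed.

Lemma flag_jets0 t : O t -> F 0%N t = 0.
Proof.
move=> Ot; apply/eqP; rewrite -submx0 (flag_jets _ Ot) /J big_ord0.
exact: submx_refl.
Qed.

Lemma flag_jetsS i t : O t -> (F i.+1 t :=: F i t + nj i t)%MS.
Proof.
move=> Ot; apply: (eqmx_trans (flag_jets _ Ot)); rewrite /J big_ord_recr /=.
by apply: eqmx_sym; apply: adds_eqmx; [exact: flag_jets|apply: eqmx_sym; exact: genmxE].
Qed.

(** Two extensions of [v] give results that differ by a vector of F^i, which the projection kills;
    and [sec_lincomb] is an extension, so the default value of [xget] is excluded. The index [i.+1]
    stands for i derivatives. *)
Lemma LmapE i t (v : 'rV[R]_n) : O t -> (v <= D t)%MS ->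
  Lmap X gam T Y i.+1 t v = v *m (D t)^T *m nj i t *m proj_mx (kermx (F i t)^T) (F i t).
Proof.
move=> Ot vD.
have key V : section X V -> ycomp gam Y t (ev V (gam t)) = v ->
    ycomp gam Y t (ev (iter i (lie T) V) (gam t)) *m proj_mx (kermx (F i t)^T) (F i t) =
    v *m (D t)^T *m nj i t *m proj_mx (kermx (F i t)^T) (F i t).
  move=> sV; have gV := section_gvf sV.
  rewrite (ycomp_ev gV Ot) (ycomp_ev (gvf_iter oU gTU i gV) Ot) => zv.
  apply/eqP; rewrite -subr_eq0 -mulmxBl proj_mx_0 ?kermx_tr_cap//.
  by rewrite (flag_jets _ Ot) -zv; exact: section_jets.
rewrite /Lmap; case: xgetP => [w _ [V [sV eV] ->]|/(_ (v *m (D t)^T *m nj i t *m proj_mx (kermx (F i t)^T) (F i t)))].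
  exact: key.
case; have sV := section_lincomb (v *m (D t)^T).
have eV : ycomp gam Y t (ev (sec_lincomb (v *m (D t)^T)) (gam t)) = v.
  have -> : ev (sec_lincomb (v *m (D t)^T)) (gam t) = v *m (D t)^T *m frame_mx X (gam t).
    by rewrite [RHS]mulmx_sum_row; apply: eq_bigr => j _; rewrite rowK.
  rewrite /ycomp -mulmxA.
  have -> : frame_mx X (gam t) *m invmx (frame_mx Y (gam t)) = D t by exact: distr_compE.
  have /submxP[x ->] := vD.
  by rewrite -[x *m D t *m _]mulmxA DD// mulmx1.
exists (sec_lincomb (v *m (D t)^T)); first by [].
by rewrite (key _ sV eV).
Qed.

Lemma Lmap_eq0 i t (v : 'rV[R]_n) : O t -> (v <= D t)%MS ->
  Lmap X gam T Y i.+1 t v = 0 <-> (v *m (D t)^T *m nj i t <= F i t)%MS.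
Proof.
move=> Ot vD; rewrite LmapE//; split=> H; last by rewrite proj_mx_0 ?kermx_tr_cap.
move: H; set w := v *m _ *m _ => H.
have [x xF] := orth_decomp (F i t) w.
have wK : (w - x *m F i t <= kermx (F i t)^T)%MS by apply/sub_kermxP.
have : (w - x *m F i t) *m proj_mx (kermx (F i t)^T) (F i t) = w - x *m F i t.
  by rewrite proj_mx_id ?kermx_tr_cap.
rewrite mulmxBl H (proj_mx_0 (kermx_tr_cap _) (submxMl _ _)) subrr => /esym/eqP.
by rewrite subr_eq0 => /eqP ->; exact: submxMl.
Qed.

End FlagJets.

Section FlagRanks.
Context {R : realType} {n k : nat} {M : smoothManifold R n}.
Variables (X : 'I_k -> vfield M) (gam : R -> M) (T : vfield M).

Lemma flag_le i t : (flag X gam T i t <= flag X gam T i.+1 t)%MS.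
Proof.
have [_ S2] := span_mxP [set v | exists j V,
    [/\ (j < i)%N, section X V & v = ev (iter j (lie T) V) (gam t)]].
have [S1 _] := span_mxP [set v | exists j V,
    [/\ (j < i.+1)%N, section X V & v = ev (iter j (lie T) V) (gam t)]].
apply: S2 => v [j [V [ji sV ->]]]; apply: S1; exists j, V; split=> //.
exact: ltn_trans ji _.
Qed.

Lemma flag0 t : flag X gam T 0 t = 0.
Proof.
have [_ S2] := span_mxP [set v | exists j V,
    [/\ (j < 0)%N, section X V & v = ev (iter j (lie T) V) (gam t)]].
by apply/eqP; rewrite -submx0; apply: S2 => v [j [V []]].
Qed.

Lemma sum_growth m : (\sum_(i < m) growth X gam T i.+1)%N = \rank (flag X gam T m 0).
Proof.
elim: m => [|m IH]; first by rewrite big_ord0 flag0 mxrank0.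
by rewrite big_ord_recr /= IH /growth /= subnKC// mxrankS// flag_le.
Qed.

Lemma geodesic_dimensionE m :
  geodesic_dimension X gam T m = (\sum_(i < m) i.*2.+1 * growth X gam T i.+1)%N.
Proof.
rewrite /geodesic_dimension big_add1 /= big_mkord; apply: eq_bigr => i _.
by rewrite mul2n doubleS subn1.
Qed.

End FlagRanks.

Section QuotientFrames.
Context {R : realType} {n k : nat} {M : smoothManifold R n}.
Variables (a : chart M) (gam : R -> M) (O : set R) (oO : open O).
Variables (U : set M) (oU : open U) (Y : 'I_n -> vfield M).
Hypothesis agam : forall t, O t -> dom a (gam t).
Hypothesis Ugam : forall t, O t -> U (gam t).
Hypothesis sgx : smx O (fun t => chart_map a (gam t)).
Hypothesis gY : forall i, gvf U (Y i).
Hypothesis Y_basis : forall x, U x -> frame_mx Y x \in unitmx.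
Variables (X : 'I_k -> vfield M) (T : vfield M).
Hypothesis X_smooth : forall i, smooth_vfield (X i).
Hypothesis gT : gvf setT T.
Hypothesis gx_der : forall t j, O t ->
  isd (fun s => chart_map a (gam s) 0 j) t (T a (chart_map a (gam t)) 0 j).
Let D := zcm a gam Y X.
Let Lam := clam a gam Y T.
Hypothesis DD : forall t, O t -> D t *m (D t)^T = 1%:M.
Let F i t := ycomp gam Y t (flag X gam T i t).
Variables (m : nat) (d : nat -> nat) (E : forall i, R -> 'M[R]_(d i, n)).
Hypothesis E_quot : forall i t, (i < m)%N -> O t -> quotient_basis X gam T Y i.+1 t (E i t).

Lemma quotient_ortho i t : (i < m)%N -> O t -> E i t *m (E i t)^T = 1%:M.
Proof. by move=> im Ot; have [] := E_quot im Ot. Qed.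

Lemma quotient_kernel i t (v : 'rV[R]_n) : (i < m)%N -> O t ->
  (v <= E i t)%MS <-> (v <= D t)%MS /\
    forall w : 'rV[R]_n, (w <= D t)%MS -> (w *m (D t)^T *m njet D Lam i t <= F i t)%MS ->
      v *m w^T = 0.
Proof.
move=> im Ot; have [_ H] := E_quot im Ot.
have eD := distr_compE agam Ugam gY Y_basis X_smooth Ot.
have L (w : 'rV[R]_n) := @Lmap_eq0 _ _ _ _ _ _ _ oO _ oU _ agam Ugam sgx gY Y_basis _ _ X_smooth gT gx_der DD i t w Ot.
apply: (iff_trans (H v)); rewrite eD; split=> -[vD Hv]; split=> // w wD Hw; apply: Hv => //.
  exact: (L w wD).2.
exact: (L w wD).1.
Qed.

Let F0 t (Ot : O t) := flag_jets0 oO oU agam Ugam sgx gY Y_basis X_smooth gT gx_der DD Ot.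
Let FS i t (Ot : O t) := flag_jetsS oO oU agam Ugam sgx gY Y_basis X_smooth gT gx_der DD i Ot.

Lemma Lmx_perp i t : (i < m)%N -> O t -> Lmx X gam T Y i.+1 t (E i t) = FYperp D Lam E i t.
Proof.
move=> im Ot.
have [qT qq qF] := @orthqP _ _ _ m d O D Lam F E DD F0 FS quotient_ortho quotient_kernel i t (ltnW im) Ot.
apply/row_matrixP => j; rewrite rowK.
have ED : (row j (E i t) <= D t)%MS.
  by have [] := (quotient_kernel (row j (E i t)) im Ot).1 (row_sub _ _).
rewrite (LmapE oO oU agam Ugam sgx gY Y_basis X_smooth gT gx_der DD i Ot ED).
apply: (etrans (orth_proj _ qT qq qF)).
by rewrite /FYperp /FY !row_mul.
Qed.

Lemma Mmx_gram i t : (i < m)%N -> O t -> Mmx X gam T Y i.+1 t (E i t) = FYgram D Lam E i t.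
Proof. by move=> im Ot; rewrite /Mmx Lmx_perp. Qed.

Hypothesis O0 : O 0.
Hypothesis sE : forall i, (i < m)%N -> smx O (@E i).

(** [trace_term] differentiates the matrix as a whole, [dmx] its entries; and [Mmx] is known to
    agree with the smooth [FYgram] on [O], that is near 0. *)
Lemma trace_term_gram i : (i < m)%N ->
  trace_term X gam T Y i.+1 (@E i) =
  \tr (invmx (FYgram D Lam E i 0) *m dmx (FYgram D Lam E i) 0).
Proof.
move=> im; rewrite /trace_term /= Mmx_gram//; congr (\tr (_ *m _)).
have sD : smx O D.
  apply: (smx_zcm oO agam Ugam sgx gY Y_basis) => l; apply: (gvfS _ (gvf_smooth openT (X_smooth l))).
  by [].
have sLam : smx O Lam.
  by apply: (smx_clam oO agam Ugam sgx gY Y_basis); exact: gvfS gT.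
have sG := @smx_FYgram _ _ _ m d O oO D Lam F E sD sLam DD F0 FS sE quotient_ortho quotient_kernel i im.
have N : \forall t \near (0 : R), FYgram D Lam E i t = Mmx X gam T Y i.+1 t (E i t).
  by near=> t; rewrite Mmx_gram//; near: t; apply: open_nbhs_nbhs.
have dG : derivable (FYgram D Lam E i : R -> 'M[R]_(d i)) 0 1.
  by apply/derivable_mxP => p q; have := smx_derivable sG O0 p q; rewrite dableE.
rewrite derive1E; have e := @near_eq_derive R R^o 'M[R]_(d i) _ _ (0 : R^o) (1 : R^o) N.
apply: (etrans (esym e)).
apply: (etrans (derive_mx dG)).
by apply/matrixP => p q; rewrite [LHS]mxE [RHS]mxE derive1E.
Unshelve. all: by end_near. Qed.

End QuotientFrames.

Lemma smooth_on_smx {R : realType} {p q} (O : set R) (F : R -> 'M[R]_(p, q)) :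
  open O -> smooth_on O (F : R^o -> 'M[R]_(p, q)) -> smx O F.
Proof.
move=> oO sF i j; have s := smf_entry i j oO sF.
have := @smooth1_line _ _ O _ (0 : R^o) (1 : R^o) O oO.
have e (t : R) : (0 : R^o) + t *: (1 : R^o) = t by rewrite add0r; exact: mulr1.
move=> /(_ (fun t => F t i j)) H; apply: (smooth1_ext _ (H _ s)) => t; first by rewrite e.
by move=> Ot; rewrite e.
Qed.

Section VanishingSections.
Context {R : realType} {n k : nat}.
Variables (A : set 'rV[R]_n) (oA : open A).
Variables (Z : 'rV[R]_n -> 'M[R]_(k, n)) (V : 'rV[R]_n -> 'rV[R]_n) (u : 'rV[R]_n).
Hypotheses (Au : A u) (V0 : V u = 0).
Hypothesis sZ : forall i j, smf A (fun v => Z v i j).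
Hypothesis sV : forall j, smf A (fun v => V v 0 j).
Hypothesis Zfree : forall v, A v -> row_free (Z v).
Hypothesis VZ : forall v, A v -> (V v <= Z v)%MS.

(* Write V = w Z with w smooth; then w vanishes at u, so dV = dw Z there. *)
Lemma vanishing_section_pd l : ((\row_j pd (fun v => V v 0 j) l u)%R <= Z u)%MS.
Proof.
pose line (s : R) := u + s *: (delta_mx 0 l : 'rV[R]_n).
pose O := line @^-1` A.
have cl : continuous line.
  by move=> s; apply: cvgD; [exact: cvg_cst|apply: cvgZr_tmp; exact: cvg_id].
have oO : open O by apply: open_comp => // s _; exact: cl.
have l0 : line 0 = u by rewrite /line scale0r addr0.
have O0 : O 0 by rewrite /O /= l0.
pose f s := V (line s); pose z s := Z (line s).
have sf : smx O f by move=> i j; rewrite ord1; apply: (smooth1_line oO _ (sV j)).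
have sz : smx O z by move=> i j; apply: (smooth1_line oO _ (sZ i j)).
have gu s : O s -> z s *m (z s)^T \in unitmx.
  move=> Os; apply: gram_unit => c cz.
  by apply: (row_free_inj (Zfree Os)); rewrite cz mul0mx.
pose w s := f s *m (z s)^T *m invmx (z s *m (z s)^T).
have szT : smx O (fun s => (z s)^T) by exact: smxT.
have sw : smx O w.
  apply: (smxM oO); first exact: (smxM oO).
  by apply: (smx_inv oO gu); exact: (smxM oO).
have fE : {in O, f =1 fun s => w s *m z s}.
  move=> s /set_mem Os; have /submxP[x xE] := VZ Os.
  by rewrite /w /f xE -/(z s) -(mulmxA x) mulmxK// gu.
have w0 : w 0 = 0 by rewrite /w /f l0 V0 !mul0mx.
have df : dmx f 0 = dmx w 0 *m z 0.
  by rewrite (eq_on_dmx oO fE O0) (dmxM sw sz O0) w0 mul0mx addr0.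
have -> : \row_j pd (fun v => V v 0 j) l u = dmx f 0.
  by apply/rowP => j; rewrite [LHS]mxE [RHS]mxE pd_line.
by rewrite df /z l0; exact: submxMl.
Qed.

End VanishingSections.

(** * The volume along the geodesic *)

Section GeodesicGeometry.
Context {R : realType} {n k : nat} {M : smoothManifold R n}.
Implicit Types (a : chart M) (x : M).

(** The velocity is given in the chart selected at [gam t]; continuity keeps the curve in the
    overlap with [a], where the chain rule applies. *)
Lemma admissible_chart (T : vfield M) (gam : R -> M) t a : gvf setT T ->
  {for t, continuous gam} -> dom a (gam t) ->
  is_derive (t : R^o) (1 : R^o) (fun s => chart_map (chart_at (gam t)) (gam s)) (ev T (gam t)) ->
  forall j, isd (fun s => chart_map a (gam s) 0 j) t (T a (chart_map a (gam t)) 0 j).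
Proof.
move=> [_ tT] cg at_ H j; set c := chart_at (gam t) in H *.
have ct : dom c (gam t) by exact: dom_chart_at.
have {}H := is_derive_entries H.
have nca : \near t, (dom c `&` dom a) (gam t).
  by apply: cg; apply: open_nbhs_nbhs; split => //; apply: openI; exact: open_dom.
apply: (@near_eq_isd _ (fun s => trans c a (chart_map c (gam s)) 0 j)).
  near=> s; have [cs as_] : (dom c `&` dom a) (gam s) by near: s.
  by rewrite trans_chart.
have dt : differentiable ((fun w => trans c a w 0 j) : _ -> R^o) (chart_map c (gam t)).
  by apply: (smf_diff (trans_smf c a j)); exists (gam t).
apply: (isd_eq (isd_comp dt H)).
rewrite (tT c a (gam t))// mxE; apply: eq_bigr => l _.
by rewrite tmxE.
Unshelve. all: by end_near. Qed.

Lemma section_chart (X : 'I_k -> vfield M) V a x : (forall i, gvf setT (X i)) ->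
  section X V -> dom a x -> (V a (chart_map a x) <= fmx a X (chart_map a x))%MS.
Proof.
move=> gX [sV VX] ax; have := VX x.
have J := tmx_unit ax (dom_chart_at x).
rewrite (frame_mx_chart gX (I : [set: M] x) ax).
have -> : ev V x = V a (chart_map a x) *m tmx a (chart_at x) x.
  have [_ tV] := gvf_smooth openT sV; exact: tV (dom_chart_at x).
by move: (tmx _ _ _) J => N NU /(submxMr (invmx N)); rewrite !mulmxK.
Qed.

(** Let c_i be the values of [p] on the X_i at the point. Then V - sum c_i X_i is a section of the
    distribution vanishing at the point, so its derivatives there lie in the distribution by
    [vanishing_section_pd]. The rest of the difference comes from differentiating the coefficients
    of the X_i. *)
Lemma lin_xp_sub (X0 V : vfield M) (X : 'I_k -> vfield M) (gam : R -> M) t a p :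
  gvf setT X0 -> (forall i, gvf setT (X i)) -> everywhere_independent X ->
  section X V -> dom a (gam t) ->
  (forall j, Defs.addvf X0 V a (chart_map a (gam t)) 0 j = chart_ham_p X0 X a p (chart_map a (gam t)) 0 j) ->
  ((ham_xp (X0 a) (X^~ a) p (chart_map a (gam t)) - tau a gam (Defs.addvf X0 V) t)%R
     <= fmx a X (chart_map a (gam t)))%MS.
Proof.
move=> gX0 gX Xfree sV at_ TE; set u := chart_map a (gam t) in TE *.
pose A := chart_map a @` dom a.
have oA : open A by exact: open_chart_map_dom.
have Au : A u by exists (gam t).
have gV : gvf setT V by have [/(gvf_smooth openT)] := sV.
have s0 j : smf A (fun u => X0 a u 0 j) by exact: gvf_dom.
have sX i j : smf A (fun u => X i a u 0 j) by exact: gvf_dom.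
have sVj j : smf A (fun u => V a u 0 j) by exact: gvf_dom.
pose c i := pairing p (X i a u).
pose W v : 'rV[R]_n := V a v - \sum_i c i *: X i a v.
have WE v j : W v 0 j = V a v 0 j - \sum_i c i * X i a v 0 j.
  rewrite mxE [X in _ + X]mxE summxE; congr (_ - _).
  by apply: eq_bigr => i _; rewrite mxE.
have sW j : smf A (fun v => W v 0 j).
  apply: (eq_on_smf oA (f := fun v => V a v 0 j + - \sum_i c i * X i a v 0 j)).
    by move=> v _; rewrite WE.
  apply: (smfD oA) => //; apply: (smfN oA); apply: (smf_sum oA) => i _.
  by apply: (smfM oA); [exact: smf_cst|exact: sX].
have dW j l : pd (fun v => W v 0 j) l u =
    pd (fun v => V a v 0 j) l u - \sum_i c i * pd (fun v => X i a v 0 j) l u.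
  apply: (isd_unique (isd_pd l (sW j) Au)).
  have H := isdD (isd_pd l (sVj j) Au) (isdN (isd_sum (index_enum 'I_k) (P := xpredT)
    (fun i _ => isdM (isd_cst (c i) 0) (isd_pd l (sX i j) Au)))).
  apply: (isd_eq (isd_ext _ H)) => [s|]; first by rewrite WE.
  by congr (_ - _); apply: eq_bigr => i _; rewrite mul0r add0r.
have dT j l : pd (fun v => Defs.addvf X0 V a v 0 j) l u =
    pd (fun v => X0 a v 0 j) l u + pd (fun v => V a v 0 j) l u.
  have e : smf A (fun v => Defs.addvf X0 V a v 0 j).
    apply: (eq_on_smf oA (f := fun v => X0 a v 0 j + V a v 0 j)).
      by move=> v _; rewrite mxE.
    exact: (smfD oA).
  apply: (isd_unique (isd_pd l e Au)).
  apply: (isd_ext _ (isdD (isd_pd l (s0 j) Au) (isd_pd l (sVj j) Au))) => s.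
  by rewrite [RHS]mxE.
have W0 : W u = 0.
  apply/rowP => j; rewrite WE [RHS]mxE; have := TE j.
  rewrite mxE [RHS]mxE [RHS]addrC => /addrI ->.
  by rewrite subrr.
have Zfree v : A v -> row_free (fmx a X v).
  move=> [y ay <-]; have := Xfree y.
  rewrite (frame_mx_chart gX (I : [set: M] y) ay) /row_free mxrankMfree//.
  by rewrite row_free_unit; exact: (tmx_unit ay (dom_chart_at y)).
have WZ v : A v -> (W v <= fmx a X v)%MS.
  move=> [y ay <-]; apply: addmx_sub; first exact: section_chart.
  rewrite eqmx_opp; apply: summx_sub => i _; apply: scalemx_sub.
  by apply: (submx_trans _ (row_sub i _)); rewrite rowK.
have sZ i j : smf A (fun v => fmx a X v i j).
  by apply: (eq_on_smf oA _ (sX i j)) => v _; rewrite fmxE.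
apply/row_subP => l.
have -> : row l (ham_xp (X0 a) (X^~ a) p u - tau a gam (Defs.addvf X0 V) t) =
    (\row_i dpairing (X i a) p u l) *m fmx a X u - \row_j pd (fun v => W v 0 j) l u.
  apply/rowP => j; rewrite [LHS]mxE [LHS]mxE [X in X + _]mxE.
  rewrite [X in _ + X]mxE [X in _ - X]mxE dT.
  rewrite [RHS]mxE [X in _ = X + _]mxE [X in _ = _ + X]mxE [X in _ = _ - X]mxE dW.
  have -> : \sum_i (\row_i dpairing (X i a) p u l) 0 i * fmx a X u i j =
      \sum_i dpairing (X i a) p u l * X i a u 0 j.
    by apply: eq_bigr => i _; rewrite mxE fmxE.
  rewrite big_split/= /c; set S1 := \sum_i _; set S2 := \sum_i _.
  by move: (pd _ _ _) (pd _ _ _) => q1 q2; ring.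
apply: addmx_sub; first exact: submxMl.
rewrite eqmx_opp; exact: (vanishing_section_pd oA Au W0 sZ sW Zfree WZ l).
Qed.

(** The [X i] are an orthogonal combination of the first [k] vectors of [Y], whose components in [Y]
    are standard basis vectors. *)
Lemma orthonormal_frame_gram (X : 'I_k -> vfield M) (Y : 'I_n -> vfield M) (kn : (k <= n)%N)
    (U : set M) x : orthonormal_basis_on X U (fun i => Y (widen_ord kn i)) ->
  U x -> frame_mx Y x \in unitmx ->
  (frame_mx X x *m invmx (frame_mx Y x)) *m (frame_mx X x *m invmx (frame_mx Y x))^T = 1%:M.
Proof.
move=> oX Ux yu; have [Om OO OE] := oX x Ux.
pose P : 'M[R]_(k, n) := \matrix_(i < k) delta_mx 0 (widen_ord kn i).
have PY : frame_mx (fun i => Y (widen_ord kn i)) x = P *m frame_mx Y x.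
  by apply/row_matrixP => i; rewrite row_mul !rowK -rowE rowK.
have PP : P *m P^T = 1%:M.
  apply/matrixP => i j; rewrite mxE (bigD1 (widen_ord kn i))//= big1 ?addr0 => [|l li].
    rewrite !mxE !eqxx /= mul1r.
    by have -> : (widen_ord kn i == widen_ord kn j) = (i == j) by [].
  by rewrite !mxE (negPf li) mul0r.
have OO' : Om^T *m Om = 1%:M by exact: mulmx1C.
have -> : frame_mx X x *m invmx (frame_mx Y x) = Om^T *m P.
  rewrite -[frame_mx X x]mul1mx -OO' -(mulmxA _ Om) -OE PY.
  by rewrite mulmxA mulmxK.
by rewrite trmx_mul trmxK mulmxA -(mulmxA _ P) PP mulmx1.
Qed.

End GeodesicGeometry.

Section FiberVolume.
Context {R : realType} {n k : nat} {M : smoothManifold R n}.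
Variables (dPhi : set (R * cotangent M)) (Phi : R -> cotangent M -> cotangent M).
Variables (lam : cotangent M) (mu : vform M).
Hypothesis mu_volume : volume_form mu.
Let a := chart_at lam.1.

(** The Jacobian from [a] to the chart selected at the end point is absorbed by the density of [mu].
    The density at the initial point is a factor, for the dual form has the inverse density. *)
Lemma fiber_volumeE A (O : set R) t : flow_domain dPhi Phi lam A ->
  (forall t, O t -> A (t, (chart_map a lam.1, lam.2))) -> O t -> dom a (Phi t lam).1 ->
  fiber_volume mu Phi lam t =
  mu a (geo_x Phi lam t) * \det (fiber_dx Phi lam t) * mu a (chart_map a lam.1).
Proof.
move=> HA OA Ot at_; have [_ _ tmu] := mu_volume.
set y := (Phi t lam).1 in at_ *; set c := chart_at y.
have cy : dom c y by exact: dom_chart_at.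
have [_ _ Adom _] := HA.
pose phi p := (Psi Phi lam (t, (chart_map a lam.1, p))).1.
have phiE p : phi p = chart_map a (Phi t (lam.1, p)).1 by rewrite /phi Psi_fiber.
have phi0 : phi lam.2 = chart_map a y by rewrite phiE /y; case: (lam).
have dphi : differentiable phi lam.2 by exact: (Psi_fiber_differentiable HA OA Ot).
have dtr : differentiable (trans a c) (phi lam.2).
  by rewrite phi0; apply: trans_differentiable; exists y.
have e := jacobian_comp dphi dtr.
have ejac : jacobian (fun p => chart_map c (Phi t (lam.1, p)).1) lam.2 =
    fiber_dx Phi lam t *m tmx a c y.
  apply: (etrans (esym (near_eq_jacobian _ (differentiable_comp dphi dtr)))).
    near=> p; have := Adom (t, (chart_map a lam.1, p)).
    rewrite /= ct_param_fiber => H.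
    have [_ dp] : dPhi (t, (lam.1, p)) /\ dom a (Phi t (lam.1, p)).1.
      by apply: H; near: p; exact: (near_fiber_domain HA OA Ot).
    by rewrite /= phiE trans_chart.
  apply: (etrans e); rewrite phi0.
  by apply: (congr1 (fun N => N *m _)); exact: (jacobian_Psi_fiber HA OA Ot).
rewrite /fiber_volume /vform_eval /vform_density invrK.
rewrite -/y -/c.
apply: (etrans (congr1 (fun N => mu c (chart_map c y) * \det N * mu a (chart_map a lam.1)) ejac)).
have tm : mu a (geo_x Phi lam t) = mu c (chart_map c y) * \det (tmx a c y) by exact: tmu.
rewrite det_mulmx tm.
by move: (\det (fiber_dx _ _ _)) (\det (tmx a c y)) => d q; ring.
Unshelve. all: by end_near. Qed.

Lemma volume_frame_chart (U : set M) (Y : 'I_n -> vfield M) x : (forall i, gvf U (Y i)) -> U x ->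
  dom a x -> vform_eval mu x (frame_mx Y x) = 1 ->
  mu a (chart_map a x) * \det (fmx a Y (chart_map a x)) = 1.
Proof.
move=> gY Ux ax; have [_ _ tmu] := mu_volume.
rewrite (frame_mx_chart gY Ux ax) /vform_eval /vform_density det_mulmx => H.
have tm : mu a (chart_map a x) =
    mu (chart_at x) (chart_map (chart_at x) x) * \det (tmx a (chart_at x) x).
  exact: tmu (dom_chart_at x).
rewrite tm -[RHS]H.
by move: (\det (fmx _ _ _)) (\det (tmx _ _ _)) => d q; ring.
Qed.

End FiberVolume.

Lemma near0_ball {R : realType} (P : set R) : (\forall t \near (0 : R), P t) ->
  exists2 e : R, 0 < e & forall t, ball (0 : R) e t -> P t.
Proof. by move=> /nbhs_ballP[e e0 eP]; exists e. Qed.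

(** Each quotient frame comes with a radius of its own; finitely many radii have a positive
    minimum. *)
Lemma common_frame_ball {R : realType} {n k : nat} {M : smoothManifold R n}
  (X : 'I_k -> vfield M) (gam : R -> M) (T : vfield M) (Y : 'I_n -> vfield M)
  (d : nat -> nat) (E : forall i, R -> 'M[R]_(d i, n)) (m : nat) :
  (forall i, (1 <= i <= m)%N -> smooth_quotient_frame X gam T Y i (E i)) ->
  exists2 e : R, 0 < e & forall i, (i < m)%N ->
    smx (ball (0 : R) e) (E i.+1) /\
    forall t, ball (0 : R) e t -> quotient_basis X gam T Y i.+1 t (E i.+1 t).
Proof.
elim: m => [|m IH] H; first by exists 1.
have [|e e0 He] := IH; first by move=> i /andP[i1 im]; apply: H; rewrite i1 ltnW.
have [|e' e'0 [sE qE]] := H m.+1; first by rewrite /=.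
have oB : open (ball (0 : R^o) e') by exact: ball_open.
have sE' := smooth_on_smx oB sE.
exists (Num.min e e'); first by rewrite lt_min e0.
have be t : ball (0 : R) (Num.min e e') t -> ball (0 : R) e t /\ ball (0 : R^o) e' t.
  by rewrite /ball /= lt_min => /andP[].
move=> i; rewrite ltnS leq_eqVlt => /orP[/eqP ->|im].
  split; last by move=> t /be[_]; exact: qE.
  by move=> r s; apply: smS (sE' r s) => t /be[].
have [s q] := He i im; split; last by move=> t /be[/q].
by move=> r c; apply: smS (s r c) => t /be[].
Qed.

Lemma isd_is_volume_derivative {R : realType} (O : set R) (f : R -> R) N (g : R -> R) c rho :
  open O -> O 0 -> 0 < c -> (forall t, O t -> f t = g t) ->
  isd (fun t => ln (if t == 0 then c else t ^- N * g t)) 0 rho ->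
  is_volume_geodesic_derivative f N rho.
Proof.
move=> oO O0 c0 fg H; exists c => //.
have e : {in O, (fun t => ln (if t == 0 then c else t ^- N * g t)) =1
    (fun t => ln (if t == 0 then c else t ^- N * f t))}.
  by move=> t /set_mem Ot; rewrite fg.
have [d1 d2] := eq_on_isd oO e O0 H.
by apply: DeriveDef; [rewrite -dableE|rewrite -derive1E].
Qed.

Theorem mainTheorem3 (R : realType) (n k : nat) (M : smoothManifold R n)
  (M_connected : connected [set: M])
  (k_le_n : (k <= n)%N)
  (X0 : vfield M) (X : 'I_k -> vfield M) (Q : M -> R)
  (X0_smooth : smooth_vfield X0)
  (X_smooth : forall i, smooth_vfield (X i))
  (Q_smooth : smooth_function Q)
  (X_independent : everywhere_independent X)
  (X_Lie : Lie_condition X0 X)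
  (mu : vform M) (mu_volume : volume_form mu)
  (* the Hamiltonian flow and the geodesic gamma, on an open interval I *)
  (dPhi : set (R * cotangent M)) (Phi : R -> cotangent M -> cotangent M)
  (Phi_flow : hamiltonian_flow X0 X Q dPhi Phi)
  (lam : cotangent M)
  (I : set R) (I_open : open I) (I_interval : is_interval I) (I0 : I 0)
  (I_dPhi : forall t, I t -> dPhi (t, lam))
  (gam : R -> M) (gamE : forall t, gam t = (Phi t lam).1)
  (* the flag of gamma *)
  (T : vfield M) (T_admissible : admissible_extension X0 X gam I T)
  (gam_ample : ample X gam I T)
  (gam_equiregular : equiregular X gam I T)
  (m : nat) (m_step : is_step X gam I T m)
  (* the local frame Y around x0 = lam.1 *)
  (Y : 'I_n -> vfield M) (U : set M) (U_open : open U) (U_x0 : U lam.1)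
  (Y_smooth : forall i, smooth_vfield_on U (Y i))
  (Y_orthonormal :
     orthonormal_basis_on X U (fun i : 'I_k => Y (widen_ord k_le_n i)))
  (Y_basis : forall x, U x -> frame_mx Y x \in unitmx)
  (Y_mu : forall x, U x -> vform_eval mu x (frame_mx Y x) = 1)
  (* smooth orthonormal frames of the quotients D / ker L_T^(i-1) *)
  (E : forall i, R -> 'M[R]_(growth X gam T i, n))
  (E_frame : forall i, (1 <= i <= m)%N ->
     smooth_quotient_frame X gam T Y i (E i)) :
  is_volume_geodesic_derivative
    (fiber_volume mu Phi lam) (geodesic_dimension X gam T m)
    (2^-1 * \sum_(1 <= i < m.+1) trace_term X gam T Y i (E i)).
Proof.
have gameq : gam = fun t => (Phi t lam).1 by apply/funext.
subst gam.
set gam := fun t => (Phi t lam).1 in E T_admissible m_step E_frame gam_ample gam_equiregular gamE *.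
have gX0 : gvf setT X0 := gvf_smooth openT X0_smooth.
have gX i : gvf setT (X i) := gvf_smooth openT (X_smooth i).
have gY i : gvf U (Y i) := gvf_smooth U_open (Y_smooth i).
have [[V sV TE] gamT] := T_admissible.
have gT : gvf setT T.
  have [sV' _] := sV; have [s0 t0] := gX0; have [s1 t1] := gvf_smooth openT sV'.
  rewrite TE; split=> [b j|b b' x Ux bx b'x].
    have oW : open (chart_map b @` (dom b `&` [set: M])) by apply: open_chart_image; exact: openT.
    apply: (eq_on_smf oW (f := fun u => X0 b u 0 j + V b u 0 j)).
      by move=> u _; rewrite mxE.
    exact: (smfD oW).
  by rewrite /Defs.addvf mulmxDl (t0 b b' x)// (t1 b b' x).
set a := chart_at lam.1.
have [A HA] := flow_domain_exists Phi_flow lam.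
have [oA A0 Adom _] := HA.
have cgam t : I t -> {for t, continuous gam}.
  by move=> /I_dPhi/(flow_hamilton Phi_flow)[].
have gam0 : gam 0 = lam.1 by rewrite /gam; have [_ ->] := flow_init Phi_flow lam.
(* A ball of times on which the curve stays in the domain of the frame [Y] and the flow is smooth in
   the fixed chart. *)
have [e1 e10 He1] : exists2 e : R, 0 < e & forall t, ball (0 : R) e t ->
    [/\ I t, A (t, (chart_map a lam.1, lam.2)) & U (gam t)].
  apply: near0_ball.
  have nI : \forall t \near (0 : R), I t by apply: open_nbhs_nbhs.
  have nU : \forall t \near (0 : R), U (gam t).
    by apply: (cgam 0 I0); rewrite gam0; apply: open_nbhs_nbhs.
  pose h : R^o * ('rV[R]_n * 'rV[R]_n) := (1, (0, 0)).
  have [r r0 Hr] := plane_near h h (open_nbhs_nbhs (conj oA A0)).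
  near=> t; split; [by near: t| |by near: t].
  have tr : `|t| < r by near: t; apply/nbhs_ballP; exists r => //= s; rewrite /ball /= sub0r normrN.
  have := Hr t 0 tr; rewrite normr0 scale0r addr0 => /(_ r0).
  congr (A _); rewrite /h; congr (_, (_, _)) => /=.
  - by rewrite add0r; exact: mulr1.
  - by rewrite scaler0 addr0.
  - by rewrite scaler0 addr0.
have [e2 e20 He2] := common_frame_ball E_frame.
pose O : set R := ball (0 : R) (Num.min e1 e2).
have O12 t : O t -> ball (0 : R) e1 t /\ ball (0 : R) e2 t.
  by rewrite /O /ball /= lt_min => /andP[].
have m0 : 0 < Num.min e1 e2 by rewrite lt_min e10.
have oO : open O by exact: (@ball_open _ R^o).
have O0 : O 0 by exact: ballxx.
have OI t : O t -> I t by move=> /O12[/He1[]].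
have OA t : O t -> A (t, (chart_map a lam.1, lam.2)) by move=> /O12[/He1[]].
have Ugam t : O t -> U (gam t) by move=> /O12[/He1[]].
have agam t : O t -> dom a (gam t).
  move=> Ot; have [_] := Adom _ (OA t Ot).
  by rewrite /= ct_param_fiber -surjective_pairing.
pose gx := geo_x Phi lam; pose gp := geo_p Phi lam.
have sgx : smx O gx := smx_geo_x HA oO OA.
have sgp : smx O gp := smx_geo_p HA oO OA.
have Wgx t : O t -> (chart_map a @` dom a) (gx t) by move=> Ot; exists (gam t) => //; exact: agam.
have gx_der t j : O t -> isd (fun s => chart_map a (gam s) 0 j) t (T a (chart_map a (gam t)) 0 j).
  move=> Ot; apply: (admissible_chart gT (cgam t (OI t Ot)) (agam t Ot)).
  exact: gamT (OI t Ot).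
have sQ b : smf (chart_map b @` dom b) (fun u => Q (param b u)) by exact: Q_smooth.
have lX0 j : smf (chart_map a @` dom a) (fun u => X0 a u 0 j) by exact: gvf_dom.
have lX i j : smf (chart_map a @` dom a) (fun u => X i a u 0 j) by exact: gvf_dom.
pose D := zcm a gam Y X; pose Lam := clam a gam Y T.
have gXU i : gvf U (X i) by apply: gvfS (gX i).
have gTU : gvf U T by apply: gvfS gT.
have sD : smx O D := smx_zcm oO agam Ugam sgx gY Y_basis gXU.
have sLam : smx O Lam := smx_clam oO agam Ugam sgx gY Y_basis gTU.
have DD t : O t -> D t *m (D t)^T = 1%:M.
  move=> Ot.
  have <- : distr_comp X gam Y t = D t by exact: (distr_compE agam Ugam gY Y_basis X_smooth Ot).
  exact: (orthonormal_frame_gram Y_orthonormal (Ugam t Ot) (Y_basis _ (Ugam t Ot))).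
pose F i t := ycomp gam Y t (flag X gam T i t).
have F0 t (Ot : O t) : F 0%N t = 0 :=
  flag_jets0 oO U_open agam Ugam sgx gY Y_basis X_smooth gT gx_der DD Ot.
have FS i t (Ot : O t) : (F i.+1 t :=: F i t + njet D Lam i t)%MS :=
  flag_jetsS oO U_open agam Ugam sgx gY Y_basis X_smooth gT gx_der DD i Ot.
have F_full t : O t -> row_full (F m t).
  move=> Ot; have [/(_ t (OI t Ot)) + _] := m_step.
  rewrite /F /ycomp /row_full mxrankMfree// row_free_unit unitmx_inv.
  exact: Y_basis (Ugam t Ot).
(* Shift by one: [E' i] is the frame of the quotient by the kernel of L_T^i. *)
pose E' i := E i.+1.
have sE' i : (i < m)%N -> smx O (E' i).
  by move=> im r c; have [s _] := He2 i im; apply: smS (s r c) => t /O12[].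
have qE' i t : (i < m)%N -> O t -> quotient_basis X gam T Y i.+1 t (E' i t).
  by move=> im /O12[_]; have [_] := He2 i im; apply.
have EE := quotient_ortho qE'.
have EK := quotient_kernel oO U_open agam Ugam sgx gY Y_basis X_smooth gT gx_der DD qE'.
(* The flag is full at step [m], so its growth numbers add up to [n]. *)
have dn : (\sum_(i < m) growth X gam T i.+1)%N = n.
  by rewrite sum_growth; have [/(_ 0 I0)/eqP] := m_step.
have [w [Sel HS]] := @block_selection_exists R m n (fun i => growth X gam T i.+1) dn.
pose ym := ymx a gam Y.
have sym : smx O ym := smx_ymx oO agam Ugam sgx gY.
have uym t : O t -> ym t \in unitmx by move=> Ot; exact: (ymx_unit agam Ugam gY Y_basis Ot).
have siym : smx O (fun t => invmx (ym t)) := smx_inv oO uym sym.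
pose xp t := ham_xp (X0 a) (X^~ a) (gp t) (gx t).
pose xx t := ham_xx (X0 a) (X^~ a) (Q \o param a) (gp t) (gx t).
have sxp : smx O xp := smx_ham_xp lX0 lX oO sgx sgp Wgx.
have sxx : smx O xx := smx_ham_xx lX0 lX (sQ a) oO sgx sgp Wgx.
(* The linearized system in components with respect to [Y], by the same kind of gauge transformation
   as in [fsys]. *)
pose ay t := (ym t *m xp t - dmx ym t) *m invmx (ym t).
pose cy t := ym t *m xx t *m (ym t)^T.
have say : smx O ay.
  apply: (smxM oO) => //; apply: (smxB oO); first exact: (smxM oO).
  exact: (smx_dmx sym).
have scy : smx O cy.
  by apply: (smxM oO); [exact: (smxM oO)|exact: (smxT sym)].
have cysym t : O t -> (cy t)^T = cy t.
  move=> Ot; rewrite /cy !trmx_mul trmxK mulmxA.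
  apply: (congr1 (fun N => ym t *m N *m (ym t)^T)).
  have oWa : open (chart_map a @` dom a) by exact: open_chart_map_dom.
  exact: (ham_xx_sym oWa lX0 lX (sQ a) (gp t) (Wgx t Ot)).
have ayD t : O t -> ((ay t + Lam t)%R <= D t)%MS.
  (* The derivatives of the frame cancel, leaving the difference between the linearizations of
     Hamilton's equations and of [T]. *)
  move=> Ot; have -> : ay t + Lam t = ym t *m (xp t - tau a gam T t) *m invmx (ym t).
    rewrite /ay /Lam /clam -/(ym) -mulmxDl mulmxBr; congr (_ *m _).
    by rewrite addrA subrK.
  apply: submxMr; apply: (submx_trans (submxMl _ _)).
  rewrite TE; apply: (lin_xp_sub gX0 gX X_independent sV (agam t Ot)) => j.
  (* The velocity of the geodesic computed twice, from [T] and from Hamilton's equations. *)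
  rewrite -TE; apply: (isd_unique (gx_der t j Ot)).
  exact: (isd_geo_x gX0 gX sQ Phi_flow HA OA j Ot).
pose LAt := fiber_dx Phi lam; pose LBt := fiber_dp Phi lam.
have dLA t i j : O t -> isd (fun s => LAt s i j) t
    ((LAt t *m xp t + LBt t *m ham_pp (X^~ a) (gx t)) i j).
  by move=> Ot; exact: (isd_fiber_dx gX0 gX sQ Phi_flow HA OA i j Ot).
have dLB t i j : O t -> isd (fun s => LBt s i j) t
    ((- (LAt t *m xx t) - LBt t *m (xp t)^T) i j).
  by move=> Ot; exact: (isd_fiber_dp gX0 gX sQ Phi_flow HA OA i j Ot).
pose Ay t := LAt t *m invmx (ym t); pose By t := LBt t *m (ym t)^T.
have dAy t i j : O t ->
    isd (fun s => Ay s i j) t ((Ay t *m ay t + By t *m ((D t)^T *m D t)) i j).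
  move=> Ot.
  have H := isd_mulmx i j (fun r c => dLA t r c Ot) (smx_isd siym Ot).
  apply: (isd_eq H); rewrite (dmx_inv oO uym sym Ot).
  apply: (congr1 (fun N : 'M[R]_n => N i j)).
  have VF : invmx (ym t) *m ym t = 1%:M by rewrite mulVmx// uym.
  have DE : By t *m ((D t)^T *m D t) = LBt t *m ham_pp (X^~ a) (gx t) *m invmx (ym t).
    rewrite /By /D /zcm -/ym /ham_pp trmx_mul !mulmxA.
    rewrite -[LBt t *m (ym t)^T *m _]mulmxA -trmx_mul VF trmx1 mulmx1.
    by [].
  rewrite DE mulmxDl /Ay /ay mulmxBl mulmxBr !mulmxA.
  rewrite -[LAt t *m invmx (ym t) *m ym t]mulmxA VF mulmx1 mulmxN !mulmxA.
  by rewrite addrAC.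
have dBy t i j : O t ->
    isd (fun s => By s i j) t ((- (Ay t *m cy t) - By t *m (ay t)^T) i j).
  move=> Ot.
  have symT : smx O (fun s => (ym s)^T) by exact: smxT.
  have H := isd_mulmx i j (fun r c => dLB t r c Ot) (smx_isd symT Ot).
  apply: (isd_eq H); rewrite dmxT.
  apply: (congr1 (fun N : 'M[R]_n => N i j)).
  have VF : invmx (ym t) *m ym t = 1%:M by rewrite mulVmx// uym.
  have VFT : (ym t)^T *m (invmx (ym t))^T = 1%:M by rewrite -trmx_mul VF trmx1.
  rewrite /Ay /cy /By /ay !mulmxA -[LAt t *m invmx (ym t) *m ym t]mulmxA VF mulmx1.
  rewrite trmx_mul !mulmxA -[LBt t *m (ym t)^T *m _]mulmxA VFT mulmx1.
  rewrite linearB/= trmx_mul mulmxBr mulmxBl mulNmx !mulmxA.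
  by rewrite opprB [RHS]addrA [LHS]addrAC.
have LA00 : LAt 0 = 0 := fiber_dx0 Phi_flow HA OA O0.
have LB00 : LBt 0 = 1%:M := fiber_dp0 Phi_flow HA OA O0.
have Ay0 : Ay 0 = 0 by rewrite /Ay LA00 mul0mx.
(* Not the identity, as the fibre coordinates are those of the chart; dividing by this determinant
   later accounts for the dual volume on the initial fibre. *)
have By0 : By 0 = (ym 0)^T by rewrite /By LB00 mul1mx.
have uBy0 : By 0 \in unitmx by rewrite By0 unitmx_tr uym.
have [r r0 Hr] := flow_log_derivative oO sD sLam DD F0 FS F_full sE' EE EK HS say scy cysym ayD
  O0 dAy dBy Ay0 uBy0.
have -> : \sum_(1 <= i < m.+1) trace_term X gam T Y i (E i) =
    \sum_(i < m) \tr (invmx (FYgram D Lam E' i 0) *m dmx (FYgram D Lam E' i) 0).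
  rewrite big_add1 /= big_mkord; apply: eq_bigr => i _.
  exact: (trace_term_gram oO U_open agam Ugam sgx gY Y_basis X_smooth gT gx_der DD qE' O0 sE' (ltn_ord i)).
rewrite geodesic_dimensionE.
apply: (isd_is_volume_derivative oO O0 r0 _ Hr) => t Ot.
(* Since mu(Y) = 1, the density of [mu] in the chart is the inverse determinant of the frame; hence
   f(t) is the quotient of the determinants of [Ay t] and [By 0]. *)
have vol s : O s -> mu a (gx s) = (\det (ym s))^-1.
  move=> Os.
  have H := volume_frame_chart mu_volume gY (Ugam s Os) (agam s Os) (Y_mu _ (Ugam s Os)).
  have d0 : \det (ym s) != 0 by rewrite -unitfE -unitmxE uym.
  by apply: (mulIf d0); rewrite mulVf.
rewrite (fiber_volumeE mu_volume HA OA Ot (agam t Ot)).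
have g0 : chart_map a lam.1 = gx 0 by rewrite /gx /geo_x -/(gam 0) gam0.
rewrite -/a g0 !vol// /Ay By0 det_mulmx det_tr det_inv.
by rewrite [X in X * _]mulrC.
Unshelve. all: by end_near. Qed.
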